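(* Let $A$ be a Hopf algebra with bijective antipode and let $(\Lambda^1,\theta)$ define an inner generalised first order bicovariant differential calculus, where $\Lambda^1$ is a right $A$-crossed module and $\theta\in\Lambda^1$ is such that $\Delta_R\theta=\theta\otimes1$. Let $$\Lambda_\theta(\Lambda^1)=T_-\Lambda^1/\langle\theta^2\triangleleft a,\ [\theta^2,\eta]\ \mid\ a\in A^+,\ \eta\in\Lambda^1\rangle.$$ Then $\Omega_\theta(A)=A\#\Lambda_\theta(\Lambda^1)$ with $\mathrm{d}=[\theta,\ \}$ is an inner strongly bicovariant differential exterior algebra on $A$. Conversely, any inner strongly bicovariant differential exterior algebra on $A$ with $\theta$ right-invariant and which is generated by its degrees $0,1$ is isomorphic to a quotient of $\Omega_\theta(A)$ for some right $A$-crossed module $\Lambda^1$.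
   Context: We work over a field $k$ of characteristic not $2$. $A^+=\ker\epsilon$, $\pi(a)=a-\epsilon(a)1$. A right $A$-crossed module is a vector space $V$ with right action $\triangleleft$ and right coaction $\Delta_Rv=v_0\otimes v_1$ of $A$ such that $\Delta_R(v\triangleleft a)=v_0\triangleleft a_{(2)}\otimes(Sa_{(1)})v_1a_{(3)}$; these form a braided category with $\Psi(v\otimes w)=w_0\otimes v\triangleleft w_1$. The first order calculus defined by $(\Lambda^1,\theta)$ is $\Omega^1=A\otimes\Lambda^1$ with $\mathrm{d}a=a_{(1)}\otimes\theta\triangleleft\pi(a_{(2)})=\theta a-a\theta$. $T_-\Lambda^1$ is the tensor algebra with the braided-super Hopf algebra structure in which $\Lambda^1$ is odd and $\underline\Delta v=v\otimes1+1\otimes v$ for $v\in\Lambda^1$; the angle brackets denote the two-sided ideal generated. For a braided-super Hopf algebra $\Lambda$ in the category of right $A$-crossed modules, $A\#\Lambda$ is the super-Hopf algebra $A\otimes\Lambda$ with $(a\otimes\eta)(b\otimes\zeta)=ab_{(1)}\otimes(\eta\triangleleft b_{(2)})\zeta$ and $\Delta(a\otimes\eta)=a_{(1)}\otimes(\eta^1)_0\otimes a_{(2)}(\eta^1)_1\otimes\eta^2$, where $\underline\Delta\eta=\eta^1\otimes\eta^2$. $[\theta,u\}=\theta u-(-1)^{|u|}u\theta$. A strongly bicovariant differential exterior algebra over $A$ is a graded super-Hopf algebra $\Omega=\oplus_{n\ge0}\Omega^n$ with $\Omega^0=A$ (parity given by the degree) with a degree $1$ map $\mathrm{d}$ with $\mathrm{d}^2=0$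 that is a super-derivation and a super-coderivation, $\Delta\mathrm{d}=(\mathrm{d}\otimes\mathrm{id}+(-1)^{|\ |}\otimes\mathrm{d})\Delta$. It is inner if $\mathrm{d}=[\theta,\ \}$ for some $\theta\in\Omega^1$. Its right coaction of $A$ is $\Delta_R=(\mathrm{id}\otimes\Pi)\Delta$, with $\Pi:\Omega\to A$ the projection to degree $0$; $\theta$ is right-invariant if $\Delta_R\theta=\theta\otimes1$.
   Formalization: In the converse, θ is assumed left-invariant (i.e. θ ∈ Λ¹) as well as right-invariant; with right-invariance alone the converse is false (e.g. A = k[x], Λ¹ = ⟨t,c⟩, Δ_R t = t⊗1 + c⊗x, θ = t − xc). *)

(* Defs.v *)
From HB Require Import structures.
From mathcomp Require Import all_boot all_algebra.
From mathcomp Require Import boolp classical_sets.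

Set Implicit Arguments.
Unset Strict Implicit.
Unset Printing Implicit Defensive.

Import GRing.Theory.
Local Open Scope classical_set_scope.
Local Open Scope quotient_scope.
Local Open Scope ring_scope.

Record is_subspace (K : fieldType) (V : lmodType K) (W : set V) : Prop := {
  subspace0 : W 0;
  subspaceP : forall c x y, W x -> W y -> W (c *: x + y) }.

Definition lspan (K : fieldType) (V : lmodType K) (I : set V) : set V :=
  smallest (@is_subspace K V) I.

Section QuotientSpace.
Variables (K : fieldType) (V : lmodType K) (I : set V).

Lemma lspan_subspace : is_subspace (lspan I).
Proof.
split=> [W [sW _]|c x y Ix Iy W [sW IW]]; first exact: subspace0 sW.
by apply: (subspaceP sW); [apply: Ix | apply: Iy].
Qed.

Let span0 : lspan I 0 := subspace0 lspan_subspace.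

Let spanD x y : lspan I x -> lspan I y -> lspan I (x + y).
Proof. by move=> Ix Iy; rewrite -[x]scale1r; apply: (subspaceP lspan_subspace). Qed.

Let spanZ c x : lspan I x -> lspan I (c *: x).
Proof. by move=> Ix; rewrite -[_ *: _]addr0; apply: (subspaceP lspan_subspace). Qed.

Definition qrel (x y : V) : bool := `[< lspan I (x - y) >].

Let qrel_equiv : equiv_class_of qrel.
Proof.
split=> [x|x y|y x z]; first by apply/asboolP; rewrite subrr.
- suff sym u v : qrel u v -> qrel v u by apply/idP/idP; apply: sym.
  by move=> /asboolP /(spanZ (-1)) h; apply/asboolP; rewrite scaleN1r opprB in h.
- move=> /asboolP h1 /asboolP h2; apply/asboolP.
  by rewrite -(subrK y x) -addrA; apply: spanD.
Qed.

Canonical qrel_eqv := EquivRelPack qrel_equiv.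

(* The quotient of V by the subspace spanned by I. *)
Definition quot : Type := {eq_quot qrel_eqv}.
HB.instance Definition _ : EqQuotient _ qrel_eqv quot := EqQuotient.on quot.
HB.instance Definition _ := Choice.on quot.

Definition proj (x : V) : quot := \pi_quot x.

Lemma projP x y : proj x = proj y <-> lspan I (x - y).
Proof.
by rewrite /proj; split=> [/eqquotP/asboolP|h] //; apply/eqquotP/asboolP.
Qed.

Let zero_quot := proj 0.
Let opp_quot (x : quot) := proj (- repr x).
Let add_quot (x y : quot) := proj (repr x + repr y).
Let scale_quot (c : K) (x : quot) := proj (c *: repr x).

Let proj_repr (x : quot) : proj (repr x) = x.
Proof. by rewrite /proj reprK. Qed.

Let repr_proj x : lspan I (repr (proj x) - x).
Proof. by apply/projP; rewrite proj_repr. Qed.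

Let projD x y : add_quot (proj x) (proj y) = proj (x + y).
Proof.
by apply/projP; rewrite opprD addrACA; apply: spanD; apply: repr_proj.
Qed.

Let projN x : opp_quot (proj x) = proj (- x).
Proof.
by apply/projP; rewrite -opprD -[- (_ + _)]scaleN1r; apply: spanZ; apply: repr_proj.
Qed.

Let projZ c x : scale_quot c (proj x) = proj (c *: x).
Proof. by apply/projP; rewrite -scalerBr; apply: spanZ; apply: repr_proj. Qed.

Let addA : associative add_quot.
Proof.
move=> x y z; rewrite -(proj_repr x) -(proj_repr y) -(proj_repr z).
by rewrite !projD addrA.
Qed.

Let addC : commutative add_quot.
Proof. by move=> x y; rewrite /add_quot addrC. Qed.

Let add0 : left_id zero_quot add_quot.
Proof. by move=> x; rewrite -(proj_repr x) projD add0r. Qed.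

Let addN : left_inverse zero_quot opp_quot add_quot.
Proof. by move=> x; rewrite -(proj_repr x) projN projD addNr. Qed.

HB.instance Definition _ := GRing.isZmodule.Build quot addA addC add0 addN.

Let scaleA a b x : scale_quot a (scale_quot b x) = scale_quot (a * b) x.
Proof. by rewrite -(proj_repr x) !projZ scalerA. Qed.

Let scale1 : left_id 1 scale_quot.
Proof. by move=> x; rewrite -(proj_repr x) projZ scale1r. Qed.

Let scaleDr : right_distributive scale_quot +%R.
Proof.
move=> c x y; rewrite -(proj_repr x) -(proj_repr y).
by rewrite [_ + _]projD !projZ [RHS]projD scalerDr.
Qed.

Let scaleDl x : {morph scale_quot^~ x : a b / a + b}.
Proof. by move=> a b; rewrite -(proj_repr x) !projZ [RHS]projD scalerDl. Qed.

HB.instance Definition _ :=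
  GRing.Zmodule_isLmodule.Build K quot scaleA scale1 scaleDr scaleDl.

Lemma proj_linear : linear proj.
Proof. by move=> c x y; rewrite -projD -projZ. Qed.

End QuotientSpace.

Definition bilinear (K : fieldType) (V W U : lmodType K) (f : V -> W -> U) :=
  (forall v, linear (f v)) /\ (forall w, linear (f^~ w)).

Section TensorProduct.
Variables (K : fieldType) (V W : lmodType K).

Definition tsum (U : lmodType K) (f : V -> W -> U) (s : seq (V * W)) : U :=
  \sum_(p <- s) f p.1 p.2.

(* Formal sums of simple tensors are identified when no bilinear map separates
   them. *)
Definition trel (s t : seq (V * W)) : bool :=
  `[< forall (U : lmodType K) (f : V -> W -> U), bilinear f ->
      tsum f s = tsum f t >].

Let trel_equiv : equiv_class_of trel.
Proof.
split=> [s|s t|t s u]; first by apply/asboolP.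
- by apply/idP/idP => /asboolP h; apply/asboolP => U f /h.
- move=> /asboolP h1 /asboolP h2; apply/asboolP=> U f bf.
  by rewrite (h1 _ _ bf) (h2 _ _ bf).
Qed.

Canonical trel_eqv := EquivRelPack trel_equiv.

Definition tens : Type := {eq_quot trel_eqv}.
HB.instance Definition _ : EqQuotient _ trel_eqv tens := EqQuotient.on tens.
HB.instance Definition _ := Choice.on tens.

Let tpi (s : seq (V * W)) : tens := \pi_tens s.

Let tpiP s t : tpi s = tpi t <-> forall (U : lmodType K) (f : V -> W -> U),
  bilinear f -> tsum f s = tsum f t.
Proof. by rewrite /tpi; split=> [/eqquotP/asboolP|h] //; apply/eqquotP/asboolP. Qed.

Let tpi_repr x : tpi (repr x) = x. Proof. by rewrite /tpi reprK. Qed.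

Let repr_tpi s (U : lmodType K) (f : V -> W -> U) :
  bilinear f -> tsum f (repr (tpi s)) = tsum f s.
Proof. by move: U f; apply/tpiP; rewrite tpi_repr. Qed.

Let zscale (c : K) (s : seq (V * W)) := [seq (c *: p.1, p.2) | p <- s].

Let tsum_cat (U : lmodType K) (f : V -> W -> U) s t :
  tsum f (s ++ t) = tsum f s + tsum f t.
Proof. exact: big_cat. Qed.

Let tsum_zscale (U : lmodType K) (f : V -> W -> U) c s :
  bilinear f -> tsum f (zscale c s) = c *: tsum f s.
Proof.
move=> [_ lf]; rewrite /tsum big_map scaler_sumr; apply: eq_bigr => p _ /=.
have f0 : f 0 p.2 = 0.
  have := lf p.2 1 0 0; rewrite !scale1r addr0 => h.
  by apply/(addrI (f 0 p.2)); rewrite addr0 -h.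
by have := lf p.2 c p.1 0; rewrite !addr0 f0 addr0.
Qed.

Let zero_tens := tpi [::].
Let opp_tens (x : tens) := tpi (zscale (-1) (repr x)).
Let add_tens (x y : tens) := tpi (repr x ++ repr y).
Let scale_tens (c : K) (x : tens) := tpi (zscale c (repr x)).

Let tpiD s t : add_tens (tpi s) (tpi t) = tpi (s ++ t).
Proof. by apply/tpiP => U f bf; rewrite !tsum_cat !repr_tpi. Qed.

Let tpiZ c s : scale_tens c (tpi s) = tpi (zscale c s).
Proof. by apply/tpiP => U f bf; rewrite !tsum_zscale // repr_tpi. Qed.

Let addA : associative add_tens.
Proof.
move=> x y z; rewrite -(tpi_repr x) -(tpi_repr y) -(tpi_repr z).
by rewrite !tpiD catA.
Qed.

Let addC : commutative add_tens.
Proof. by move=> x y; apply/tpiP=> U f bf; rewrite !tsum_cat addrC. Qed.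

Let add0 : left_id zero_tens add_tens.
Proof. by move=> x; rewrite -(tpi_repr x) tpiD. Qed.

Let addN : left_inverse zero_tens opp_tens add_tens.
Proof.
move=> x; rewrite -(tpi_repr x) [opp_tens _]tpiZ tpiD; apply/tpiP=> U f bf.
by rewrite tsum_cat tsum_zscale // scaleN1r addNr /tsum big_nil.
Qed.

HB.instance Definition _ := GRing.isZmodule.Build tens addA addC add0 addN.

Let scaleA a b x : scale_tens a (scale_tens b x) = scale_tens (a * b) x.
Proof.
rewrite -(tpi_repr x) !tpiZ; apply/tpiP=> U f bf.
by rewrite !tsum_zscale // scalerA.
Qed.

Let scale1 : left_id 1 scale_tens.
Proof.
by move=> x; rewrite -(tpi_repr x) tpiZ; apply/tpiP=> U f bf; rewrite tsum_zscale // scale1r.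
Qed.

Let scaleDr : right_distributive scale_tens +%R.
Proof.
move=> c x y; rewrite -(tpi_repr x) -(tpi_repr y) [_ + _]tpiD !tpiZ [RHS]tpiD.
by rewrite /zscale map_cat.
Qed.

Let scaleDl x : {morph scale_tens^~ x : a b / a + b}.
Proof.
move=> a b; rewrite -(tpi_repr x) !tpiZ [RHS]tpiD; apply/tpiP=> U f bf.
by rewrite tsum_cat !tsum_zscale // scalerDl.
Qed.

HB.instance Definition _ :=
  GRing.Zmodule_isLmodule.Build K tens scaleA scale1 scaleDr scaleDl.

Definition pure (v : V) (w : W) : tens := \pi_tens [:: (v, w)].

(* For bilinear f this is the linear map on the tensor product induced by f;
   it depends on the choice of representatives otherwise. *)
Definition tlift (U : lmodType K) (f : V -> W -> U) (t : tens) : U :=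
  tsum f (repr t).

Lemma tlift_linear (U : lmodType K) (f : V -> W -> U) :
  bilinear f -> linear (tlift f).
Proof.
move=> bf c x y; rewrite -(tpi_repr x) -(tpi_repr y) [c *: _]tpiZ [_ + _]tpiD.
by rewrite /tlift !repr_tpi // tsum_cat tsum_zscale.
Qed.

Lemma tlift_pure (U : lmodType K) (f : V -> W -> U) v w :
  bilinear f -> tlift f (pure v w) = f v w.
Proof. by move=> bf; rewrite /tlift repr_tpi // /tsum big_seq1. Qed.

Lemma pure_bilinear : bilinear pure.
Proof.
split=> [v|w] c x y; rewrite [X in _ = X + _]tpiZ [RHS]tpiD; apply/tpiP=> U f bf.
  by rewrite tsum_cat tsum_zscale // /tsum !big_seq1; apply: bf.1.
by rewrite tsum_cat tsum_zscale // /tsum !big_seq1; apply: bf.2.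
Qed.

Lemma tens_sum (t : tens) : t = \sum_(p <- repr t) pure p.1 p.2.
Proof.
rewrite -{1}(tpi_repr t); elim: (repr t) => [|[v w] s IHs].
  by rewrite big_nil.
by rewrite big_cons -IHs [RHS]tpiD.
Qed.

End TensorProduct.

Arguments tens {K} (V W)%_type_scope.

Notation "V ⊗ W" := (tens V W) (at level 40, left associativity) : type_scope.
Notation "v ⊗ w" := (pure v w) (at level 40, left associativity) : ring_scope.

(* Sweedler notation: for F bilinear in (x, y), \sw_(x, y <- t) F is the value
   at t of the linear map x ⊗ y |-> F. *)
Notation "\sw_ ( x , y <- t ) F" := (tlift (fun x y => F) t)
  (at level 41, F at level 41, x name, y name, t at level 200,
   format "\sw_ ( x ,  y  <-  t )  F") : ring_scope.

Definition tmap (K : fieldType) (V W V' W' : lmodType K)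
    (f : V -> V') (g : W -> W') (t : V ⊗ W) : V' ⊗ W' :=
  \sw_(x, y <- t) f x ⊗ g y.

Section TensorAlgebra.
Variables (K : fieldType) (V : lmodType K).

Definition wsum (U : lmodType K) (F : seq V -> U) (s : seq (K * seq V)) : U :=
  \sum_(p <- s) p.1 *: F p.2.

Definition weval (B : algType K) (f : V -> B) : seq (K * seq V) -> B :=
  wsum (fun w => \prod_(v <- w) f v).

(* Formal combinations of words in V are identified when they have the same
   value under every linear map from V to a K-algebra. *)
Definition wrel (s t : seq (K * seq V)) : bool :=
  `[< forall (B : algType K) (f : V -> B), linear f -> weval f s = weval f t >].

Let wrel_equiv : equiv_class_of wrel.
Proof.
split=> [s|s t|t s u]; first by apply/asboolP.
- by apply/idP/idP => /asboolP h; apply/asboolP => B f /h.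
- move=> /asboolP h1 /asboolP h2; apply/asboolP=> B f lf.
  by rewrite (h1 _ _ lf) (h2 _ _ lf).
Qed.

Canonical wrel_eqv := EquivRelPack wrel_equiv.

Definition talg : Type := {eq_quot wrel_eqv}.
HB.instance Definition _ : EqQuotient _ wrel_eqv talg := EqQuotient.on talg.
HB.instance Definition _ := Choice.on talg.

Let tpi (s : seq (K * seq V)) : talg := \pi_talg s.

Let tpiP s t : tpi s = tpi t <->
  forall (B : algType K) (f : V -> B), linear f -> weval f s = weval f t.
Proof. by rewrite /tpi; split=> [/eqquotP/asboolP|h] //; apply/eqquotP/asboolP. Qed.

Let tpi_repr x : tpi (repr x) = x. Proof. by rewrite /tpi reprK. Qed.

Let repr_tpi s (B : algType K) (f : V -> B) :
  linear f -> weval f (repr (tpi s)) = weval f s.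
Proof. by move: B f; apply/tpiP; rewrite tpi_repr. Qed.

Let wscale (c : K) (s : seq (K * seq V)) := [seq (c * p.1, p.2) | p <- s].
Let wmul (s t : seq (K * seq V)) := [seq (p.1 * q.1, p.2 ++ q.2) | p <- s, q <- t].

Let weval_cat (B : algType K) (f : V -> B) s t :
  weval f (s ++ t) = weval f s + weval f t.
Proof. exact: big_cat. Qed.

Let weval_scale (B : algType K) (f : V -> B) c s :
  weval f (wscale c s) = c *: weval f s.
Proof.
rewrite /weval /wsum big_map scaler_sumr; apply: eq_bigr => p _ /=.
by rewrite scalerA.
Qed.

Let weval_mul (B : algType K) (f : V -> B) s t :
  weval f (wmul s t) = weval f s * weval f t.
Proof.
rewrite /weval /wsum /wmul big_allpairs_dep mulr_suml; apply: eq_bigr => p _.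
rewrite mulr_sumr; apply: eq_bigr => q _ /=.
by rewrite big_cat -scalerAl -scalerAr scalerA.
Qed.

Let zero_talg := tpi [::].
Let one_talg := tpi [:: (1, [::])].
Let opp_talg (x : talg) := tpi (wscale (-1) (repr x)).
Let add_talg (x y : talg) := tpi (repr x ++ repr y).
Let scale_talg (c : K) (x : talg) := tpi (wscale c (repr x)).
Let mul_talg (x y : talg) := tpi (wmul (repr x) (repr y)).

Let weval1 (B : algType K) (f : V -> B) : weval f [:: (1, [::])] = 1.
Proof. by rewrite /weval /wsum big_seq1 big_nil scale1r. Qed.

Let tpiD s t : add_talg (tpi s) (tpi t) = tpi (s ++ t).
Proof. by apply/tpiP => B f lf; rewrite !weval_cat !repr_tpi. Qed.

Let tpiZ c s : scale_talg c (tpi s) = tpi (wscale c s).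
Proof. by apply/tpiP => B f lf; rewrite !weval_scale repr_tpi. Qed.

Let tpiM s t : mul_talg (tpi s) (tpi t) = tpi (wmul s t).
Proof. by apply/tpiP => B f lf; rewrite !weval_mul !repr_tpi. Qed.

Let addA : associative add_talg.
Proof.
move=> x y z; rewrite -(tpi_repr x) -(tpi_repr y) -(tpi_repr z).
by rewrite !tpiD catA.
Qed.

Let addC : commutative add_talg.
Proof. by move=> x y; apply/tpiP=> B f lf; rewrite !weval_cat addrC. Qed.

Let add0 : left_id zero_talg add_talg.
Proof. by move=> x; rewrite -(tpi_repr x) tpiD. Qed.

Let addN : left_inverse zero_talg opp_talg add_talg.
Proof.
move=> x; rewrite -(tpi_repr x) [opp_talg _]tpiZ tpiD; apply/tpiP=> B f lf.
by rewrite weval_cat weval_scale scaleN1r addNr /weval /wsum big_nil.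
Qed.

HB.instance Definition _ := GRing.isZmodule.Build talg addA addC add0 addN.

Let mulA : associative mul_talg.
Proof.
move=> x y z; rewrite -(tpi_repr x) -(tpi_repr y) -(tpi_repr z) !tpiM.
by apply/tpiP=> B f lf; rewrite !weval_mul mulrA.
Qed.

Let mul1 : left_id one_talg mul_talg.
Proof.
move=> x; rewrite -(tpi_repr x) tpiM.
by apply/tpiP=> B f lf; rewrite weval_mul weval1 mul1r.
Qed.

Let mulx1 : right_id one_talg mul_talg.
Proof.
move=> x; rewrite -(tpi_repr x) tpiM.
by apply/tpiP=> B f lf; rewrite weval_mul weval1 mulr1.
Qed.

Let mulDl : left_distributive mul_talg +%R.
Proof.
move=> x y z; rewrite -(tpi_repr x) -(tpi_repr y) -(tpi_repr z).
rewrite [_ + _]tpiD !tpiM [RHS]tpiD.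
by apply/tpiP=> B f lf; rewrite weval_mul !weval_cat !weval_mul mulrDl.
Qed.

Let mulDr : right_distributive mul_talg +%R.
Proof.
move=> x y z; rewrite -(tpi_repr x) -(tpi_repr y) -(tpi_repr z).
rewrite [_ + _]tpiD !tpiM [RHS]tpiD.
by apply/tpiP=> B f lf; rewrite weval_mul !weval_cat !weval_mul mulrDr.
Qed.

Let one_neq0 : one_talg != 0.
Proof.
apply/eqP => /tpiP /(_ K^o (fun=> 0)).
rewrite weval1 /weval /wsum big_nil => h; have /eqP := @oner_neq0 K.
by apply; apply: h => c x y; rewrite scaler0 addr0.
Qed.

HB.instance Definition _ :=
  GRing.Zmodule_isNzRing.Build talg mulA mul1 mulx1 mulDl mulDr one_neq0.

Let scaleA a b x : scale_talg a (scale_talg b x) = scale_talg (a * b) x.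
Proof.
rewrite -(tpi_repr x) !tpiZ; apply/tpiP=> B f lf.
by rewrite !weval_scale scalerA.
Qed.

Let scale1 : left_id 1 scale_talg.
Proof.
by move=> x; rewrite -(tpi_repr x) tpiZ; apply/tpiP=> B f lf; rewrite weval_scale scale1r.
Qed.

Let scaleDr : right_distributive scale_talg +%R.
Proof.
move=> c x y; rewrite -(tpi_repr x) -(tpi_repr y) [_ + _]tpiD !tpiZ [RHS]tpiD.
by rewrite /wscale map_cat.
Qed.

Let scaleDl x : {morph scale_talg^~ x : a b / a + b}.
Proof.
move=> a b; rewrite -(tpi_repr x) !tpiZ [RHS]tpiD; apply/tpiP=> B f lf.
by rewrite weval_cat !weval_scale scalerDl.
Qed.

HB.instance Definition _ :=
  GRing.Zmodule_isLmodule.Build K talg scaleA scale1 scaleDr scaleDl.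

Let scaleAl c (x y : talg) : c *: (x * y) = (c *: x) * y.
Proof.
rewrite -(tpi_repr x) -(tpi_repr y) [_ * _]tpiM [c *: _]tpiZ [c *: _]tpiZ.
rewrite [RHS]tpiM; apply/tpiP=> B f lf.
by rewrite weval_scale !weval_mul weval_scale scalerAl.
Qed.

HB.instance Definition _ := GRing.Lmodule_isLalgebra.Build K talg scaleAl.

Let scaleAr c (x y : talg) : c *: (x * y) = x * (c *: y).
Proof.
rewrite -(tpi_repr x) -(tpi_repr y) [_ * _]tpiM [c *: _]tpiZ [c *: _]tpiZ.
rewrite [RHS]tpiM; apply/tpiP=> B f lf.
by rewrite weval_scale !weval_mul weval_scale scalerAr.
Qed.

HB.instance Definition _ := GRing.Lalgebra_isAlgebra.Build K talg scaleAr.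

Definition tin (v : V) : talg := \pi_talg [:: (1, [:: v])].

(* For F multilinear on words of each length, the linear map v1 ... vn |->
   F [:: v1; ...; vn] on the tensor algebra. *)
Definition wlift (U : lmodType K) (F : seq V -> U) (x : talg) : U :=
  wsum F (repr x).

Lemma tin_linear : linear tin.
Proof.
move=> c x y; rewrite [X in _ = X + _]tpiZ [RHS]tpiD; apply/tpiP=> B f lf.
rewrite weval_cat weval_scale /weval /wsum !big_seq1 /= !scale1r.
exact: lf.
Qed.

Lemma wlift_tin (B : algType K) (f : V -> B) v : linear f ->
  wlift (fun w => \prod_(u <- w) f u) (tin v) = f v.
Proof.
by move=> lf; rewrite /wlift [LHS]repr_tpi // /weval /wsum !big_seq1 scale1r.
Qed.

Lemma talg_sum (x : talg) : x = wlift (fun w => \prod_(v <- w) tin v) x.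
Proof.
have tpi_word w : tpi [:: (1, w)] = \prod_(v <- w) tin v.
  elim: w => [|v w IHw]; first by rewrite big_nil.
  rewrite big_cons -IHw [RHS]tpiM; apply/tpiP=> B f lf.
  by rewrite weval_mul /weval /wsum !big_seq1 /= !scale1r big_cons.
rewrite -{1}(tpi_repr x) /wlift /wsum; elim: (repr x) => [|[c w] s IHs].
  by rewrite big_nil.
rewrite big_cons -IHs -tpi_word [_ *: _]tpiZ [RHS]tpiD /=.
by rewrite mulr1.
Qed.

End TensorAlgebra.

Section Gradings.
Variables (K : fieldType) (V : lmodType K) (G : nat -> set V).

Definition homogeneous_seq (s : seq V) : Prop := forall i, G i s`_i.

Record is_grading : Prop := {
  grading_sub : forall n, is_subspace (G n);
  grading_span : forall x, exists2 s, homogeneous_seq s & x = \sum_(i < size s) s`_i;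
  grading_free : forall s, homogeneous_seq s -> \sum_(i < size s) s`_i = 0 ->
    forall i, s`_i = 0 }.

(* Homogeneous components of x; unique up to trailing zeros when G is a grading. *)
Definition components (x : V) : seq V :=
  xget [::] [set s | homogeneous_seq s /\ x = \sum_(i < size s) s`_i].

(* The linear map given by F n in degree n. *)
Definition gmap (U : lmodType K) (F : nat -> V -> U) (x : V) : U :=
  \sum_(i < size (components x)) F i (components x)`_i.

(* x |-> (-1)^|x| x *)
Definition parity : V -> V := gmap (fun n y => (-1) ^+ n *: y).

End Gradings.

Record is_hopf (K : fieldType) (A : algType K) (cop : A -> A ⊗ A) (cou : A -> K)
    (S : A -> A) : Prop := {
  hopf_cop_linear : linear cop;
  hopf_cou_linear : scalar cou;
  hopf_anti_linear : linear S;
  hopf_coassoc : forall a,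
    \sw_(a1, a2 <- cop a) (\sw_(a11, a12 <- cop a1) a11 ⊗ (a12 ⊗ a2)) =
    \sw_(a1, a2 <- cop a) a1 ⊗ cop a2;
  hopf_counitl : forall a, \sw_(a1, a2 <- cop a) (cou a1 *: a2) = a;
  hopf_counitr : forall a, \sw_(a1, a2 <- cop a) (cou a2 *: a1) = a;
  hopf_copM : forall a b, cop (a * b) =
    \sw_(a1, a2 <- cop a) \sw_(b1, b2 <- cop b) (a1 * b1) ⊗ (a2 * b2);
  hopf_cop1 : cop 1 = 1 ⊗ 1;
  hopf_couM : forall a b, cou (a * b) = cou a * cou b;
  hopf_cou1 : cou 1 = 1;
  hopf_antil : forall a, \sw_(a1, a2 <- cop a) (S a1 * a2) = cou a *: 1;
  hopf_antir : forall a, \sw_(a1, a2 <- cop a) (a1 * S a2) = cou a *: 1 }.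

Record hopfAlg (K : fieldType) := HopfAlg {
  hcar :> algType K;
  hcop : hcar -> hcar ⊗ hcar;
  hcou : hcar -> K;
  hanti : hcar -> hcar;
  hopfP : is_hopf hcop hcou hanti }.

Arguments hcop {K h} _.
Arguments hcou {K h} _.
Arguments hanti {K h} _.

Record is_crossed (K : fieldType) (A : hopfAlg K) (V : lmodType K)
    (act : V -> A -> V) (coact : V -> V ⊗ A) : Prop := {
  crossed_act_bilinear : bilinear act;
  crossed_act1 : forall v, act v 1 = v;
  crossed_actM : forall v a b, act v (a * b) = act (act v a) b;
  crossed_coact_linear : linear coact;
  crossed_coassoc : forall v,
    \sw_(v0, v1 <- coact v) (\sw_(v00, v01 <- coact v0) v00 ⊗ (v01 ⊗ v1)) =
    \sw_(v0, v1 <- coact v) v0 ⊗ hcop v1;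
  crossed_counit : forall v, \sw_(v0, v1 <- coact v) (hcou v1 *: v0) = v;
  crossed_compat : forall v a, coact (act v a) =
    \sw_(v0, v1 <- coact v) \sw_(a1, a' <- hcop a) \sw_(a2, a3 <- hcop a')
      act v0 a2 ⊗ (hanti a1 * v1 * a3) }.

Record crossedMod (K : fieldType) (A : hopfAlg K) := CrossedMod {
  cmcar :> lmodType K;
  cmact : cmcar -> A -> cmcar;
  cmcoact : cmcar -> cmcar ⊗ A;
  crossedP : is_crossed cmact cmcoact }.

Arguments cmact {K A c} _ _.
Arguments cmcoact {K A c} _.

Record superData (K : fieldType) := SuperData {
  scar :> lmodType K;
  smul : scar -> scar -> scar;
  sone : scar;
  scop : scar -> scar ⊗ scar;
  scou : scar -> K;
  sdeg : nat -> set scar }.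

Arguments smul {K s} _ _.
Arguments sone {K s}.
Arguments scop {K s} _.
Arguments scou {K s} _.
Arguments sdeg {K s} _.

(* The product of V ⊗ V for a product mul of V and a braiding br:
   (x ⊗ y)(x' ⊗ y') = x br(y ⊗ x') y'. *)
Definition braided_mul (K : fieldType) (V : lmodType K) (mul : V -> V -> V)
    (br : V -> V -> V ⊗ V) (s t : V ⊗ V) : V ⊗ V :=
  \sw_(x, y <- s) \sw_(x', y' <- t) \sw_(u, v <- br y x') mul x u ⊗ mul v y'.

(* y ⊗ x |-> (-1)^(|y||x|) x ⊗ y *)
Definition super_flip (K : fieldType) (V : lmodType K) (G : nat -> set V)
    (y x : V) : V ⊗ V :=
  gmap G (fun j y' => gmap G (fun i x' => (-1) ^+ (j * i) *: (x' ⊗ y')) x) y.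

(* y ⊗ x |-> (-1)^(|y||x|) Psi(y ⊗ x) *)
Definition super_braiding (K : fieldType) (A : hopfAlg K) (V : lmodType K)
    (G : nat -> set V) (act : V -> A -> V) (coact : V -> V ⊗ A) (y x : V) : V ⊗ V :=
  gmap G (fun j y' => gmap G (fun i x' =>
    (-1) ^+ (j * i) *: \sw_(x0, x1 <- coact x') x0 ⊗ act y' x1) x) y.

(* super_flip gives super-bialgebras, super_braiding gives braided-super ones. *)
Record is_graded_bialgebra (K : fieldType) (H : superData K) (br : H -> H -> H ⊗ H)
    : Prop := {
  gb_grading : is_grading (@sdeg K H);
  gb_mul_bilinear : bilinear (@smul K H);
  gb_mulA : associative (@smul K H);
  gb_mul1x : left_id sone (@smul K H);
  gb_mulx1 : right_id sone (@smul K H);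
  gb_mul_deg : forall i j (x y : H), sdeg i x -> sdeg j y -> sdeg (i + j)%N (smul x y);
  gb_one_deg : sdeg 0 (@sone K H);
  gb_cop_linear : linear (@scop K H);
  gb_cou_linear : scalar (@scou K H);
  gb_coassoc : forall x : H,
    \sw_(x1, x2 <- scop x) (\sw_(x11, x12 <- scop x1) x11 ⊗ (x12 ⊗ x2)) =
    \sw_(x1, x2 <- scop x) x1 ⊗ scop x2;
  gb_counitl : forall x : H, \sw_(x1, x2 <- scop x) (scou x1 *: x2) = x;
  gb_counitr : forall x : H, \sw_(x1, x2 <- scop x) (scou x2 *: x1) = x;
  gb_cop_deg : forall n (x : H), sdeg n x ->
    lspan [set t : H ⊗ H | exists i j (y z : H),
      [/\ (i + j)%N = n, sdeg i y, sdeg j z & t = y ⊗ z]] (scop x);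
  gb_cou_deg : forall n (x : H), sdeg n.+1 x -> scou x = 0;
  gb_copM : forall x y : H,
    scop (smul x y) = braided_mul smul br (scop x) (scop y);
  gb_cop1 : scop (@sone K H) = sone ⊗ sone;
  gb_couM : forall x y : H, scou (smul x y) = scou x * scou y;
  gb_cou1 : scou (@sone K H) = 1 }.

Record is_antipode (K : fieldType) (H : superData K) (S : H -> H) : Prop := {
  anti_linear : linear S;
  anti_deg : forall n x, sdeg n x -> sdeg n (S x);
  antil : forall x, \sw_(x1, x2 <- scop x) smul (S x1) x2 = scou x *: sone;
  antir : forall x, \sw_(x1, x2 <- scop x) smul x1 (S x2) = scou x *: sone }.

Record is_super_hopf (K : fieldType) (H : superData K) : Prop := {
  sh_bialgebra : is_graded_bialgebra (super_flip (@sdeg K H));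
  sh_antipode : exists S : H -> H, is_antipode S }.

Record is_super_morph (K : fieldType) (H H' : superData K) (f : H -> H') : Prop := {
  sm_linear : linear f;
  sm_mul : forall x y, f (smul x y) = smul (f x) (f y);
  sm_one : f sone = sone;
  sm_cop : forall x, scop (f x) = tmap f f (scop x);
  sm_cou : forall x, scou (f x) = scou x;
  sm_deg : forall n x, sdeg n x -> sdeg n (f x) }.

(* The operations induced on the quotient of H by the span of I.  They are
   computed on representatives, hence meaningful exactly when I is a Hopf ideal,
   i.e. when proj is a morphism. *)
Definition super_quot (K : fieldType) (H : superData K) (I : set H) : superData K :=
  @SuperData K (quot I)
    (fun x y => proj I (smul (repr x) (repr y)))
    (proj I sone)
    (fun x => tmap (proj I) (proj I) (scop (repr x)))
    (fun x => scou (repr x))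
    (fun n => [set x | exists2 y, sdeg n y & x = proj I y]).

Record braidedData (K : fieldType) (A : hopfAlg K) := BraidedData {
  bsuper :> superData K;
  bact : bsuper -> A -> bsuper;
  bcoact : bsuper -> bsuper ⊗ A }.

Arguments bact {K A b} _ _.
Arguments bcoact {K A b} _.

Record is_braided_hopf (K : fieldType) (A : hopfAlg K) (B : braidedData A) : Prop := {
  bh_crossed : is_crossed (@bact K A B) (@bcoact K A B);
  bh_act_deg : forall n (x : B) a, sdeg n x -> sdeg n (bact x a);
  bh_coact_deg : forall n (x : B), sdeg n x ->
    lspan [set t : B ⊗ A | exists2 y : B, sdeg n y & exists a, t = y ⊗ a] (bcoact x);
  bh_mul_act : forall (x y : B) a, bact (smul x y) a =
    \sw_(a1, a2 <- hcop a) smul (bact x a1) (bact y a2);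
  bh_one_act : forall a, bact (@sone K B) a = hcou a *: sone;
  bh_mul_coact : forall x y : B, bcoact (smul x y) =
    \sw_(x0, x1 <- bcoact x) \sw_(y0, y1 <- bcoact y) smul x0 y0 ⊗ (x1 * y1);
  bh_one_coact : bcoact (@sone K B) = sone ⊗ 1;
  bh_cop_act : forall (x : B) a, scop (bact x a) =
    \sw_(x1, x2 <- scop x) \sw_(a1, a2 <- hcop a) bact x1 a1 ⊗ bact x2 a2;
  bh_cou_act : forall (x : B) a, scou (bact x a) = scou x * hcou a;
  bh_cop_coact : forall x : B,
    \sw_(x0, a <- bcoact x) scop x0 ⊗ a =
    \sw_(x1, x2 <- scop x) \sw_(y1, a1 <- bcoact x1) \sw_(y2, a2 <- bcoact x2)
      (y1 ⊗ y2) ⊗ (a1 * a2);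
  bh_cou_coact : forall x : B, \sw_(x0, a <- bcoact x) (scou x0 *: a) = scou x *: 1;
  bh_bialgebra :
    is_graded_bialgebra (super_braiding (@sdeg K B) (@bact K A B) (@bcoact K A B));
  bh_antipode : exists S : B -> B, [/\ is_antipode S,
    forall x a, S (bact x a) = bact (S x) a &
    forall x, bcoact (S x) = tmap S id (bcoact x)] }.

Record is_braided_morph (K : fieldType) (A : hopfAlg K) (B B' : braidedData A)
    (f : B -> B') : Prop := {
  bm_super : is_super_morph f;
  bm_act : forall x a, f (bact x a) = bact (f x) a;
  bm_coact : forall x, bcoact (f x) = tmap f id (bcoact x) }.

Definition braided_quot (K : fieldType) (A : hopfAlg K) (B : braidedData A)
    (I : set B) : braidedData A :=
  @BraidedData K A (super_quot I)
    (fun x a => proj I (bact (repr x) a))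
    (fun x => tmap (proj I) id (bcoact (repr x))).

(* T_- V: the action and coaction are those of the tensor powers of V, and the
   coproduct is the multiplicative extension of v |-> v ⊗ 1 + 1 ⊗ v for the
   braided-super product of T_- V ⊗ T_- V. *)
Section BraidedTensorAlgebra.
Variables (K : fieldType) (A : hopfAlg K) (V : crossedMod A).

Definition talg_deg (n : nat) : set (talg V) :=
  lspan [set x | exists2 w : seq V, size w = n & x = \prod_(v <- w) tin v].

Definition talg_act (x : talg V) (a : A) : talg V :=
  wlift (fun w => foldr
    (fun (v : V) f b => \sw_(b1, b2 <- hcop b) (tin (cmact v b1) * f b2))
    (fun b => hcou b *: 1) w a) x.

Definition talg_coact : talg V -> talg V ⊗ A :=
  wlift (foldr
    (fun (v : V) t => \sw_(v0, v1 <- cmcoact v) \sw_(x0, x1 <- t)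
       (tin v0 * x0) ⊗ (v1 * x1))
    (1 ⊗ 1)).

Definition talg_cop : talg V -> talg V ⊗ talg V :=
  wlift (foldr
    (fun (v : V) t => braided_mul *%R (super_braiding talg_deg talg_act talg_coact)
       (tin v ⊗ 1 + 1 ⊗ tin v) t)
    (1 ⊗ 1)).

Definition talg_cou : talg V -> K :=
  wlift (fun w => (nilp w)%:R : K^o).

Definition btalg : braidedData A :=
  @BraidedData K A (@SuperData K (talg V) *%R 1 talg_cop talg_cou talg_deg)
    talg_act talg_coact.

End BraidedTensorAlgebra.

Section Bosonisation.
Variables (K : fieldType) (A : hopfAlg K) (B : braidedData A).

Definition boson_mul (s t : A ⊗ B) : A ⊗ B :=
  \sw_(a, x <- s) \sw_(b, y <- t) \sw_(b1, b2 <- hcop b)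
    (a * b1) ⊗ smul (bact x b2) y.

Definition boson_cop (s : A ⊗ B) : (A ⊗ B) ⊗ (A ⊗ B) :=
  \sw_(a, x <- s) \sw_(a1, a2 <- hcop a) \sw_(x1, x2 <- scop x)
    \sw_(y, b <- bcoact x1) (a1 ⊗ y) ⊗ ((a2 * b) ⊗ x2).

Definition boson_cou (s : A ⊗ B) : K :=
  tlift (U := K^o) (fun a x => hcou a * scou x) s.

Definition boson_deg (n : nat) : set (A ⊗ B) :=
  lspan [set t : A ⊗ B | exists a (x : B), sdeg n x /\ t = a ⊗ x].

Definition boson : superData K :=
  @SuperData K (A ⊗ B)%type boson_mul (1 ⊗ sone) boson_cop boson_cou boson_deg.

End Bosonisation.

Record extData (K : fieldType) (A : hopfAlg K) := ExtData {
  esuper :> superData K;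
  einc : A -> esuper;
  ed : esuper -> esuper }.

Arguments einc {K A e} _.
Arguments ed {K A e} _.

Record is_strongly_bicovariant (K : fieldType) (A : hopfAlg K) (X : extData A)
    : Prop := {
  sb_super_hopf : is_super_hopf X;
  sb_inc_linear : linear (@einc K A X);
  sb_inc_inj : injective (@einc K A X);
  sb_inc_image : forall x : X, sdeg 0 x <-> exists a, x = einc a;
  sb_incM : forall a b : A, einc (a * b) = smul (einc a) (einc b) :> X;
  sb_inc1 : einc 1 = sone :> X;
  sb_inc_cop : forall a : A, scop (einc a : X) = tmap einc einc (hcop a);
  sb_inc_cou : forall a : A, scou (einc a : X) = hcou a;
  sb_d_linear : linear (@ed K A X);
  sb_d_deg : forall n (x : X), sdeg n x -> sdeg n.+1 (ed x);
  sb_dd : forall x : X, ed (ed x) = 0;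
  sb_leibniz : forall n (x y : X), sdeg n x ->
    ed (smul x y) = smul (ed x) y + (-1) ^+ n *: smul x (ed y);
  sb_coleibniz : forall x : X, scop (ed x) =
    tmap ed id (scop x) + tmap (parity (@sdeg K X)) ed (scop x) }.

(* [θ, x} = θ x - (-1)^|x| x θ *)
Definition super_bracket (K : fieldType) (H : superData K) (θ : H) : H -> H :=
  gmap (@sdeg K H) (fun n x => smul θ x - (-1) ^+ n *: smul x θ).

Definition inner_by (K : fieldType) (A : hopfAlg K) (X : extData A) (θ : X) : Prop :=
  sdeg 1 θ /\ forall x : X, ed x = super_bracket θ x.

Definition is_inner (K : fieldType) (A : hopfAlg K) (X : extData A) : Prop :=
  exists θ : X, inner_by θ.

(* The projection Pi to degree 0, identified with A *)
Definition deg0_part (K : fieldType) (A : hopfAlg K) (X : extData A) (x : X) : A :=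
  xget 0 [set a | einc a = (components (@sdeg K X) x)`_0].

Definition right_invariant (K : fieldType) (A : hopfAlg K) (X : extData A) (θ : X)
    : Prop :=
  tmap id (@deg0_part K A X) (scop θ) = θ ⊗ 1.

(* Lambda^1 is the space of left-invariant elements of degree 1. *)
Definition left_invariant (K : fieldType) (A : hopfAlg K) (X : extData A) (θ : X)
    : Prop :=
  tmap (@deg0_part K A X) id (scop θ) = 1 ⊗ θ.

Record is_subalgebra (K : fieldType) (H : superData K) (C : set H) : Prop := {
  subalg_subspace : is_subspace C;
  subalg_one : C sone;
  subalg_mul : forall x y, C x -> C y -> C (smul x y) }.

Definition generated_in_deg01 (K : fieldType) (H : superData K) : Prop :=
  smallest (@is_subalgebra K H) (sdeg 0 `|` sdeg 1) = setT.

Record is_ext_morph (K : fieldType) (A : hopfAlg K) (X Y : extData A) (f : X -> Y)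
    : Prop := {
  em_super : is_super_morph f;
  em_inc : forall a, f (einc a) = einc a;
  em_d : forall x, f (ed x) = ed (f x) }.

Definition ext_iso (K : fieldType) (A : hopfAlg K) (X Y : extData A) : Prop :=
  exists2 f : X -> Y, is_ext_morph f & bijective f.

Definition ext_quot (K : fieldType) (A : hopfAlg K) (X : extData A) (I : set X)
    : extData A :=
  @ExtData K A (super_quot I)
    (fun a => proj I (einc a))
    (fun x => proj I (ed (repr x))).

(* The structure of X descends to X / I exactly when proj is a morphism, i.e.
   when I is a differential super-Hopf ideal. *)
Definition is_iso_to_quotient_of (K : fieldType) (A : hopfAlg K) (Y X : extData A)
    : Prop :=
  exists I : set X,
    is_ext_morph (proj I : X -> ext_quot I) /\ ext_iso Y (ext_quot I).

Record is_ideal (K : fieldType) (H : superData K) (I : set H) : Prop := {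
  ideal_subspace : is_subspace I;
  ideal_mull : forall x y, I y -> I (smul x y);
  ideal_mulr : forall x y, I x -> I (smul x y) }.

Section OmegaTheta.
Variables (K : fieldType) (A : hopfAlg K) (V : crossedMod A) (θ : V).

Let θ2 : talg V := tin θ * tin θ.

Definition theta_relations : set (btalg V) :=
  [set talg_act θ2 a | a in [set a : A | hcou a = 0]] `|`
  [set θ2 * tin η - tin η * θ2 | η in @setT V].

Definition theta_ideal : set (btalg V) := smallest (@is_ideal K (btalg V)) theta_relations.

Definition Lambda_theta : braidedData A := braided_quot theta_ideal.

Definition Omega_theta_elt : boson Lambda_theta :=
  (1 : A) ⊗ (proj theta_ideal (tin θ) : Lambda_theta).

Definition Omega_theta : extData A :=
  @ExtData K A (boson Lambda_theta)
    (fun a => a ⊗ (sone : Lambda_theta))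
    (super_bracket Omega_theta_elt).

End OmegaTheta.

(* Main.v *)
(* θ² is coinvariant, and primitive in T_-Λ¹: as Δ_R θ = θ ⊗ 1, the two cross terms
   of the coproduct of θ² are θ ⊗ θ and its negative. So each θ² ◁ a is primitive,
   and the cross terms of the coproduct of [θ², η] add up to η_0 ⊗ θ² ◁ π(η_1); the
   relations span a braided Hopf ideal. In the bosonisation θ is primitive and θ² is
   central: θ² a = a_1 (θ² ◁ a_2) = a θ². So d = [θ, } squares to zero and is
   a super-derivation and a super-coderivation.

   Conversely, d² = 0 makes θ² central in X. The left-invariant 1-forms V of X, onto
   which P(x) = S(x_{-1}) x_0 projects, form a crossed module, and the algebra map
   φ : T_-V -> X extending the inclusion satisfies
   φ(t ◁ a) = S(a_1) φ(t) a_2. For t = θ² this is ε(a) θ², so φ kills the relations,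
   and a ⊗ η |-> a φ(η) is a surjection of Ω_θ onto X. *)

From HB Require Import structures.
From mathcomp Require Import all_boot all_algebra.
From mathcomp Require Import boolp classical_sets functions.
Require Import Defs.

Set Implicit Arguments.
Unset Strict Implicit.
Unset Printing Implicit Defensive.

Import GRing.Theory.
Local Open Scope classical_set_scope.
Local Open Scope quotient_scope.
Local Open Scope ring_scope.

(** * Linear maps and Sweedler sums *)

(** Tensor products and tensor algebras are quotients of formal sums, and a Sweedler sum [tlift F t]
    is computed on a representative of t, so it is meaningful only for bilinear F. Each renumbering
    of indices thus carries a linearity side condition, left to the tactic [lin], and identities are
    extended linearly from simple tensors, homogeneous elements or words. Axioms are contracted with
    arbitrary multilinear maps before use ([sw_coassoc] and its analogues). Signs are carried by
    operators [twist j], so that super flips and braidings require only one factor to be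
    homogeneous. The crossed module axiom is used in the antipode-free form (v ◁ a_2)_0 ⊗ a_1 (v ◁
    a_2)_1 = v_0 ◁ a_1 ⊗ v_1 a_2, which behaves well under products. Stability of the ideal under
    coaction and coproduct is stated as vanishing in Λ_θ ⊗ A and Λ_θ ⊗ Λ_θ, so that no kernel of a
    map between tensor products has to be described. In the converse, left invariance places θ in V,
    and right invariance becomes the coinvariance of θ in V. *)

Section LinearMaps.
Variables (K : fieldType) (U V W : lmodType K).

Lemma lin0 (f : V -> W) : linear f -> f 0 = 0.
Proof. by move=> lf; have := zmod_morphism_linear lf 0 0; rewrite !subrr. Qed.

Lemma linB (f : V -> W) : linear f -> {morph f : x y / x - y}.
Proof. exact: zmod_morphism_linear. Qed.

Lemma linZ (f : V -> W) : linear f -> forall c x, f (c *: x) = c *: f x.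
Proof. exact: scalable_linear. Qed.

Lemma linD (f : V -> W) : linear f -> {morph f : x y / x + y}.
Proof. by move=> lf x y; have := lf 1 x y; rewrite !scale1r. Qed.

Lemma linN (f : V -> W) : linear f -> {morph f : x / - x}.
Proof. by move=> lf x; rewrite -scaleN1r linZ // scaleN1r. Qed.

Lemma lin_sum (f : V -> W) (I : Type) (r : seq I) (P : pred I) (E : I -> V) :
  linear f -> f (\sum_(i <- r | P i) E i) = \sum_(i <- r | P i) f (E i).
Proof. by move=> lf; apply: (big_morph f (linD lf) (lin0 lf)). Qed.

Lemma lin_id : linear (fun x : V => x). Proof. by []. Qed.

Lemma lin_cst0 : linear (fun x : V => 0 : W).
Proof. by move=> c x y; rewrite scaler0 addr0. Qed.

Lemma lin_comp (g : V -> W) (f : U -> V) :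
  linear g -> linear f -> linear (fun x => g (f x)).
Proof. by move=> lg lf c x y; rewrite lf lg. Qed.

Lemma lin_addf (f g : V -> W) : linear f -> linear g -> linear (fun x => f x + g x).
Proof. by move=> lf lg c x y; rewrite lf lg scalerDr addrACA. Qed.

Lemma lin_oppf (f : V -> W) : linear f -> linear (fun x => - f x).
Proof. by move=> lf c x y; rewrite lf opprD scalerN. Qed.

Lemma lin_scalef k (f : V -> W) : linear f -> linear (fun x => k *: f x).
Proof. by move=> lf c x y; rewrite lf scalerDr !scalerA mulrC. Qed.

Lemma lin_sumf (I : Type) (r : seq I) (P : pred I) (f : I -> V -> W) :
  (forall i, linear (f i)) -> linear (fun x => \sum_(i <- r | P i) f i x).
Proof.
move=> lf c x y; rewrite scaler_sumr -big_split /=.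
by apply: eq_bigr => i _; rewrite lf.
Qed.

Lemma lin_scalar (k : V -> K) (w : W) : scalar k -> linear (fun x => k x *: w).
Proof. by move=> lk c x y; rewrite lk scalerDl scalerA. Qed.

Lemma lin_bil1 (b : U -> V -> W) v : bilinear b -> linear (fun x => b x v).
Proof. by case. Qed.

Lemma lin_bil2 (b : U -> V -> W) u : bilinear b -> linear (b u).
Proof. by case. Qed.

End LinearMaps.

Lemma scalar_comp (K : fieldType) (V W : lmodType K) (g : V -> K) (f : W -> V) :
  scalar g -> linear f -> scalar (fun x => g (f x)).
Proof. by move=> lg lf c x y; rewrite lf lg. Qed.

Lemma scalar_linear (K : fieldType) (V : lmodType K) (g : V -> K) :
  scalar g -> linear (g : V -> K^o).
Proof. by []. Qed.

Lemma scalar_mull (K : fieldType) (V : lmodType K) k (g : V -> K) :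
  scalar g -> scalar (fun x => k * g x).
Proof. by move=> lg c x y; rewrite lg mulrDr mulrCA. Qed.

Lemma scalar_mulr (K : fieldType) (V : lmodType K) k (g : V -> K) :
  scalar g -> scalar (fun x => g x * k).
Proof. by move=> lg c x y; rewrite lg mulrDl mulrA. Qed.

Lemma mul_bilinear (K : fieldType) (B : algType K) : bilinear (@GRing.mul B).
Proof.
split=> [a|b] c x y; first by rewrite mulrDr scalerAr.
by rewrite mulrDl scalerAl.
Qed.

Section Tensors.
Variables (K : fieldType) (V W : lmodType K).

Lemma eq_tlift (U : lmodType K) (F G : V -> W -> U) t :
  (forall x y, F x y = G x y) -> tlift F t = tlift G t.
Proof. by move=> eFG; apply: eq_bigr. Qed.

Lemma lin_tlift (U Z : lmodType K) (F : V -> W -> U) (t : Z -> V ⊗ W) :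
  bilinear F -> linear t -> linear (fun x => tlift F (t x)).
Proof. by move=> bF lt c x y; rewrite lt tlift_linear. Qed.

Lemma lin_tliftf (U Z : lmodType K) (F : Z -> V -> W -> U) (t : V ⊗ W) :
  (forall v w, linear (fun z => F z v w)) -> linear (fun z => tlift (F z) t).
Proof.
move=> lF c x y; rewrite /tlift /tsum scaler_sumr -big_split /=.
by apply: eq_bigr => p _; apply: lF.
Qed.

Lemma tlift_map (U U' : lmodType K) (f : U -> U') (F : V -> W -> U) t :
  linear f -> \sw_(x, y <- t) f (F x y) = f (tlift F t).
Proof. by move=> lf; rewrite /tlift /tsum lin_sum. Qed.

Lemma tliftZ (U : lmodType K) c (F : V -> W -> U) t :
  \sw_(x, y <- t) (c *: F x y) = c *: tlift F t.
Proof. by rewrite -tlift_map //; apply: lin_scalef; apply: lin_id. Qed.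

Lemma tliftD (U : lmodType K) (F G : V -> W -> U) t :
  \sw_(x, y <- t) (F x y + G x y) = tlift F t + tlift G t.
Proof. exact: big_split. Qed.

Lemma tliftN (U : lmodType K) (F : V -> W -> U) t :
  \sw_(x, y <- t) (- F x y) = - tlift F t.
Proof. by rewrite -tlift_map //; apply: lin_oppf; apply: lin_id. Qed.

Lemma tlift0 (U : lmodType K) (t : V ⊗ W) : \sw_(x, y <- t) (0 : U) = 0 :> U.
Proof. exact: big1. Qed.

Lemma tlift_0 (U : lmodType K) (F : V -> W -> U) : bilinear F -> tlift F 0 = 0.
Proof. by move=> bF; apply: lin0; apply: tlift_linear. Qed.

(** A [tlift] is a finite sum over a chosen representative, so independent ones commute without any
    bilinearity. *)
Lemma tlift_exch (V' W' U : lmodType K) (F : V -> W -> V' -> W' -> U) s t :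
  \sw_(x, y <- s) \sw_(u, v <- t) F x y u v =
  \sw_(u, v <- t) \sw_(x, y <- s) F x y u v.
Proof. exact: exchange_big. Qed.

Lemma tlift_pureE (t : V ⊗ W) : \sw_(x, y <- t) x ⊗ y = t.
Proof. by rewrite [RHS]tens_sum. Qed.

Lemma tens_ind (P : V ⊗ W -> Prop) : is_subspace P ->
  (forall x y, P (x ⊗ y)) -> forall t, P t.
Proof.
move=> sP Pp t; rewrite [t]tens_sum; elim: (repr t) => [|p s IHs].
  by rewrite big_nil; apply: subspace0.
by rewrite big_cons -[_ ⊗ _]scale1r; apply: subspaceP.
Qed.

Lemma eq_linear_subspace (Z U : lmodType K) (f g : Z -> U) :
  linear f -> linear g -> is_subspace [set z | f z = g z].
Proof.
move=> lf lg; split; first by rewrite /= !lin0.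
by move=> c x y /= fx fy; rewrite lf lg fx fy.
Qed.

Lemma tens_eq (U : lmodType K) (f g : V ⊗ W -> U) : linear f -> linear g ->
  (forall x y, f (x ⊗ y) = g (x ⊗ y)) -> forall t, f t = g t.
Proof.
by move=> lf lg fg t; apply: (tens_ind (eq_linear_subspace lf lg)).
Qed.

End Tensors.

(* Automation for linearity and bilinearity side conditions *)
#[global] Hint Extern 1 (bilinear (@GRing.mul _)) => eapply mul_bilinear : linh.
#[global] Hint Extern 1 (bilinear (@pure _ _ _)) => eapply pure_bilinear : linh.
#[global] Hint Resolve tlift_linear proj_linear
  tin_linear : linh.

Ltac lin_close :=
  first [ solve [eauto 3 with linh]
        | match goal with
          | H : GRing.linear_for _ ?f |- GRing.linear_for _ ?f => exact H
          | H : bilinear ?f |- bilinear ?f => exact H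
          end ].

Ltac lin_base :=
  first [ lin_close
        | lazymatch goal with
          | |- GRing.linear_for _ (fun y => ?h y ?b) =>
            apply: (@lin_bil1 _ _ _ _ h b); lin_close
          | |- GRing.linear_for _ (fun y => ?h ?a y) =>
            change (linear (h a)); lin_base
          | |- GRing.linear_for _ (fun y => ?h y) => change (linear h); lin_base
          | |- GRing.linear_for _ (?h ?a) =>
            apply: (@lin_bil2 _ _ _ _ h a); lin_close
          end ].

(* Standing for the bound variable, so that a body can be matched without
   second-order patterns. *)
Definition lin_mark (T : Type) (x : T) : T := x.

Ltac is_cst f :=
  lazymatch type of f with
  | ?V -> _ =>
    let e := eval cbv beta in (f (lin_mark (0 : V))) in
    lazymatch e with
    | context [lin_mark] => fail
    | _ => idtac
    end
  end.

(** Factors the function f as an operator after an inner function: the inner function is the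
    rightmost argument in which the marked variable occurs, searched among the last four arguments
    of the body. *)
Ltac lin_app f tac :=
  lazymatch type of f with
  | ?V -> _ =>
    let m := constr:(lin_mark (0 : V)) in
    let abs b := (let p := eval pattern m in b in
      lazymatch p with ?B _ => B end) in
    let e := eval cbv beta in (f m) in
    lazymatch e with
    | ?h ?b =>
      lazymatch b with
      | context [lin_mark] => let B := abs b in tac h B
      | _ => lazymatch h with
        | ?h' ?b' =>
          lazymatch b' with
          | context [lin_mark] => let B := abs b' in (let op := constr:(fun y => h' y b) in tac op B)
          | _ => lazymatch h' with
            | ?h'' ?b'' =>
              lazymatch b'' with
              | context [lin_mark] => let B := abs b'' in (let op := constr:(fun y => h'' y b' b) in tac op B)
              | _ => lazymatch h'' with
                | ?h3 ?b3 => let B := abs b3 in (let op := constr:(fun y => h3 y b'' b' b) in tac op B)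
                end
              end
            end
          end
        end
      end
    end
  end.

(** Recursion on the body of the function. In a Sweedler sum the variable sits either in the tensor,
    and then the summand must be bilinear, or in the summand, and then linearity is checked term by
    term. *)
Ltac lin :=
  lazymatch goal with
  | |- forall _, _ => move=> ?; cbv beta; lin
  | |- bilinear _ => split => ?; cbv beta; lin
  | |- prod _ _ => split; lin
  | |- _ /\ _ => split; lin
  | |- GRing.linear_for (@GRing.mul _) ?f => lin_scal
  | |- GRing.linear_for _ ?f =>
    lazymatch f with
    | fun x => x => exact: lin_id
    | fun x => (@?E x) + (@?E' x) => apply: (@lin_addf _ _ _ E E'); lin
    | fun x => - (@?E x) => apply: (@lin_oppf _ _ _ E); lin
    | fun x => @GRing.scale _ _ (@?k x) (@?E x) =>
        tryif is_cst k then (apply: lin_scalef; lin)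
        else (apply: lin_scalar; lin_scal)
    | fun x => @tlift _ _ _ _ _ (@?t x) =>
        tryif is_cst t then (apply: lin_tliftf => ? ?; cbv beta; lin)
        else (apply: lin_tlift; lin)
    | @tlift _ _ _ _ _ => apply: tlift_linear; lin
    | fun x => @tmap _ _ _ _ _ _ _ _ => rewrite /tmap; lin
    | fun x => @bigop _ _ _ _ _ => apply: lin_sumf => ?; lin
    | _ =>
        first [ lin_close |
        lin_app f
          ltac:(fun op B =>
            lazymatch B with
            | fun x => x => lin_base
            | _ => apply: (@lin_comp _ _ _ _ op B); cbv beta; [lin_base | lin]
            end) | lin_base ]
    end
  end
with lin_scal :=
  cbv beta;
  first [ lin_close |
  lazymatch goal with
  | |- GRing.linear_for _ ?f =>
    lazymatch f with
    | fun x => @GRing.mul _ (@?k x) (@?E x) =>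
        tryif is_cst k then (apply: scalar_mull; lin_scal)
        else (apply: scalar_mulr; lin_scal)
    | fun x => ?h (@?g x) => apply: (@scalar_comp _ _ _ h g);
        [ lin_close | lin ]
    end
  end ].

Section Sweedler.
Variables (K : fieldType) (V W : lmodType K).

Lemma tlift_tlift (V' W' U : lmodType K) (F : V -> W -> U)
    (G : V' -> W' -> V ⊗ W) t : bilinear F ->
  tlift F (tlift G t) = \sw_(u, v <- t) tlift F (G u v).
Proof. by move=> bF; rewrite -tlift_map //; apply: tlift_linear. Qed.

Lemma tlift_tmap (V' W' U : lmodType K) (F : V -> W -> U)
    (f : V' -> V) (g : W' -> W) t : bilinear F -> linear f -> linear g ->
  tlift F (tmap f g t) = \sw_(u, v <- t) F (f u) (g v).
Proof.
move=> bF lf lg; rewrite tlift_tlift //; apply: eq_tlift => u v.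
by rewrite tlift_pure.
Qed.

Lemma tliftDr (U : lmodType K) (F : V -> W -> U) s t : bilinear F ->
  tlift F (s + t) = tlift F s + tlift F t.
Proof. by move=> bF; apply: (linD (tlift_linear bF)). Qed.

Lemma tliftZr (U : lmodType K) (F : V -> W -> U) c t : bilinear F ->
  tlift F (c *: t) = c *: tlift F t.
Proof. by move=> bF; apply: (linZ (tlift_linear bF)). Qed.

Lemma tmap_linear (V' W' : lmodType K) (f : V -> V') (g : W -> W') :
  linear f -> linear g -> linear (tmap f g).
Proof. by move=> lf lg; apply: tlift_linear; lin. Qed.

Lemma tmap_pure (V' W' : lmodType K) (f : V -> V') (g : W -> W') v w :
  linear f -> linear g -> tmap f g (v ⊗ w) = f v ⊗ g w.
Proof. by move=> lf lg; rewrite /tmap tlift_pure //; lin. Qed.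

Lemma pure0l (w : W) : (0 : V) ⊗ w = 0.
Proof. by apply: (lin0 (f := fun v => v ⊗ w)); lin. Qed.

Lemma pure0r (v : V) : v ⊗ (0 : W) = 0.
Proof. by apply: (lin0 (f := pure v)); lin. Qed.

Lemma pureZl c (v : V) (w : W) : (c *: v) ⊗ w = c *: (v ⊗ w).
Proof. by apply: (linZ (f := fun v => v ⊗ w)); lin. Qed.

Lemma pureZr c (v : V) (w : W) : v ⊗ (c *: w) = c *: (v ⊗ w).
Proof. by apply: (linZ (f := pure v)); lin. Qed.

Lemma pureDl (v v' : V) (w : W) : (v + v') ⊗ w = v ⊗ w + v' ⊗ w.
Proof. by apply: (linD (f := fun v => v ⊗ w)); lin. Qed.

Lemma pureDr (v : V) (w w' : W) : v ⊗ (w + w') = v ⊗ w + v ⊗ w'.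
Proof. by apply: (linD (f := pure v)); lin. Qed.

End Sweedler.

#[global] Hint Extern 1 (GRing.linear_for _ id) => exact: lin_id : linh.
#[global] Hint Extern 1 (GRing.linear_for _ (tmap _ _)) => eapply tmap_linear : linh.

Section Span.
Variables (K : fieldType) (V : lmodType K).

Lemma subspaceD (W : set V) : is_subspace W -> forall x y, W x -> W y -> W (x + y).
Proof. by move=> sW x y Wx Wy; rewrite -[x]scale1r; apply: subspaceP. Qed.

Lemma subspaceZ (W : set V) : is_subspace W -> forall c x, W x -> W (c *: x).
Proof.
by move=> sW c x Wx; rewrite -[_ *: _]addr0; apply: subspaceP => //; apply: subspace0.
Qed.

Lemma subspaceB (W : set V) : is_subspace W -> forall x y, W x -> W y -> W (x - y).
Proof.
by move=> sW x y Wx Wy; rewrite -scaleN1r; apply: subspaceD => //; apply: subspaceZ.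
Qed.

Lemma subspace_sum (W : set V) (I : Type) (r : seq I) (P : pred I) (E : I -> V) :
  is_subspace W -> (forall i, P i -> W (E i)) -> W (\sum_(i <- r | P i) E i).
Proof.
move=> sW WE; elim/big_ind: _ => //; first exact: subspace0.
exact: subspaceD.
Qed.

Lemma subspace_tlift (W : set V) (U U' : lmodType K) (F : U -> U' -> V) t :
  is_subspace W -> (forall x y, W (F x y)) -> W (tlift F t).
Proof. by move=> sW WF; apply: subspace_sum. Qed.

Lemma lspan_gen (I : set V) x : I x -> lspan I x.
Proof. by move=> Ix W [_ IW]; apply: IW. Qed.

Lemma lspan_min (I W : set V) : is_subspace W -> (forall x, I x -> W x) ->
  forall x, lspan I x -> W x.
Proof. by move=> sW IW x; apply; split. Qed.

Lemma lspan_id (W : set V) : is_subspace W -> forall x, lspan W x -> W x.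
Proof. by move=> sW; apply: lspan_min. Qed.

Lemma preim_subspace (U : lmodType K) (f : U -> V) (W : set V) :
  linear f -> is_subspace W -> is_subspace [set x | W (f x)].
Proof.
move=> lf sW; split; first by rewrite /= lin0 //; apply: subspace0.
by move=> c x y /= Wx Wy; rewrite lf; apply: subspaceP.
Qed.

Lemma ker_subspace (U : lmodType K) (f : V -> U) :
  linear f -> is_subspace [set x | f x = 0].
Proof. by move=> lf; apply: eq_linear_subspace; [|apply: lin_cst0]. Qed.

Lemma forall_subspace (I : Type) (W : I -> set V) :
  (forall i, is_subspace (W i)) -> is_subspace [set x | forall i, W i x].
Proof.
move=> sW; split=> [i|c x y Wx Wy i]; first exact: subspace0.
exact: subspaceP.
Qed.

End Span.

(** Allows F and G to differ outside the span in which t is known to lie, typically that of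
    homogeneous simple tensors. *)
Lemma eq_tlift_span (K : fieldType) (V W U : lmodType K) (S : set (V ⊗ W))
    (F G : V -> W -> U) t : bilinear F -> bilinear G -> lspan S t ->
  (forall s, S s -> exists x y, s = x ⊗ y /\ F x y = G x y) ->
  tlift F t = tlift G t.
Proof.
move=> bF bG St FG; move: t St.
apply: (@lspan_min _ _ _ [set t | tlift F t = tlift G t]).
  by apply: eq_linear_subspace; apply: tlift_linear.
by move=> s /FG [x [y [-> eFG]]] /=; rewrite !tlift_pure.
Qed.

(** * Sweedler calculus in a Hopf algebra *)

Section HopfLaws.
Variables (K : fieldType) (A : hopfAlg K).
Local Notation hS := (@hanti K A).

Lemma hcop_linear : linear (@hcop K A). Proof. exact: hopf_cop_linear (hopfP A). Qed.
Lemma hcou_scalar : scalar (@hcou K A). Proof. exact: hopf_cou_linear (hopfP A). Qed.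
Lemma hanti_linear : linear hS. Proof. exact: hopf_anti_linear (hopfP A). Qed.
#[local] Hint Resolve hcop_linear hcou_scalar hanti_linear : linh.

(** Packing the last two arguments of F into one tensor makes it bilinear, so that the axiom, an
    equation in A ⊗ (A ⊗ A), can be contracted with it. This and its analogues for coactions and
    super coproducts are how Sweedler legs are renumbered. *)
Lemma sw_coassoc (U : lmodType K) (F : A -> A -> A -> U) a :
  (forall y z, linear (fun x => F x y z)) ->
  (forall x z, linear (fun y => F x y z)) -> (forall x y, linear (F x y)) ->
  \sw_(x, z <- hcop a) (\sw_(x1, y <- hcop x) F x1 y z) =
  \sw_(x, y <- hcop a) (\sw_(y1, z <- hcop y) F x y1 z).
Proof.
move=> F1 F2 F3.
pose G x t := tlift (fun y z => F x y z) t.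
have bG : bilinear G by rewrite /G; lin.
have := congr1 (tlift G) (hopf_coassoc (hopfP A) a).
rewrite !tlift_tlift // => h.
transitivity (\sw_(x, z <- hcop a) \sw_(x1, y <- hcop x) G x1 (y ⊗ z)).
  apply: eq_tlift => x z; apply: eq_tlift => x1 y.
  by rewrite /G tlift_pure //; lin.
transitivity (\sw_(x, z <- hcop a) G x (hcop z)).
  transitivity (\sw_(x, z <- hcop a) tlift G (\sw_(x1, y <- hcop x) x1 ⊗ (y ⊗ z))).
    apply: eq_tlift => x z; rewrite tlift_tlift //.
    by apply: eq_tlift => x1 y; rewrite tlift_pure.
  by rewrite h; apply: eq_tlift => x z; rewrite tlift_pure.
by [].
Qed.

Lemma sw_counitl (U : lmodType K) (F : A -> U) a : linear F ->
  \sw_(x, y <- hcop a) (hcou x *: F y) = F a.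
Proof.
move=> lF; rewrite -[in RHS](hopf_counitl (hopfP A) a) -tlift_map //.
by apply: eq_tlift => x y; rewrite linZ.
Qed.

Lemma sw_counitr (U : lmodType K) (F : A -> U) a : linear F ->
  \sw_(x, y <- hcop a) (hcou y *: F x) = F a.
Proof.
move=> lF; rewrite -[in RHS](hopf_counitr (hopfP A) a) -tlift_map //.
by apply: eq_tlift => x y; rewrite linZ.
Qed.

Lemma sw_hcopM (U : lmodType K) (F : A -> A -> U) a b : bilinear F ->
  tlift F (hcop (a * b)) =
  \sw_(a1, a2 <- hcop a) \sw_(b1, b2 <- hcop b) F (a1 * b1) (a2 * b2).
Proof.
move=> bF; rewrite (hopf_copM (hopfP A)) tlift_tlift //; apply: eq_tlift => x y.
by rewrite tlift_tlift //; apply: eq_tlift => x' y'; rewrite tlift_pure.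
Qed.

Lemma sw_hcop1 (U : lmodType K) (F : A -> A -> U) : bilinear F ->
  tlift F (hcop 1) = F 1 1.
Proof. by move=> bF; rewrite (hopf_cop1 (hopfP A)) tlift_pure. Qed.

Lemma sw_hantil (U : lmodType K) (F : A -> U) a : linear F ->
  \sw_(x, y <- hcop a) F (hS x * y) = hcou a *: F 1.
Proof. by move=> lF; rewrite tlift_map // (hopf_antil (hopfP A)) linZ. Qed.

Lemma sw_hantir (U : lmodType K) (F : A -> U) a : linear F ->
  \sw_(x, y <- hcop a) F (x * hS y) = hcou a *: F 1.
Proof. by move=> lF; rewrite tlift_map // (hopf_antir (hopfP A)) linZ. Qed.

Lemma hcouM (a b : A) : hcou (a * b) = hcou a * hcou b.
Proof. exact: hopf_couM (hopfP A) _ _. Qed.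

Lemma hcou1 : hcou (1 : A) = 1.
Proof. exact: hopf_cou1 (hopfP A). Qed.

End HopfLaws.

#[global] Hint Extern 1 (GRing.linear_for _ (@hcop _ _)) => eapply hcop_linear : linh.
#[global] Hint Extern 1 (GRing.linear_for _ (@hcou _ _)) => eapply hcou_scalar : linh.
#[global] Hint Extern 1 (GRing.linear_for _ (@hanti _ _)) => eapply hanti_linear : linh.

(** * Crossed modules *)

Section CrossedLaws.
Variables (K : fieldType) (A : hopfAlg K) (V : lmodType K).
Variables (act : V -> A -> V) (coact : V -> V ⊗ A).

Section Laws.
Hypothesis cV : is_crossed act coact.
Let bact := crossed_act_bilinear cV.
Let lcoact := crossed_coact_linear cV.
#[local] Hint Resolve bact lcoact : linh.

Lemma sw_coact_assoc (U : lmodType K) (F : V -> A -> A -> U) v :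
  (forall a b, linear (fun v => F v a b)) ->
  (forall v b, linear (fun a => F v a b)) -> (forall v a, linear (F v a)) ->
  \sw_(x, b <- coact v) (\sw_(y, a <- coact x) F y a b) =
  \sw_(x, c <- coact v) (\sw_(a, b <- hcop c) F x a b).
Proof.
move=> F1 F2 F3.
pose G x t := tlift (fun a b => F x a b) t.
have bG : bilinear G by rewrite /G; lin.
have := congr1 (tlift G) (crossed_coassoc cV v); rewrite !tlift_tlift // => h.
transitivity (\sw_(x, b <- coact v) tlift G (\sw_(y, a <- coact x) y ⊗ (a ⊗ b))).
  apply: eq_tlift => x b; rewrite tlift_tlift //; apply: eq_tlift => y a.
  by rewrite tlift_pure // /G tlift_pure //; lin.
by rewrite h; apply: eq_tlift => x c; rewrite tlift_pure.
Qed.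

Lemma sw_coact_counit (U : lmodType K) (F : V -> U) v : linear F ->
  \sw_(x, a <- coact v) (hcou a *: F x) = F v.
Proof.
move=> lF; rewrite -[in RHS](crossed_counit cV v) -tlift_map //.
by apply: eq_tlift => x a; rewrite linZ.
Qed.

(** The compatibility axiom multiplied by a_1 on the left: a_1 meets the antipode of the next leg
    and both cancel, which leaves a form without antipode. *)
Lemma sw_crossed (U : lmodType K) (F : V -> A -> U) v a : bilinear F ->
  \sw_(a1, a2 <- hcop a) (\sw_(x, b <- coact (act v a2)) F x (a1 * b)) =
  \sw_(x, b <- coact v) \sw_(a1, a2 <- hcop a) F (act x a1) (b * a2).
Proof.
move=> bF.
transitivity (\sw_(a1, a' <- hcop a) \sw_(b1, b' <- hcop a')
    \sw_(x, b <- coact v) \sw_(b2, b3 <- hcop b')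
    F (act x b2) ((a1 * hanti b1) * (b * b3))).
  apply: eq_tlift => a1 a2; rewrite (crossed_compat cV) tlift_tlift; last by lin.
  rewrite tlift_exch; apply: eq_tlift => x b.
  rewrite tlift_tlift; last by lin.
  apply: eq_tlift => b1 b'; rewrite tlift_tlift; last by lin.
  by apply: eq_tlift => b2 b3; rewrite tlift_pure; [rewrite !mulrA | lin].
rewrite -sw_coassoc; [|by lin..].
rewrite -[RHS](sw_counitl (F := fun a => \sw_(x, b <- coact v)
  \sw_(a1, a2 <- hcop a) F (act x a1) (b * a2))); last by lin.
apply: eq_tlift => c a'.
rewrite (sw_hantir (F := fun t => \sw_(x, b <- coact v) \sw_(b2, b3 <- hcop a')
    F (act x b2) (t * (b * b3)))); last by lin.
by congr (_ *: _); apply: eq_tlift => x b; apply: eq_tlift => b2 b3; rewrite mul1r.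
Qed.

End Laws.

(** Converse of [sw_crossed]: multiplying the antipode-free form by S(a_1) on the left recovers the
    axiom. New crossed modules are built through it. *)
Lemma crossed_compat_of (v : V) (a : A) : bilinear act -> linear coact ->
  (forall v' a', \sw_(a1, a2 <- hcop a') (\sw_(x, b <- coact (act v' a2)) x ⊗ (a1 * b)) =
    \sw_(x, b <- coact v') \sw_(a1, a2 <- hcop a') act x a1 ⊗ (b * a2)) ->
  coact (act v a) = \sw_(v0, v1 <- coact v) \sw_(a1, a' <- hcop a)
    \sw_(a2, a3 <- hcop a') act v0 a2 ⊗ (hanti a1 * v1 * a3).
Proof.
move=> bact lcoact yd.
rewrite tlift_exch.
transitivity (\sw_(a1, a' <- hcop a) \sw_(a2, a3 <- hcop a')
   \sw_(x, b <- coact (act v a3)) x ⊗ (hanti a1 * a2 * b)).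
  rewrite -sw_coassoc; [|by lin..].
  transitivity (\sw_(c, a' <- hcop a) (hcou c *: coact (act v a'))).
    by rewrite (sw_counitl (F := fun a' => coact (act v a'))) //; lin.
  apply: eq_tlift => c a'.
  rewrite (sw_hantil (F := fun t => \sw_(x, b <- coact (act v a')) x ⊗ (t * b)));
    last by lin.
  by congr (_ *: _); rewrite -[LHS]tlift_pureE; apply: eq_tlift => x b; rewrite mul1r.
apply: eq_tlift => a1 a'.
have := congr1 (tlift (fun x b => x ⊗ (hanti a1 * b))) (yd v a').
rewrite !tlift_tlift; [|lin..] => h.
transitivity (\sw_(a2, a3 <- hcop a')
   tlift (fun x b => x ⊗ (hanti a1 * b)) (\sw_(x, b <- coact (act v a3)) x ⊗ (a2 * b))).
  apply: eq_tlift => a2 a3; rewrite tlift_tlift; last by lin.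
  by apply: eq_tlift => x b; rewrite tlift_pure ?mulrA //; lin.
rewrite h; apply: eq_tlift => x b; rewrite tlift_tlift; last by lin.
by apply: eq_tlift => a2 a3; rewrite tlift_pure ?mulrA //; lin.
Qed.

End CrossedLaws.

(** * The antipode reverses products *)

Section Antipode.
Variables (K : fieldType) (A : hopfAlg K).
Local Notation hS := (@hanti K A).

Lemma hanti1 : hS 1 = 1.
Proof.
have := sw_hantil (F := id) (1 : A) (fun _ _ _ => erefl).
by rewrite sw_hcop1 ?mulr1 ?hcou1 ?scale1r //; lin.
Qed.

(* Both sides are convolution inverse to the product of A. *)
Lemma hantiM (a b : A) : hS (a * b) = hS b * hS a.
Proof.
pose T (x y : A) := \sw_(x1, x' <- hcop x) \sw_(y1, y' <- hcop y)
  \sw_(x2, x3 <- hcop x') \sw_(y2, y3 <- hcop y')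
  (hS (x1 * y1) * (x2 * y2) * (hS y3 * hS x3)).
transitivity (T a b).
  transitivity (\sw_(x1, x' <- hcop a) \sw_(y1, y' <- hcop b)
     hcou x' *: (hcou y' *: hS (x1 * y1))).
    transitivity (\sw_(x1, x' <- hcop a) (hcou x' *: hS (x1 * b))).
      by rewrite (sw_counitr (F := fun x => hS (x * b))) //; lin.
    apply: eq_tlift => x1 x'; rewrite tliftZ; congr (_ *: _).
    by rewrite (sw_counitr (F := fun y => hS (x1 * y))) //; lin.
  apply: eq_tlift => x1 x'; apply: eq_tlift => y1 y'.
  transitivity (\sw_(x2, x3 <- hcop x') (hcou y' *: (hS (x1 * y1) * (x2 * hS x3)))).
    rewrite tliftZ (sw_hantir (F := fun t => hS (x1 * y1) * t)); last by lin.
    by rewrite mulr1 scalerA mulrC -scalerA.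
  apply: eq_tlift => x2 x3.
  transitivity (\sw_(y2, y3 <- hcop y') (hS (x1 * y1) * (x2 * (y2 * hS y3) * hS x3))).
    rewrite (sw_hantir (F := fun t => hS (x1 * y1) * (x2 * t * hS x3))); last by lin.
    by rewrite mulr1.
  by apply: eq_tlift => y2 y3; rewrite !mulrA.
transitivity (\sw_(x, x3 <- hcop a) \sw_(y, y3 <- hcop b)
   hcou x *: (hcou y *: (hS y3 * hS x3))); last first.
  transitivity (\sw_(x, x3 <- hcop a) (hcou x *: (hS b * hS x3))).
    apply: eq_tlift => x x3; rewrite tliftZ; congr (_ *: _).
    by rewrite (sw_counitl (F := fun y => hS y * hS x3)) //; lin.
  by rewrite (sw_counitl (F := fun x => hS b * hS x)) //; lin.
rewrite /T.
transitivity (\sw_(x1, x' <- hcop a) \sw_(x2, x3 <- hcop x')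
    \sw_(y1, y' <- hcop b) \sw_(y2, y3 <- hcop y')
  (hS (x1 * y1) * (x2 * y2) * (hS y3 * hS x3))).
  by apply: eq_tlift => x1 x'; rewrite tlift_exch; apply: eq_tlift => x2 x3.
rewrite -sw_coassoc; [|by lin..].
apply: eq_tlift => x x3.
transitivity (\sw_(x1, x2 <- hcop x) \sw_(y, y3 <- hcop b) \sw_(y1, y2 <- hcop y)
  (hS (x1 * y1) * (x2 * y2) * (hS y3 * hS x3))).
  by apply: eq_tlift => x1 x2; rewrite sw_coassoc //; lin.
rewrite tlift_exch; apply: eq_tlift => y y3.
rewrite -(sw_hcopM (F := fun s t => hS s * t * (hS y3 * hS x3))); last by lin.
rewrite (sw_hantil (F := fun t => t * (hS y3 * hS x3))); last by lin.
by rewrite hcouM mul1r scalerA.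
Qed.

End Antipode.

(** * Graded spaces *)

Section Gradings.
Variables (K : fieldType) (V : lmodType K) (G : nat -> set V).

Lemma sum_nth_widen (U : lmodType K) (F : nat -> V -> U) (s : seq V) N :
  (forall i, F i 0 = 0) -> (size s <= N)%N ->
  \sum_(i < size s) F i s`_i = \sum_(i < N) F i s`_i.
Proof.
move=> F0 sN; rewrite (big_ord_widen_cond N predT (fun i => F i s`_i)) //.
rewrite big_mkcond; apply: eq_bigr => i _ /=; case: ltnP => // si.
by rewrite nth_default.
Qed.

(** Lists of components may have different lengths; entries past the end read as 0, so the longer
    length serves for both. *)
Lemma homogeneous_comb c s t : (forall n, is_subspace (G n)) ->
  homogeneous_seq G s -> homogeneous_seq G t ->
  let u := mkseq (fun i => c *: s`_i + t`_i) (maxn (size s) (size t)) in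
  [/\ homogeneous_seq G u, forall i, u`_i = c *: s`_i + t`_i &
  \sum_(i < size u) u`_i =
  c *: (\sum_(i < size s) s`_i) + \sum_(i < size t) t`_i].
Proof.
move=> sG hs ht u.
have uE i : u`_i = c *: s`_i + t`_i.
  case: (ltnP i (maxn (size s) (size t))) => [lt|]; first by rewrite nth_mkseq.
  rewrite geq_max => /andP [si ti].
  by rewrite nth_default ?size_mkseq ?geq_max ?si // !nth_default // scaler0 addr0.
split=> // [i|]; first by rewrite uE; apply: subspaceP.
rewrite (sum_nth_widen (F := fun _ x => x) (N := maxn (size s) (size t))) //; last first.
  by rewrite size_mkseq.
rewrite (sum_nth_widen (s := s) (F := fun _ x => x) (N := maxn (size s) (size t))) //;
  last exact: leq_maxl.
rewrite (sum_nth_widen (s := t) (F := fun _ x => x) (N := maxn (size s) (size t))) //;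
  last exact: leq_maxr.
by rewrite scaler_sumr -big_split; apply: eq_bigr => i _.
Qed.

Section Maps.
Hypothesis gG : is_grading G.
Let sG := grading_sub gG.

Lemma componentsP x : homogeneous_seq G (components G x) /\
  x = \sum_(i < size (components G x)) (components G x)`_i.
Proof.
have [s hs sx] := grading_span gG x.
exact: (@xgetPex _ _ [set s | homogeneous_seq G s /\ x = \sum_(i < size s) s`_i]
  (ex_intro _ s (conj hs sx))).
Qed.

(** The difference with the chosen decomposition is homogeneous with sum zero, so [grading_free]
    kills each of its entries. *)
Lemma components_nth s : homogeneous_seq G s ->
  forall i, (components G (\sum_(i < size s) s`_i))`_i = s`_i.
Proof.
move=> hs; have [] := componentsP (\sum_(i < size s) s`_i).
set c := components _ _ => hc sc i.
have [hu uE us] := homogeneous_comb (-1) sG hs hc.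
move: us; rewrite -sc scaleN1r addNr => /(grading_free gG hu) /(_ i).
by rewrite uE scaleN1r addrC => /eqP; rewrite subr_eq0 => /eqP.
Qed.

Lemma gmap_sum (U : lmodType K) (F : nat -> V -> U) s :
  (forall n, linear (F n)) -> homogeneous_seq G s ->
  gmap G F (\sum_(i < size s) s`_i) = \sum_(i < size s) F i s`_i.
Proof.
move=> lF hs; rewrite /gmap; have cE := components_nth hs.
set c := components _ _ in cE *; pose N := maxn (size c) (size s).
have F0 i : F i 0 = 0 by apply: lin0.
rewrite (sum_nth_widen (N := N)) ?leq_maxl // (sum_nth_widen (N := N) F0) ?leq_maxr //.
by apply: eq_bigr => i _; rewrite cE.
Qed.

Lemma gmap_linear (U : lmodType K) (F : nat -> V -> U) :
  (forall n, linear (F n)) -> linear (gmap G F).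
Proof.
move=> lF c x y.
have [hx {1}->] := componentsP x; have [hy {1}->] := componentsP y.
have [hu uE <-] := homogeneous_comb c sG hx hy.
rewrite gmap_sum // size_mkseq /gmap.
have F0 i : F i 0 = 0 by apply: lin0.
set N := maxn _ _.
rewrite (sum_nth_widen (s := components G x) (N := N)) ?leq_maxl //.
rewrite (sum_nth_widen (s := components G y) (N := N)) ?leq_maxr //.
rewrite scaler_sumr -big_split; apply: eq_bigr => i _ /=.
by rewrite uE lF.
Qed.

Lemma gmap_hom (U : lmodType K) (F : nat -> V -> U) n x :
  (forall i, linear (F i)) -> G n x -> gmap G F x = F n x.
Proof.
move=> lF Gx; pose s := rcons (nseq n 0) x.
have sE i : s`_i = if i == n then x else 0.
  rewrite nth_rcons size_nseq; case: ltngtP => // lt; rewrite nth_nseq lt //.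
have hs : homogeneous_seq G s.
  by move=> i; rewrite sE; case: eqP => [->|_] //; apply: subspace0.
have F0 i : F i 0 = 0 by apply: lin0.
have pick (U' : lmodType K) (H : nat -> V -> U') : (forall i, H i 0 = 0) ->
    \sum_(i < size s) H i s`_i = H n x.
  move=> H0; rewrite size_rcons size_nseq big_ord_recr /= sE eqxx big1 ?add0r //.
  by move=> i _; rewrite sE ltn_eqF.
by have := gmap_sum lF hs; rewrite (pick _ (fun _ y => y)) // pick.
Qed.

Lemma hom_ind (P : V -> Prop) : is_subspace P ->
  (forall n x, G n x -> P x) -> forall x, P x.
Proof.
move=> sP GP x; have [s hs ->] := grading_span gG x.
by apply: subspace_sum => // i _; apply: GP (hs i).
Qed.

Lemma hom_eq (U : lmodType K) (f g : V -> U) : linear f -> linear g ->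
  (forall n x, G n x -> f x = g x) -> forall x, f x = g x.
Proof. by move=> lf lg fg; apply: (hom_ind (eq_linear_subspace lf lg)). Qed.

Lemma gmap_ext (U : lmodType K) (F F' : nat -> V -> U) x :
  (forall n x, G n x -> F n x = F' n x) -> gmap G F x = gmap G F' x.
Proof. by move=> FF; apply: eq_bigr => i _; apply: FF; case: (componentsP x). Qed.

Definition gcomp n : V -> V := gmap G (fun i y => if i == n then y else 0).

Lemma gcomp_linear n : linear (gcomp n).
Proof.
apply: gmap_linear => i; case: (i == n); [exact: lin_id | exact: lin_cst0].
Qed.

Lemma gcomp_hom n m x : G m x -> gcomp n x = if m == n then x else 0.
Proof.
move=> Gx; rewrite /gcomp (gmap_hom _ Gx) // => i.
by case: (i == n); [exact: lin_id | exact: lin_cst0].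
Qed.

Lemma gcomp_deg n x : G n (gcomp n x).
Proof.
apply: (hom_ind (P := fun x => G n (gcomp n x))).
  exact: (preim_subspace (@gcomp_linear n)).
by move=> m y Gy; rewrite (gcomp_hom n Gy); case: eqP => [<-|_] //; apply: subspace0.
Qed.

Lemma components0 x : (components G x)`_0 = gcomp 0 x.
Proof.
have [hc sc] := componentsP x; rewrite {2}sc /gcomp gmap_sum //.
  case: (components G x) => [|y s]; first by rewrite big_ord0.
  by rewrite big_ord_recl big1 ?addr0.
by move=> i; case: (i == 0)%N; [exact: lin_id | exact: lin_cst0].
Qed.

(** The sign produced when an element is moved past one of degree j. Being linear, it turns a super
    flip or braiding with one factor of degree j into a formula valid for every other factor. *)
Definition twist (j : nat) : V -> V := gmap G (fun i x => (-1) ^+ (j * i) *: x).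

Lemma twist_linear j : linear (twist j).
Proof. by apply: gmap_linear => i; apply: lin_scalef; apply: lin_id. Qed.

Lemma twist_hom j i x : G i x -> twist j x = (-1) ^+ (j * i) *: x.
Proof.
by move=> Gx; rewrite /twist (gmap_hom _ Gx) // => n; apply: lin_scalef; apply: lin_id.
Qed.

Lemma twist_deg j i x : G i x -> G i (twist j x).
Proof. by move=> Gx; rewrite (twist_hom j Gx); apply: subspaceZ. Qed.

Lemma twist0 x : twist 0 x = x.
Proof.
move: x; apply: hom_eq; [exact: twist_linear | exact: lin_id |].
by move=> n x Gx; rewrite (twist_hom _ Gx) mul0n scale1r.
Qed.

Lemma twistD i j x : twist (i + j) x = twist i (twist j x).
Proof.
move: x; apply: hom_eq; first exact: twist_linear.
  by apply: lin_comp; apply: twist_linear.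
move=> n x Gx; rewrite (twist_hom j Gx) (linZ (@twist_linear i)) !(twist_hom _ Gx).
by rewrite scalerA -exprD mulnDl addnC.
Qed.

Lemma twist_even i x : twist i.*2 x = x.
Proof.
move: x; apply: hom_eq; [exact: twist_linear | exact: lin_id |].
by move=> n x Gx; rewrite (twist_hom _ Gx) -mul2n -mulnA exprM sqrrN !expr1n scale1r.
Qed.

Lemma parityE x : parity G x = twist 1 x.
Proof. by apply: gmap_ext => n y _; rewrite mul1n. Qed.

End Maps.

(** Candidate projections p replace freeness: applied to a homogeneous sum equal to zero, p i
    isolates the i-th term. *)
Lemma gradingI (p : nat -> V -> V) : (forall n, is_subspace (G n)) ->
  (forall n, linear (p n)) ->
  (forall m n x, G n x -> p m x = if m == n then x else 0) ->
  (forall x, lspan [set y | exists n, G n y] x) -> is_grading G.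
Proof.
move=> sG lp pE Gspan; split=> // [x|s hs s0 i]; last first.
  case: (ltnP i (size s)) => [si|]; last exact: nth_default.
  have := congr1 (p i) s0; rewrite (lin_sum _ _ _ (lp i)) (lin0 (lp i)) (bigD1 (Ordinal si)) //=.
  rewrite (pE _ _ _ (hs i)) eqxx big1 ?addr0 // => j ji.
  rewrite (pE _ _ _ (hs j)); case: eqP => // ij; case/eqP: ji.
  exact/val_inj.
suff [s [hs ->]] : [set x | exists s, homogeneous_seq G s /\
    x = \sum_(i < size s) s`_i] x by exists s.
apply: (lspan_min _ _ (Gspan x)) => [|y [n Gy]].
  split; first by exists [::]; split; [move=> i; rewrite nth_nil; apply: subspace0
                                      |rewrite big_ord0].
  move=> c _ _ [s [hs ->]] [t [ht ->]].
  have [hu _ uE] := homogeneous_comb c sG hs ht.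
  by eexists; split; [exact: hu | rewrite uE].
exists (rcons (nseq n 0) y); split=> [i|].
  rewrite nth_rcons size_nseq nth_nseq; case: ltngtP => [||->] // _; exact: subspace0.
rewrite size_rcons size_nseq big_ord_recr /= nth_rcons size_nseq ltnn eqxx.
by rewrite big1 ?add0r // => i _; rewrite nth_rcons size_nseq ltn_ord nth_nseq ltn_ord.
Qed.

End Gradings.

Lemma twist_morph (K : fieldType) (V V' : lmodType K) (G : nat -> set V)
    (G' : nat -> set V') (f : V -> V') j x :
  is_grading G -> is_grading G' -> linear f ->
  (forall n x, G n x -> G' n (f x)) -> f (twist G j x) = twist G' j (f x).
Proof.
move=> gG gG' lf fdeg; move: x; apply: (hom_eq gG).
- by apply: lin_comp => //; apply: twist_linear.
- by apply: lin_comp => //; apply: twist_linear.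
by move=> n x Gx; rewrite (twist_hom _ _ Gx) // linZ // (twist_hom _ _ (fdeg _ _ Gx)).
Qed.

#[global] Hint Extern 2 (GRing.linear_for _ (@twist _ _ _ _)) =>
  eapply twist_linear : linh.

(** * The universal property of the tensor algebra *)

Section SubspaceType.
Variables (K : fieldType) (V : lmodType K) (W : set V).

(** The type carries the proof that W is a subspace, so that the module structure built from it is
    inferred from the type alone. It serves for linear endomorphisms, multilinear functions and
    left-invariant forms. *)
Definition subsp of is_subspace W : Type := {x : V | `[< W x >]}.

Variable sW : is_subspace W.
Local Notation T := (subsp sW).

HB.instance Definition _ := Choice.copy T {x : V | `[< W x >]}.

Definition sval_subsp (x : T) : V := sval x.

Lemma subsp_mem (x : T) : W (sval_subsp x).
Proof. by case: x => x /= /asboolP. Qed.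

Definition Subsp (x : V) (Wx : W x) : T := exist _ x (asboolT Wx).

Lemma subsp_inj : injective sval_subsp.
Proof. exact: val_inj. Qed.

Let zero := Subsp (subspace0 sW).
Let opp (x : T) := Subsp (subspaceZ sW (-1) (subsp_mem x)).
Let add (x y : T) := Subsp (subspaceD sW (subsp_mem x) (subsp_mem y)).
Let scale c (x : T) := Subsp (subspaceZ sW c (subsp_mem x)).

Let addA : associative add.
Proof. by move=> x y z; apply: subsp_inj; apply: addrA. Qed.
Let addC : commutative add.
Proof. by move=> x y; apply: subsp_inj; apply: addrC. Qed.
Let add0 : left_id zero add.
Proof. by move=> x; apply: subsp_inj; apply: add0r. Qed.
Let addN : left_inverse zero opp add.
Proof. by move=> x; apply: subsp_inj; rewrite /= scaleN1r; apply: addNr. Qed.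

HB.instance Definition _ := GRing.isZmodule.Build T addA addC add0 addN.

Let scaleA a b x : scale a (scale b x) = scale (a * b) x.
Proof. by apply: subsp_inj; apply: scalerA. Qed.
Let scale1 : left_id 1 scale.
Proof. by move=> x; apply: subsp_inj; apply: scale1r. Qed.
Let scaleDr : right_distributive scale +%R.
Proof. by move=> c x y; apply: subsp_inj; apply: scalerDr. Qed.
Let scaleDl x : {morph scale^~ x : a b / a + b}.
Proof. by move=> a b; apply: subsp_inj; apply: scalerDl. Qed.

HB.instance Definition _ :=
  GRing.Zmodule_isLmodule.Build K T scaleA scale1 scaleDr scaleDl.

End SubspaceType.

Section EndomorphismAlgebra.
Variables (K : fieldType) (M : lmodType K) (m0 : M).
Hypothesis m0_neq0 : m0 != 0.

Lemma linear_subspace : is_subspace [set f : M -> M | linear f].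
Proof.
split; first exact: lin_cst0.
by move=> c f g lf lg; apply: lin_addf => //; apply: lin_scalef.
Qed.

(** An [algType] must satisfy 1 ≠ 0, hence the nonzero vector among the parameters of the type. *)
Definition endo of m0 != 0 : Type := subsp linear_subspace.
Local Notation T := (endo m0_neq0).

HB.instance Definition _ := GRing.Lmodule.copy T (subsp linear_subspace).

Definition endo_fun (f : T) : M -> M := sval_subsp (f : subsp linear_subspace).
Lemma endo_lin (f : T) : linear (endo_fun f). Proof. exact: (subsp_mem (f : subsp linear_subspace)). Qed.

Definition Endo (f : M -> M) (lf : linear f) : T := Subsp linear_subspace lf.

Let one : T := Endo (@lin_id K M).
Let mul (f g : T) : T := Endo (lin_comp (endo_lin f) (endo_lin g)).

Let endo_inj : injective endo_fun. Proof. exact: subsp_inj. Qed.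

Let mulA : associative mul.
Proof. by move=> f g h; apply: endo_inj. Qed.
Let mul1 : left_id one mul.
Proof. by move=> f; apply: endo_inj. Qed.
Let mulx1 : right_id one mul.
Proof. by move=> f; apply: endo_inj. Qed.
Let mulDl : left_distributive mul +%R.
Proof. by move=> f g h; apply: endo_inj; apply/funext. Qed.
Let mulDr : right_distributive mul +%R.
Proof. by move=> f g h; apply: endo_inj; apply/funext => x; apply: linD (endo_lin f) _ _. Qed.
Let one_neq0 : one != 0.
Proof. by apply: contra_neq m0_neq0 => /(congr1 (fun f => endo_fun f m0)). Qed.

HB.instance Definition _ :=
  GRing.Zmodule_isNzRing.Build T mulA mul1 mulx1 mulDl mulDr one_neq0.

Let scaleAl c (f g : T) : c *: (f * g) = (c *: f) * g.
Proof. by apply: endo_inj. Qed.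

HB.instance Definition _ := GRing.Lmodule_isLalgebra.Build K T scaleAl.

Let scaleAr c (f g : T) : c *: (f * g) = f * (c *: g).
Proof. by apply: endo_inj; apply/funext => x; rewrite /= (linZ (endo_lin f)). Qed.

HB.instance Definition _ := GRing.Lalgebra_isAlgebra.Build K T scaleAr.

Lemma endo_mulE (f g : T) x : endo_fun (f * g) x = endo_fun f (endo_fun g x).
Proof. by []. Qed.

End EndomorphismAlgebra.

Definition multilinear (K : fieldType) (V U : lmodType K) (F : seq V -> U) :=
  forall s t, linear (fun v => F (s ++ v :: t)).

Section WordLift.
Variables (K : fieldType) (V U : lmodType K).

Lemma multilinear_subspace : is_subspace [set F : seq V -> U | multilinear F].
Proof.
split; first by move=> s t; apply: lin_cst0.
by move=> c F F' mF mF' s t; apply: lin_addf => //; apply: lin_scalef.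
Qed.

End WordLift.

Section WordLift.
Variables (K : fieldType) (V U : lmodType K).
(** The factor K keeps the module of multilinear functions nonzero even if U is zero: in it [m0]
    takes the value 1 on the empty word. *)
Let U1 : lmodType K := (U * K^o)%type.
Let M : lmodType K := subsp (@multilinear_subspace K V U1).

Let Mfun (m : M) : seq V -> U1 := sval_subsp m.

Let m0_multilinear : multilinear (fun w : seq V => (0, (nilp w)%:R) : U1).
Proof.
move=> s t; have h v : nilp (s ++ v :: t) = false by case: s.
by move=> c x y; rewrite !h /= scaler0 addr0.
Qed.

Let m0 : M := Subsp (@multilinear_subspace K V U1) m0_multilinear.

Let m0_neq0 : m0 != 0.
Proof.
apply/eqP => /(congr1 (fun m => (Mfun m [::]).2)) /= /eqP.
by rewrite oner_eq0.
Qed.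

Let B := endo m0_neq0.

Let shift_multilinear v (m : M) : multilinear (fun w => Mfun m (rcons w v)).
Proof.
move=> s t c x y; rewrite !rcons_cat !rcons_cons.
by have := subsp_mem m s (rcons t v); apply.
Qed.

Let shift v (m : M) : M := Subsp (@multilinear_subspace K V U1) (shift_multilinear v m).

Let shift_linear v : linear (shift v).
Proof. by move=> c m m'; apply: subsp_inj; apply/funext. Qed.

Let right_shift (v : V) : B := Endo m0_neq0 (@shift_linear v).

Let right_shift_linear : linear right_shift.
Proof.
move=> c v v'; apply: subsp_inj; apply/funext => m; apply: subsp_inj.
apply/funext => w; have := subsp_mem m w [::] c v v'.
by rewrite !cats1.
Qed.

(** Letters are appended on the right, so that the composite of the shifts, whose outermost factor
    is the first letter, restores the order of the word. *)
Let right_shiftE w (m : M) s :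
  Mfun (endo_fun (\prod_(v <- w) right_shift v) m) s = Mfun m (s ++ w).
Proof.
elim: w s => [|v w IHw] s; first by rewrite big_nil cats0.
rewrite big_cons endo_mulE -cat_rcons -IHw.
by [].
Qed.

Variable F : seq V -> U.
Hypothesis mF : multilinear F.

Let F1_multilinear : multilinear (fun w : seq V => (F w, 0) : U1).
Proof.
move=> s t c x y; rewrite (mF s t c x y).
by congr (_, _); rewrite /= scaler0 addr0.
Qed.

Let F1 : M := Subsp (@multilinear_subspace K V U1) F1_multilinear.

(* Letters act on multilinear functions of words by shifts; evaluating the
   resulting endomorphism at F separates the values of F. *)
Lemma wsum_wrel (s t : seq (K * seq V)) : wrel s t -> wsum F s = wsum F t.
Proof.
move=> /asboolP h; have := h (B : algType K) right_shift right_shift_linear.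
have E u : wsum F u = (Mfun (endo_fun (weval right_shift u) F1) [::]).1.
  rewrite /weval /wsum.
  elim: u => [|[c w] u IHu]; first by rewrite !big_nil.
  rewrite !big_cons IHu /=.
  transitivity (c *: (Mfun (endo_fun (\prod_(v <- w) right_shift v) F1) [::]).1 +
    (Mfun (endo_fun (\sum_(j <- u) j.1 *: (\prod_(v <- j.2) right_shift v)) F1) [::]).1).
    by rewrite right_shiftE.
  by [].
by move=> eq_st; rewrite !E eq_st.
Qed.

Lemma wsum_repr s : wsum F (repr (\pi_(talg V) s)) = wsum F s.
Proof.
apply: wsum_wrel.
have /eqquotP : repr (\pi_(talg V) s) = s %[mod talg V] by rewrite reprK.
by [].
Qed.

Lemma wlift_linear : linear (wlift F).
Proof.
move=> c x y.
have -> : wlift F (c *: x + y) =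
    wsum F (repr (c *: x) ++ repr y) by exact: wsum_repr.
rewrite /wsum big_cat /=; congr (_ + _).
transitivity (wsum F [seq (c * p.1, p.2) | p <- repr x]); first exact: wsum_repr.
rewrite /wsum big_map scaler_sumr; apply: eq_bigr => p _ /=.
by rewrite scalerA.
Qed.

Lemma talg_word (w : seq V) : \pi_(talg V) [:: (1 : K, w)] = \prod_(v <- w) tin v.
Proof.
have wevalE (B' : algType K) (f : V -> B') u : weval f [:: (1, u)] = \prod_(v <- u) f v.
  by rewrite /weval /wsum big_seq1 scale1r.
elim: w => [|v w IHw]; first by rewrite big_nil.
rewrite big_cons -IHw; apply/eqquotP/asboolP => B' f lf.
have rE u : weval f (repr (\pi_(talg V) u)) = weval f u.
  have /eqquotP/asboolP/(_ B' f lf) : repr (\pi_(talg V) u) = u %[mod talg V].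
    by rewrite reprK.
  by [].
set r1 := repr (tin v); set r2 := repr _.
have r1E : weval f r1 = f v by rewrite rE wevalE big_seq1.
have r2E : weval f r2 = \prod_(u <- w) f u by rewrite rE wevalE.
rewrite wevalE big_cons -r1E -r2E /weval /wsum big_allpairs_dep mulr_suml.
apply: eq_bigr => p _; rewrite mulr_sumr; apply: eq_bigr => q _ /=.
by rewrite big_cat -scalerAl -scalerAr scalerA.
Qed.

Lemma wlift_word w : wlift F (\prod_(v <- w) tin v) = F w.
Proof.
by rewrite -talg_word /wlift wsum_repr /wsum big_seq1 scale1r.
Qed.

End WordLift.

Section TensorAlgebraInduction.
Variables (K : fieldType) (V : lmodType K).

Lemma word_ind (P : talg V -> Prop) : is_subspace P ->
  (forall w, P (\prod_(v <- w) tin v)) -> forall x, P x.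
Proof.
move=> sP Pw x; rewrite [x]talg_sum /wlift /wsum.
by apply: subspace_sum => // p _; apply: subspaceZ.
Qed.

Lemma talg_ind (P : talg V -> Prop) : is_subspace P -> P 1 ->
  (forall v x, P x -> P (tin v * x)) -> forall x, P x.
Proof.
move=> sP P1 Pv; apply: word_ind => //; elim=> [|v w IHw]; first by rewrite big_nil.
by rewrite big_cons; apply: Pv.
Qed.

Lemma talg_eq (U : lmodType K) (f g : talg V -> U) : linear f -> linear g ->
  f 1 = g 1 -> (forall v x, f x = g x -> f (tin v * x) = g (tin v * x)) ->
  forall x, f x = g x.
Proof. by move=> lf lg; apply: talg_ind; apply: eq_linear_subspace. Qed.

Variables (U : lmodType K) (g : V -> U -> U) (z : U).
Hypothesis bg : bilinear g.

Lemma foldr_multilinear : multilinear (foldr g z).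
Proof.
move=> s t c x y; elim: s => [|v s IHs] /=; first exact: bg.2.
by rewrite IHs bg.1.
Qed.

(** The coaction, coproduct and antipode of the tensor algebra and the map φ of the converse all
    have this form; [wfold1] and [wfoldM] are their recursion equations. *)
Definition wfold : talg V -> U := wlift (foldr g z).

Lemma wfold_linear : linear wfold.
Proof. exact: wlift_linear foldr_multilinear. Qed.

Lemma wfold1 : wfold 1 = z.
Proof. by have := wlift_word foldr_multilinear [::]; rewrite big_nil. Qed.

Lemma wfoldM v x : wfold (tin v * x) = g v (wfold x).
Proof.
move: x; apply: (word_ind (P := fun x => wfold (tin v * x) = g v (wfold x))).
  apply: eq_linear_subspace.
    by apply: (lin_comp wfold_linear); lin.
  by apply: lin_comp wfold_linear; lin.
move=> w; rewrite /wfold (wlift_word foldr_multilinear).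
by have := wlift_word foldr_multilinear (v :: w); rewrite big_cons.
Qed.

End TensorAlgebraInduction.

(** * Braidings *)

Section Braidings.
Variables (K : fieldType) (V : lmodType K) (G : nat -> set V).
Hypothesis gG : is_grading G.

Lemma super_flip_bilinear : bilinear (super_flip G).
Proof.
split=> [y|x].
  apply: lin_sumf => i; apply: gmap_linear => // j; lin.
by apply: gmap_linear => // i; apply: lin_sumf => j; lin.
Qed.

Lemma super_flipE k (y x : V) : G k y -> super_flip G y x = twist G k x ⊗ y.
Proof.
move=> Gy; rewrite /super_flip (gmap_hom gG _ Gy); last first.
  by move=> i; apply: lin_sumf => j; lin.
move: x; apply: (hom_eq gG); first by apply: gmap_linear => // i; lin.
  by apply: (lin_comp (g := fun z => z ⊗ y)); [lin | apply: twist_linear].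
move=> i x Gx; rewrite (gmap_hom gG _ Gx); last by move=> j; lin.
by rewrite (twist_hom _ _ Gx) // pureZl.
Qed.

Lemma twistM (mul : V -> V -> V) j (x y : V) : bilinear mul ->
  (forall m n x y, G m x -> G n y -> G (m + n)%N (mul x y)) ->
  twist G j (mul x y) = mul (twist G j x) (twist G j y).
Proof.
move=> bm dm.
have lt : linear (twist G j) by apply: twist_linear.
move: x; apply: (hom_eq gG); [by lin | by lin |] => m x Gx.
move: y; apply: (hom_eq gG); [by lin | by lin |] => n y Gy.
rewrite !(twist_hom gG _ Gx, twist_hom gG _ Gy, twist_hom gG _ (dm _ _ _ _ Gx Gy)).
rewrite (linZ (lin_bil2 _ bm)) (linZ (lin_bil1 y bm)) scalerA.
by rewrite mulnDr exprD mulrC.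
Qed.

Variables (A : hopfAlg K) (act : V -> A -> V) (coact : V -> V ⊗ A).
Hypotheses (bact : bilinear act) (lcoact : linear coact).

Lemma super_braiding_bilinear : bilinear (super_braiding G act coact).
Proof.
split=> [y|x].
  by apply: lin_sumf => i; apply: gmap_linear => // j; lin.
by apply: gmap_linear => // i; apply: lin_sumf => j; lin.
Qed.

Lemma super_braidingE k (y x : V) : G k y ->
  super_braiding G act coact y x = \sw_(x0, x1 <- coact (twist G k x)) x0 ⊗ act y x1.
Proof.
move=> Gy; rewrite /super_braiding (gmap_hom gG _ Gy); last first.
  by move=> i; apply: lin_sumf => j; lin.
have lt : linear (twist G k) by apply: twist_linear.
move: x; apply: (hom_eq gG); first by apply: gmap_linear => // i; lin.
  by lin.
move=> i x Gx; rewrite (gmap_hom gG _ Gx); last by move=> j; lin.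
by rewrite (twist_hom gG _ Gx) (linZ lcoact) tliftZr //; lin.
Qed.

Hypothesis coact_deg : forall n x, G n x ->
  lspan [set t : V ⊗ A | exists2 y, G n y & exists a, t = y ⊗ a] (coact x).

Lemma sw_coact_twist (U : lmodType K) (F : V -> A -> U) k x : bilinear F ->
  tlift F (coact (twist G k x)) = \sw_(x0, x1 <- coact x) F (twist G k x0) x1.
Proof.
move=> bF; have lt : linear (twist G k) by apply: twist_linear.
move: x; apply: (hom_eq gG); [by lin | by lin |] => n x Gx.
rewrite (twist_hom gG _ Gx) (linZ lcoact) tliftZr // -tliftZ.
apply: (eq_tlift_span _ _ (coact_deg Gx)); [by lin | by lin |].
move=> _ [y Gy [a ->]]; exists y, a; split=> //.
by rewrite (twist_hom gG _ Gy) (linZ (f := F^~ a)) //; lin.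
Qed.

Lemma twist_act k x a : (forall n x a, G n x -> G n (act x a)) ->
  twist G k (act x a) = act (twist G k x) a.
Proof.
move=> dact; symmetry; apply: (twist_morph (f := act^~ a)) => //; first by lin.
by move=> n y; apply: dact.
Qed.

End Braidings.

#[global] Hint Extern 2 (bilinear (super_flip _)) =>
  eapply super_flip_bilinear : linh.
#[global] Hint Extern 2 (bilinear (super_braiding _ _ _)) =>
  eapply super_braiding_bilinear : linh.

Section BraidedProduct.
Variables (K : fieldType) (V : lmodType K) (mul : V -> V -> V) (br : V -> V -> V ⊗ V).
Hypotheses (bmul : bilinear mul) (bbr : bilinear br).

Lemma braided_mul_bilinear : bilinear (braided_mul mul br).
Proof. by rewrite /braided_mul; lin. Qed.

Lemma braided_mul_pure x y x' y' : braided_mul mul br (x ⊗ y) (x' ⊗ y') =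
  \sw_(u, v <- br y x') mul x u ⊗ mul v y'.
Proof.
rewrite /braided_mul tlift_pure; last by lin.
by rewrite tlift_pure //; lin.
Qed.

End BraidedProduct.

#[global] Hint Extern 2 (bilinear (braided_mul _ _)) =>
  eapply braided_mul_bilinear : linh.

(** * The braided-super Hopf algebra on the tensor algebra *)

Section TensorAlgebraModule.
Variables (K : fieldType) (A : hopfAlg K) (V : crossedMod A).
Local Notation T := (talg V).
Local Notation tact := (@talg_act K A V).
Local Notation tcoact := (@talg_coact K A V).
Local Notation tdeg := (@talg_deg K A V).
Let cV := crossedP V.
Let vact_bilinear : bilinear (@cmact K A V) := crossed_act_bilinear cV.
Let vcoact_linear : linear (@cmcoact K A V) := crossed_coact_linear cV.
Let tinl : linear (@tin K V) := @tin_linear K V.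
#[local] Hint Resolve vact_bilinear vcoact_linear tinl : linh.

Let word_act (w : seq V) (a : A) : T := foldr
  (fun (v : V) f b => \sw_(b1, b2 <- hcop b) (tin (cmact v b1) * f b2))
  (fun b => hcou b *: 1) w a.

Let word_act_linear w : linear (word_act w).
Proof.
elim: w => [|v w IHw]; first by rewrite /word_act /=; lin.
change (linear (fun b => \sw_(b1, b2 <- hcop b) (tin (cmact v b1) * word_act w b2))).
by lin.
Qed.

(** The fold produces a function of a, each letter consuming a leg of its coproduct; multilinearity
    is therefore proved by induction for all a at once instead of through [wfold]. *)
Let word_act_multilinear a : multilinear (fun w => word_act w a).
Proof.
move=> s t; elim: s a => [|u s IHs] a.
  have lw := word_act_linear t.
  change (linear (fun v => \sw_(b1, b2 <- hcop a) (tin (cmact v b1) * word_act t b2))).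
  by lin.
change (linear (fun v => \sw_(b1, b2 <- hcop a)
  (tin (cmact u b1) * word_act (s ++ v :: t) b2))).
apply: lin_tliftf => b1 b2.
by apply: (lin_comp (g := GRing.mul (tin (cmact u b1)))) (IHs b2); lin.
Qed.

Lemma tact_bilinear : bilinear tact.
Proof.
split=> [x|a]; last exact: (wlift_linear (@word_act_multilinear a)).
change (linear (fun b => \sum_(p <- repr x) p.1 *: word_act p.2 b)).
apply: lin_sumf => p.
by apply: lin_scalef; apply: word_act_linear.
Qed.
#[local] Hint Resolve tact_bilinear : linh.

Lemma tact1 a : tact 1 a = hcou a *: 1.
Proof. by have := wlift_word (@word_act_multilinear a) [::]; rewrite big_nil. Qed.

Lemma tactM v x a :
  tact (tin v * x) a = \sw_(a1, a2 <- hcop a) (tin (cmact v a1) * tact x a2).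
Proof.
move: x; apply: word_ind => [|w]; first by apply: eq_linear_subspace; lin.
have := wlift_word (@word_act_multilinear a) (v :: w).
rewrite big_cons => tE; rewrite [LHS]tE /=; apply: eq_tlift => a1 a2; congr (_ * _).
by have := wlift_word (@word_act_multilinear a2) w.
Qed.

Lemma tact_tin v a : tact (tin v) a = tin (cmact v a).
Proof.
rewrite -[tin v]mulr1 tactM -[RHS]mulr1.
rewrite -(sw_counitr (F := fun a => tin (cmact v a) * 1)); last by lin.
by apply: eq_tlift => a1 a2; rewrite tact1 -scalerAr.
Qed.

Lemma tact_mul x y a :
  tact (x * y) a = \sw_(a1, a2 <- hcop a) (tact x a1 * tact y a2).
Proof.
move: x a; apply: talg_ind => [|a|v x IHx a].
- by apply: forall_subspace => a; apply: eq_linear_subspace; lin.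
- rewrite mul1r -(sw_counitl (F := tact y)); last by lin.
  by apply: eq_tlift => a1 a2; rewrite tact1 -scalerAl mul1r.
rewrite -mulrA tactM.
transitivity (\sw_(a1, a' <- hcop a) \sw_(a2, a3 <- hcop a')
    tin (cmact v a1) * tact x a2 * tact y a3).
  apply: eq_tlift => a1 a'; rewrite IHx -tlift_map; last by lin.
  by apply: eq_tlift => a2 a3; rewrite mulrA.
rewrite -sw_coassoc; [|by lin..].
apply: eq_tlift => a' a3; rewrite tactM.
by rewrite (tlift_map (f := fun z => z * tact y a3)) //; lin.
Qed.

Lemma tact_1 x : tact x 1 = x.
Proof.
move: x; apply: talg_eq => [|||v x IHx]; [by lin | by lin | |].
  by rewrite tact1 hcou1 scale1r.
by rewrite tactM sw_hcop1 ?(crossed_act1 cV) ?IHx //; lin.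
Qed.

Lemma tact_comp x a b : tact x (a * b) = tact (tact x a) b.
Proof.
move: x a b; apply: talg_ind => [|a b|v x IHx a b].
- by do 2!apply: forall_subspace => ?; apply: eq_linear_subspace; lin.
- by rewrite !tact1 (linZ (lin_bil1 b tact_bilinear)) tact1 hcouM scalerA mulrC.
rewrite !tactM sw_hcopM; last by lin.
rewrite -(tlift_map (f := tact^~ b)); last by lin.
apply: eq_tlift => a1 a2; rewrite tactM; apply: eq_tlift => b1 b2.
by rewrite IHx (crossed_actM cV).
Qed.

Let coact_step (v : V) (t : T ⊗ A) : T ⊗ A :=
  \sw_(v0, v1 <- cmcoact v) \sw_(x0, x1 <- t) (tin v0 * x0) ⊗ (v1 * x1).

Let coact_step_bilinear : bilinear coact_step.
Proof. by rewrite /coact_step; lin. Qed.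

Lemma tcoact_linear : linear tcoact.
Proof. exact: (wfold_linear (1 ⊗ 1) coact_step_bilinear). Qed.
#[local] Hint Resolve tcoact_linear : linh.

Lemma tcoact1 : tcoact 1 = 1 ⊗ 1.
Proof. exact: (wfold1 (1 ⊗ 1) coact_step_bilinear). Qed.

Lemma tcoactM v x : tcoact (tin v * x) =
  \sw_(v0, v1 <- cmcoact v) \sw_(x0, x1 <- tcoact x) (tin v0 * x0) ⊗ (v1 * x1).
Proof. exact: (wfoldM (1 ⊗ 1) coact_step_bilinear). Qed.

Lemma sw_tcoactM (U : lmodType K) (F : T -> A -> U) v x : bilinear F ->
  tlift F (tcoact (tin v * x)) =
  \sw_(v0, v1 <- cmcoact v) \sw_(x0, x1 <- tcoact x) F (tin v0 * x0) (v1 * x1).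
Proof.
move=> bF; rewrite tcoactM tlift_tlift //; apply: eq_tlift => v0 v1.
by rewrite tlift_tlift //; apply: eq_tlift => x0 x1; rewrite tlift_pure.
Qed.

Lemma sw_tcoact1 (U : lmodType K) (F : T -> A -> U) : bilinear F ->
  tlift F (tcoact 1) = F 1 1.
Proof. by move=> bF; rewrite tcoact1 tlift_pure. Qed.

Lemma sw_tcoact_mul (U : lmodType K) (F : T -> A -> U) x y : bilinear F ->
  tlift F (tcoact (x * y)) =
  \sw_(x0, x1 <- tcoact x) \sw_(y0, y1 <- tcoact y) F (x0 * y0) (x1 * y1).
Proof.
move=> bF; move: x F bF; apply: talg_ind => [|F bF|v x IHx F bF].
- split=> [F bF|c x x' hx hx' F bF].
    by rewrite mul0r (lin0 tcoact_linear) !tlift_0 //; lin.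
  rewrite mulrDl -scalerAl !tcoact_linear !tliftDr ?tliftZr ?hx ?hx' //; lin.
- rewrite mul1r sw_tcoact1; last by lin.
  by apply: eq_tlift => y0 y1; rewrite !mul1r.
rewrite -mulrA !sw_tcoactM; [|by lin..]; apply: eq_tlift => v0 v1.
rewrite (IHx (fun x0 x1 => F (tin v0 * x0) (v1 * x1))); last by lin.
by apply: eq_tlift => x0 x1; apply: eq_tlift => y0 y1; rewrite !mulrA.
Qed.

Lemma sw_tcoact_tin (U : lmodType K) (F : T -> A -> U) v : bilinear F ->
  tlift F (tcoact (tin v)) = \sw_(v0, v1 <- cmcoact v) F (tin v0) v1.
Proof.
move=> bF; rewrite -[tin v]mulr1 sw_tcoactM //; apply: eq_tlift => v0 v1.
by rewrite sw_tcoact1 ?mulr1 //; lin.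
Qed.

Let tcoassoc x :
  \sw_(v0, v1 <- tcoact x) (\sw_(v00, v01 <- tcoact v0) v00 ⊗ (v01 ⊗ v1)) =
  \sw_(v0, v1 <- tcoact x) v0 ⊗ hcop v1.
Proof.
move: x; apply: talg_eq => [|||v x IHx]; [by lin | by lin | |].
  do ![rewrite sw_tcoact1; last by lin].
  by rewrite (hopf_cop1 (hopfP A)).
rewrite !sw_tcoactM; [|by lin..].
transitivity (\sw_(v0, v1 <- cmcoact v) \sw_(v00, v01 <- cmcoact v0)
   tlift (fun x0 t => \sw_(s, u <- t) (tin v00 * x0) ⊗ ((v01 * s) ⊗ (v1 * u)))
   (\sw_(x0, x1 <- tcoact x) (\sw_(x00, x01 <- tcoact x0) x00 ⊗ (x01 ⊗ x1)))).
  apply: eq_tlift => v0 v1.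
  transitivity (\sw_(x0, x1 <- tcoact x) \sw_(v00, v01 <- cmcoact v0)
      \sw_(x00, x01 <- tcoact x0) (tin v00 * x00) ⊗ ((v01 * x01) ⊗ (v1 * x1))).
    by apply: eq_tlift => x0 x1; rewrite sw_tcoactM //; lin.
  rewrite tlift_exch; apply: eq_tlift => v00 v01.
  rewrite tlift_tlift; last by lin.
  apply: eq_tlift => x0 x1; rewrite tlift_tlift; last by lin.
  by apply: eq_tlift => x00 x01; rewrite !tlift_pure //; lin.
rewrite IHx (sw_coact_assoc cV (F := fun v00 v01 v1 =>
   tlift (fun x0 t => \sw_(s, u <- t) (tin v00 * x0) ⊗ ((v01 * s) ⊗ (v1 * u)))
   (\sw_(x0, x1 <- tcoact x) x0 ⊗ hcop x1))); [|by lin..].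
apply: eq_tlift => v0 v1.
transitivity (\sw_(a, b <- hcop v1) \sw_(x0, x1 <- tcoact x)
    \sw_(s, u <- hcop x1) (tin v0 * x0) ⊗ ((a * s) ⊗ (b * u))).
  apply: eq_tlift => a b; rewrite tlift_tlift; last by lin.
  by apply: eq_tlift => x0 x1; rewrite tlift_pure //; lin.
rewrite tlift_exch; apply: eq_tlift => x0 x1.
rewrite (hopf_copM (hopfP A)) -(tlift_map (f := pure _)); last by lin.
by apply: eq_tlift => a b; rewrite -(tlift_map (f := pure _)) //; lin.
Qed.

Let tcounit x : \sw_(v0, v1 <- tcoact x) (hcou v1 *: v0) = x.
Proof.
move: x; apply: talg_eq => [|||v x IHx]; [by lin | by lin | |].
  by rewrite sw_tcoact1 ?hcou1 ?scale1r //; lin.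
rewrite sw_tcoactM; last by lin.
rewrite -{2}IHx -(sw_coact_counit cV (F := fun v => tin v *
  (\sw_(v0, v1 <- tcoact x) (hcou v1 *: v0)))); last by lin.
apply: eq_tlift => v0 v1; rewrite -(tlift_map (f := GRing.mul _)); last by lin.
rewrite -tliftZ; apply: eq_tlift => x0 x1.
by rewrite hcouM -scalerAr scalerA.
Qed.

(** On v x, the axiom for v moves the leading leg of a past v, and the induction hypothesis moves
    the next one past x; coassociativity joins the two steps. The form with the antipode would not
    split in this way. *)
Let tyd x a :
  \sw_(a1, a2 <- hcop a) (\sw_(y, b <- tcoact (tact x a2)) y ⊗ (a1 * b)) =
  \sw_(y, b <- tcoact x) \sw_(a1, a2 <- hcop a) tact y a1 ⊗ (b * a2).
Proof.
move: x a; apply: talg_ind => [|a|v x IHx a].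
- by apply: forall_subspace => a; apply: eq_linear_subspace; lin.
- rewrite sw_tcoact1; last by lin.
  transitivity (\sw_(a1, a2 <- hcop a) (hcou a2 *: ((1 : T) ⊗ a1))).
    apply: eq_tlift => a1 a2; rewrite tact1 (linZ tcoact_linear) tliftZr; last by lin.
    by rewrite sw_tcoact1 ?mulr1 //; lin.
  rewrite sw_counitr; last by lin.
  rewrite -(sw_counitl (F := fun a => (1 : T) ⊗ a)); last by lin.
  by apply: eq_tlift => a1 a2; rewrite tact1 pureZl mul1r.
rewrite sw_tcoactM; last by lin.
transitivity (\sw_(a1, a' <- hcop a) \sw_(a2, a3 <- hcop a')
   \sw_(v0, v1 <- cmcoact (cmact v a2)) \sw_(x0, x1 <- tcoact (tact x a3))
     (tin v0 * x0) ⊗ (a1 * v1 * x1)).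
  apply: eq_tlift => a1 a'.
  rewrite tactM -(tlift_map _ _ tcoact_linear) tlift_tlift; last by lin.
  apply: eq_tlift => a2 a3; rewrite sw_tcoactM; last by lin.
  by apply: eq_tlift => v0 v1; apply: eq_tlift => x0 x1; rewrite mulrA.
rewrite -sw_coassoc; [|by lin..].
transitivity (\sw_(a', a3 <- hcop a) \sw_(v0, v1 <- cmcoact v)
   \sw_(a1, a2 <- hcop a') \sw_(x0, x1 <- tcoact (tact x a3))
     (tin (cmact v0 a1) * x0) ⊗ (v1 * a2 * x1)).
  apply: eq_tlift => a' a3.
  by rewrite (sw_crossed cV (F := fun v0 c => \sw_(x0, x1 <- tcoact (tact x a3))
     (tin v0 * x0) ⊗ (c * x1))) //; lin.
rewrite tlift_exch; apply: eq_tlift => v0 v1.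
rewrite sw_coassoc; [|by lin..].
transitivity (\sw_(a1, a' <- hcop a) \sw_(y, b <- tcoact x) \sw_(a2, a3 <- hcop a')
   (tin (cmact v0 a1) * tact y a2) ⊗ (v1 * (b * a3))).
  apply: eq_tlift => a1 a'.
  have := congr1 (tlift (fun y b => (tin (cmact v0 a1) * y) ⊗ (v1 * b))) (IHx a').
  rewrite !tlift_tlift; [|by lin..] => h.
  transitivity (\sw_(a2, a3 <- hcop a') tlift (fun y b =>
     (tin (cmact v0 a1) * y) ⊗ (v1 * b)) (\sw_(y, b <- tcoact (tact x a3)) y ⊗ (a2 * b))).
    apply: eq_tlift => a2 a3; rewrite tlift_tlift; last by lin.
    by apply: eq_tlift => y b; rewrite tlift_pure ?mulrA //; lin.
  rewrite h; apply: eq_tlift => y b; rewrite tlift_tlift; last by lin.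
  by apply: eq_tlift => a2 a3; rewrite tlift_pure //; lin.
rewrite tlift_exch; apply: eq_tlift => y b; rewrite -sw_coassoc; [|by lin..].
apply: eq_tlift => a' a3; rewrite tactM.
rewrite -(tlift_map (f := fun z => z ⊗ _)); last by lin.
by apply: eq_tlift => a1 a2; rewrite !mulrA.
Qed.

Lemma talg_crossed : is_crossed tact tcoact.
Proof.
split.
- exact: tact_bilinear.
- exact: tact_1.
- exact: tact_comp.
- exact: tcoact_linear.
- exact: tcoassoc.
- exact: tcounit.
- move=> x a; apply: crossed_compat_of; [exact: tact_bilinear | exact: tcoact_linear |].
  exact: tyd.
Qed.

End TensorAlgebraModule.

(** * Grading, signs and coproduct of the tensor algebra *)

Section TensorAlgebraGrading.
Variables (K : fieldType) (A : hopfAlg K) (V : crossedMod A).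
Local Notation T := (talg V).
Local Notation tact := (@talg_act K A V).
Local Notation tcoact := (@talg_coact K A V).
Local Notation tdeg := (@talg_deg K A V).
Let cT := talg_crossed V.
Let tactb := crossed_act_bilinear cT.
Let tcoactl := crossed_coact_linear cT.
Let tinl : linear (@tin K V) := @tin_linear K V.
#[local] Hint Resolve tactb tcoactl tinl : linh.

Lemma tdeg_subspace n : is_subspace (tdeg n).
Proof. exact: lspan_subspace. Qed.

Lemma tdeg1 : tdeg 0 1.
Proof. by apply: lspan_gen; exists [::] => //; rewrite big_nil. Qed.

Lemma tdeg_ind (P : nat -> set T) : (forall n, is_subspace (P n)) -> P 0 1 ->
  (forall n v x, tdeg n x -> P n x -> P n.+1 (tin v * x)) ->
  forall n x, tdeg n x -> P n x.
Proof.
move=> sP P1 Pv n; apply: lspan_min => // _ [w <- ->].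
elim: w => [|v w IHw]; first by rewrite big_nil.
by rewrite big_cons; apply: Pv => //; apply: lspan_gen; exists w.
Qed.

Lemma tdegM m n x y : tdeg m x -> tdeg n y -> tdeg (m + n) (x * y).
Proof.
move=> dx dy; move: m x dx.
apply: (tdeg_ind (P := fun m => [set x | tdeg (m + n) (x * y)])) => [m||m v x _ /= IH].
- by apply: (preim_subspace (f := fun x => x * y)); [lin | apply: tdeg_subspace].
- by rewrite /= mul1r.
rewrite /= -mulrA.
move: IH; rewrite addSn; move: (x * y); apply: lspan_min => [|_ [w <- ->]].
  by apply: (preim_subspace (f := fun x => tin v * x)); [lin | apply: tdeg_subspace].
by apply: lspan_gen; exists (v :: w) => //; rewrite big_cons.
Qed.

Lemma tdeg_tin v : tdeg 1 (tin v).
Proof. by apply: lspan_gen; exists [:: v] => //; rewrite big_seq1. Qed.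

Let word_comp n (w : seq V) : T := if size w == n then \prod_(v <- w) tin v else 0.

Let word_comp_multilinear n : multilinear (word_comp n).
Proof.
move=> s t; have sz v : size (s ++ v :: t) = (size s + (size t).+1)%N.
  by rewrite size_cat.
rewrite /word_comp => c x y; rewrite !sz; case: eqP => _; last by rewrite scaler0 addr0.
rewrite !big_cat !big_cons /=.
have h : linear (fun v => \prod_(j <- s) tin j * (tin v * \prod_(j <- t) tin j)) by lin.
exact: h.
Qed.

Lemma talg_grading : is_grading tdeg.
Proof.
apply: (gradingI (p := fun n => wlift (word_comp n))) => [n|n|m n x|x].
- exact: tdeg_subspace.
- exact: wlift_linear (@word_comp_multilinear n).
- move=> dx; move: x dx; apply: lspan_min => [|_ [w <- ->]].
    apply: eq_linear_subspace; first exact: wlift_linear (@word_comp_multilinear m).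
    by case: (m == n); [apply: lin_id | apply: lin_cst0].
  by rewrite /= (wlift_word (@word_comp_multilinear m)) /word_comp eq_sym.
move: x; apply: word_ind; first exact: lspan_subspace.
move=> w; apply: lspan_gen; exists (size w).
by apply: lspan_gen; exists w.
Qed.
Let gT := talg_grading.

Lemma tact_deg n x a : tdeg n x -> tdeg n (tact x a).
Proof.
move=> dx; move: n x dx a; apply: (tdeg_ind (P := fun n => [set x | forall a, tdeg n (tact x a)])).
- move=> n; apply: forall_subspace => a; apply: (preim_subspace (f := tact^~ a)).
    by lin.
  exact: tdeg_subspace.
- by move=> a; rewrite tact1; exact: (subspaceZ (tdeg_subspace 0) _ tdeg1).
move=> n v x _ /= IH a; rewrite tactM; apply: (subspace_tlift _ (tdeg_subspace n.+1)).
by move=> a1 a2; rewrite -add1n; apply: tdegM => //; apply: tdeg_tin.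
Qed.

Lemma tcoact_deg n x : tdeg n x -> lspan [set t : T ⊗ A | exists2 y : T, tdeg n y &
  exists a, t = y ⊗ a] (tcoact x).
Proof.
move: n x; apply: (tdeg_ind (P := fun n => [set x | lspan [set t : T ⊗ A | exists2 y : T, tdeg n y &
    exists a, t = y ⊗ a] (tcoact x)])).
- move=> n; apply: preim_subspace; first exact: tcoactl.
  exact: lspan_subspace.
- rewrite /= tcoact1; apply: lspan_gen; exists 1; first exact: tdeg1.
  by exists 1.
move=> n v x _ /= IH; rewrite tcoactM; apply: subspace_tlift => [|v0 v1].
  exact: lspan_subspace.
move: (tcoact x) IH; apply: lspan_min.
  apply: (preim_subspace (f := fun t => \sw_(x0, x1 <- t) (tin v0 * x0) ⊗ (v1 * x1))).
    by lin.
  exact: lspan_subspace.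
move=> _ [y dy [a ->]] /=; rewrite tlift_pure; last by lin.
apply: lspan_gen; exists (tin v0 * y).
  by rewrite -add1n; apply: tdegM => //; apply: tdeg_tin.
by exists (v1 * a).
Qed.

Local Notation tw := (twist tdeg).
Let twl k : linear (tw k) := twist_linear gT k.
#[local] Hint Resolve twl : linh.

Lemma tw1 k : tw k 1 = 1 :> T.
Proof. by rewrite (twist_hom gT _ tdeg1) muln0 scale1r. Qed.

Lemma twM k x y : tw k (x * y) = tw k x * tw k y.
Proof. by apply: (twistM gT) => //; [apply: mul_bilinear | apply: tdegM]. Qed.

Lemma tw_tin k v : tw k (tin v) = (-1) ^+ k *: tin v.
Proof. by rewrite (twist_hom gT _ (tdeg_tin v)) muln1. Qed.

Lemma tw_act k x a : tw k (tact x a) = tact (tw k x) a.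
Proof. by apply: (twist_act gT) => //; apply: tact_deg. Qed.

Lemma sw_tcoact_tw (U : lmodType K) (F : T -> A -> U) k x : bilinear F ->
  tlift F (tcoact (tw k x)) = \sw_(x0, x1 <- tcoact x) F (tw k x0) x1.
Proof. by move=> bF; apply: (sw_coact_twist gT) => //; apply: tcoact_deg. Qed.

Local Notation tbr := (super_braiding tdeg tact tcoact).
Let tbrb : bilinear tbr := super_braiding_bilinear gT tactb tcoactl.
#[local] Hint Resolve tbrb : linh.

Lemma tbrE k x y : tdeg k y ->
  tbr y x = \sw_(x0, x1 <- tcoact x) tw k x0 ⊗ tact y x1.
Proof.
by move=> dy; rewrite (super_braidingE gT tactb tcoactl _ dy) sw_tcoact_tw //; lin.
Qed.

(* Left multiplication by tin v ⊗ 1 + 1 ⊗ tin v in the braided tensor square. *)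
Definition prim_mul (v : V) (t : T ⊗ T) : T ⊗ T :=
  \sw_(x, y <- t) ((tin v * x) ⊗ y +
    \sw_(x0, x1 <- tcoact x) tw 1 x0 ⊗ (tin (cmact v x1) * y)).

Let vact_bilinear : bilinear (@cmact K A V) := crossed_act_bilinear (crossedP V).
Let vcoact_linear : linear (@cmcoact K A V) := crossed_coact_linear (crossedP V).
#[local] Hint Resolve vact_bilinear vcoact_linear : linh.

Lemma prim_mul_bilinear : bilinear prim_mul.
Proof. by rewrite /prim_mul; lin. Qed.
#[local] Hint Resolve prim_mul_bilinear : linh.

Lemma prim_mul_pure v x y : prim_mul v (x ⊗ y) = (tin v * x) ⊗ y +
    \sw_(x0, x1 <- tcoact x) tw 1 x0 ⊗ (tin (cmact v x1) * y).
Proof. by rewrite /prim_mul tlift_pure //; lin. Qed.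

(** Braiding x past 1 gives x_0 ⊗ 1 ◁ x_1 = x ⊗ 1 by the counit, and braiding it past the odd letter
    v leaves the sign [tw 1]. *)
Lemma prim_mulE v t : braided_mul *%R tbr (tin v ⊗ 1 + 1 ⊗ tin v) t = prim_mul v t.
Proof.
have bm := braided_mul_bilinear (mul_bilinear T) tbrb.
move: t; apply: tens_eq => [||x y]; [by lin | by lin |].
rewrite (linD (lin_bil1 _ bm)) prim_mul_pure; congr (_ + _).
  rewrite /braided_mul tlift_pure; last by lin.
  rewrite tlift_pure; last by lin.
  rewrite (tbrE _ tdeg1) tlift_tlift; last by lin.
  rewrite -(sw_coact_counit cT (F := fun x => (tin v * x) ⊗ y)); last by lin.
  apply: eq_tlift => x0 x1; rewrite tlift_pure; last by lin.
  by rewrite tact1 (twist0 gT) -scalerAl mul1r pureZr.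
rewrite /braided_mul tlift_pure; last by lin.
rewrite tlift_pure; last by lin.
rewrite (tbrE _ (tdeg_tin v)) tlift_tlift; last by lin.
apply: eq_tlift => x0 x1; rewrite tlift_pure; last by lin.
by rewrite mul1r tact_tin.
Qed.

Local Notation tcop := (@talg_cop K A V).

Lemma tcopE x : tcop x = wfold prim_mul (1 ⊗ 1) x.
Proof.
rewrite /talg_cop /wfold; congr (wlift (foldr _ _) _).
by apply/funext => v; apply/funext => t; apply: prim_mulE.
Qed.

Lemma tcop_linear : linear tcop.
Proof.
by move=> c x y; rewrite !tcopE; apply: wfold_linear; apply: prim_mul_bilinear.
Qed.

Lemma tcop1 : tcop 1 = 1 ⊗ 1.
Proof. by rewrite tcopE wfold1 //; apply: prim_mul_bilinear. Qed.

Lemma tcopM v x : tcop (tin v * x) = prim_mul v (tcop x).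
Proof. by rewrite !tcopE wfoldM //; apply: prim_mul_bilinear. Qed.

Lemma tcop_tin v : tcop (tin v) = tin v ⊗ 1 + 1 ⊗ tin v.
Proof.
rewrite -[tin v]mulr1 tcopM tcop1 prim_mul_pure sw_tcoact1; last by lin.
by rewrite tw1 !mulr1 (crossed_act1 (crossedP V)).
Qed.

End TensorAlgebraGrading.

#[global] Hint Extern 2 (bilinear (@prim_mul _ _ _)) =>
  eapply prim_mul_bilinear : linh.
#[global] Hint Extern 2 (GRing.linear_for _ (@talg_cop _ _ _)) =>
  eapply tcop_linear : linh.
#[global] Hint Extern 2 (GRing.linear_for _ (@talg_coact _ _ _)) =>
  eapply tcoact_linear : linh.
#[global] Hint Extern 2 (bilinear (@talg_act _ _ _)) =>
  eapply tact_bilinear : linh.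
#[global] Hint Extern 2 (GRing.linear_for _ (twist (@talg_deg _ _ _) _)) =>
  eapply twist_linear; eapply talg_grading : linh.

(** * Equivariance and coassociativity of the coproduct *)

Section TensorAlgebraBialgebra.
Variables (K : fieldType) (A : hopfAlg K) (V : crossedMod A).
Local Notation T := (talg V).
Local Notation tact := (@talg_act K A V).
Local Notation tcoact := (@talg_coact K A V).
Local Notation tdeg := (@talg_deg K A V).
Local Notation tcop := (@talg_cop K A V).
Local Notation tw := (twist tdeg).
Local Notation tbr := (super_braiding tdeg tact tcoact).
Let cT := talg_crossed V.
Let gT := talg_grading V.
Let tinl : linear (@tin K V) := @tin_linear K V.
Let twl k : linear (tw k) := twist_linear gT k.
Let tactb : bilinear tact := @tact_bilinear K A V.
Let tcoactl : linear tcoact := @tcoact_linear K A V.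
Let tcopl : linear tcop := @tcop_linear K A V.
Let tbrb : bilinear tbr := super_braiding_bilinear gT tactb tcoactl.
Let vact_bilinear : bilinear (@cmact K A V) := crossed_act_bilinear (crossedP V).
Let vcoact_linear : linear (@cmcoact K A V) := crossed_coact_linear (crossedP V).
Let pmb : bilinear (@prim_mul K A V) := @prim_mul_bilinear K A V.
#[local] Hint Resolve tinl twl tactb tcoactl tcopl tbrb vact_bilinear vcoact_linear pmb
  : linh.

Let coact2 (t : T ⊗ T) : (T ⊗ T) ⊗ A := \sw_(x1, x2 <- t)
  \sw_(y1, a1 <- tcoact x1) \sw_(y2, a2 <- tcoact x2) (y1 ⊗ y2) ⊗ (a1 * a2).

Let coact2_linear : linear coact2.
Proof. by rewrite /coact2; lin. Qed.

(** The inductive step for colinearity of the coproduct. Only the summand in which v has crossed x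
    is delicate: there v ◁ x_1 is coacted on, and the crossed module axiom of V restores the order
    v_1 x_1. *)
Let coact2_prim v t : coact2 (prim_mul v t) =
  \sw_(v0, v1 <- cmcoact v) \sw_(s, a <- coact2 t) prim_mul v0 s ⊗ (v1 * a).
Proof.
move: t; apply: tens_eq => [||x y]; [by lin | by lin |].
rewrite prim_mul_pure linD // {1 3}/coact2 tlift_pure; last by lin.
transitivity (\sw_(v0, v1 <- cmcoact v) \sw_(x0, x1 <- tcoact x) \sw_(y0, y1 <- tcoact y)
   prim_mul v0 (x0 ⊗ y0) ⊗ (v1 * (x1 * y1))); last first.
  apply: eq_tlift => v0 v1; rewrite tlift_pure; last by lin.
  rewrite tlift_tlift; last by lin.
  apply: eq_tlift => x0 x1; rewrite tlift_tlift; last by lin.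
  by apply: eq_tlift => y0 y1; rewrite tlift_pure //; lin.
transitivity (\sw_(v0, v1 <- cmcoact v) \sw_(x0, x1 <- tcoact x) \sw_(y0, y1 <- tcoact y)
     (((tin v0 * x0) ⊗ y0) ⊗ (v1 * (x1 * y1))) +
   \sw_(v0, v1 <- cmcoact v) \sw_(x0, x1 <- tcoact x) \sw_(y0, y1 <- tcoact y)
   \sw_(x00, x01 <- tcoact x0)
     ((tw 1 x00 ⊗ (tin (cmact v0 x01) * y0)) ⊗ (v1 * (x1 * y1)))); last first.
  rewrite -tliftD; apply: eq_tlift => v0 v1.
  rewrite -tliftD; apply: eq_tlift => x0 x1.
  rewrite -tliftD; apply: eq_tlift => y0 y1.
  rewrite prim_mul_pure pureDl; congr (_ + _).
  by rewrite -(tlift_map (f := fun z => z ⊗ (v1 * (x1 * y1)))) //; lin.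
congr (_ + _).
  rewrite sw_tcoactM; last by lin.
  by apply: eq_tlift => v0 v1; apply: eq_tlift => x0 x1; apply: eq_tlift => y0 y1;
    rewrite mulrA.
rewrite -(tlift_map _ _ coact2_linear).
transitivity (\sw_(x0, x1 <- tcoact x) \sw_(x00, x01 <- tcoact x0)
   \sw_(w0, w1 <- cmcoact (cmact v x1)) \sw_(y0, y1 <- tcoact y)
     (tw 1 x00 ⊗ (tin w0 * y0)) ⊗ (x01 * (w1 * y1))).
  apply: eq_tlift => x0 x1; rewrite /coact2 tlift_pure; last by lin.
  rewrite sw_tcoact_tw; last by lin.
  by apply: eq_tlift => x00 x01; rewrite sw_tcoactM //; lin.
rewrite (sw_coact_assoc cT (F := fun x00 x01 x1 =>
   \sw_(w0, w1 <- cmcoact (cmact v x1)) \sw_(y0, y1 <- tcoact y)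
     (tw 1 x00 ⊗ (tin w0 * y0)) ⊗ (x01 * (w1 * y1)))); [|by lin..].
transitivity (\sw_(x0, x1 <- tcoact x) \sw_(v0, v1 <- cmcoact v)
   \sw_(a, b <- hcop x1) \sw_(y0, y1 <- tcoact y)
     (tw 1 x0 ⊗ (tin (cmact v0 a) * y0)) ⊗ (v1 * b * y1)).
  apply: eq_tlift => x0 x1.
  rewrite -(sw_crossed (crossedP V) (F := fun w0 c => \sw_(y0, y1 <- tcoact y)
     (tw 1 x0 ⊗ (tin w0 * y0)) ⊗ (c * y1))); last by lin.
  apply: eq_tlift => a b; apply: eq_tlift => w0 w1; apply: eq_tlift => y0 y1.
  by rewrite mulrA.
rewrite tlift_exch; apply: eq_tlift => v0 v1.
transitivity (\sw_(x0, x1 <- tcoact x) \sw_(a, b <- hcop x1) \sw_(y0, y1 <- tcoact y)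
     (tw 1 x0 ⊗ (tin (cmact v0 a) * y0)) ⊗ (v1 * (b * y1))).
  apply: eq_tlift => x0 x1; apply: eq_tlift => a b; apply: eq_tlift => y0 y1.
  by rewrite mulrA.
rewrite -(sw_coact_assoc cT (F := fun x0 a b => \sw_(y0, y1 <- tcoact y)
     (tw 1 x0 ⊗ (tin (cmact v0 a) * y0)) ⊗ (v1 * (b * y1)))); [|by lin..].
by apply: eq_tlift => x0 x1; rewrite tlift_exch.
Qed.

Lemma tcop_coact (x : T) :
  \sw_(x0, a <- tcoact x) tcop x0 ⊗ a =
  \sw_(x1, x2 <- tcop x) \sw_(y1, a1 <- tcoact x1) \sw_(y2, a2 <- tcoact x2)
      (y1 ⊗ y2) ⊗ (a1 * a2).
Proof.
rewrite -/(coact2 _); move: x; apply: talg_eq => [|||v x IHx]; [by lin | by lin | |].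
  rewrite sw_tcoact1 ?tcop1; last by lin.
  rewrite /coact2 tlift_pure; last by lin.
  do 2![rewrite sw_tcoact1; last by lin].
  by rewrite mulr1.
rewrite tcopM coact2_prim -IHx sw_tcoactM; last by lin.
apply: eq_tlift => v0 v1; rewrite tlift_tlift; last by lin.
by apply: eq_tlift => x0 x1; rewrite tlift_pure ?tcopM //; lin.
Qed.

Let act2 (t : T ⊗ T) (a : A) : T ⊗ T :=
  \sw_(x1, x2 <- t) \sw_(a1, a2 <- hcop a) tact x1 a1 ⊗ tact x2 a2.

Let act2_bilinear : bilinear act2.
Proof. by rewrite /act2; lin. Qed.
#[local] Hint Resolve act2_bilinear : linh.

(** The same step for the action. Here the braiding coacts on x ◁ a, so the crossed module axiom is
    that of the tensor algebra itself. *)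
Let act2_prim v t a : act2 (prim_mul v t) a =
  \sw_(a1, a2 <- hcop a) prim_mul (cmact v a1) (act2 t a2).
Proof.
move: t; apply: tens_eq => [||x y]; [by lin | by lin |].
rewrite prim_mul_pure (linD (lin_bil1 a act2_bilinear)).
transitivity (\sw_(a1, a' <- hcop a) \sw_(b1, b2 <- hcop a')
   (((tin (cmact v a1) * tact x b1) ⊗ tact y b2) +
    \sw_(x0, x1 <- tcoact (tact x b1)) tw 1 x0 ⊗
      (tin (cmact v (a1 * x1)) * tact y b2))); last first.
  apply: eq_tlift => a1 a'; rewrite /act2 tlift_pure; last by lin.
  rewrite -tlift_map; last by lin.
  apply: eq_tlift => b1 b2; rewrite prim_mul_pure; congr (_ + _).
  by apply: eq_tlift => x0 x1; rewrite (crossed_actM (crossedP V)).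
under [RHS]eq_tlift => a1 a' do rewrite tliftD.
rewrite tliftD; congr (_ + _).
  rewrite /act2 tlift_pure; last by lin.
  rewrite -sw_coassoc; [|by lin..].
  apply: eq_tlift => a' b2; rewrite tactM.
  by rewrite -(tlift_map (f := fun z => z ⊗ _)) //; lin.
rewrite -sw_coassoc; [|by lin..].
transitivity (\sw_(a', b2 <- hcop a) \sw_(x0, x1 <- tcoact x) \sw_(c1, c2 <- hcop a')
   tw 1 (tact x0 c1) ⊗ (tin (cmact v (x1 * c2)) * tact y b2)); last first.
  apply: eq_tlift => a' b2.
  rewrite (sw_crossed cT (F := fun x0 c => tw 1 x0 ⊗ (tin (cmact v c) * tact y b2))) //.
  by lin.
rewrite tlift_exch -(tlift_map (f := act2^~ a)); last by lin.
apply: eq_tlift => x0 x1; rewrite /act2 tlift_pure; last by lin.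
rewrite sw_coassoc; [|by lin..].
apply: eq_tlift => c1 c'; rewrite tactM -(tlift_map (f := pure _)); last by lin.
by apply: eq_tlift => c2 b2; rewrite tw_act (crossed_actM (crossedP V)).
Qed.

Lemma tcop_act (x : T) a : tcop (tact x a) =
  \sw_(x1, x2 <- tcop x) \sw_(a1, a2 <- hcop a) tact x1 a1 ⊗ tact x2 a2.
Proof.
rewrite -/(act2 _ a); move: x a; apply: talg_ind => [|a|v x IHx a].
- by apply: forall_subspace => a; apply: eq_linear_subspace; lin.
- rewrite tact1 (linZ tcopl) tcop1 /act2 tlift_pure; last by lin.
  rewrite -pureZr -(sw_counitr (F := fun a => 1 ⊗ (hcou a *: 1))); last by lin.
  by apply: eq_tlift => a1 a2; rewrite !tact1 pureZl pureZr scalerA mulrC -scalerA pureZr.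
rewrite tcopM act2_prim tactM -(tlift_map _ _ tcopl).
by apply: eq_tlift => a1 a2; rewrite tcopM IHx.
Qed.

Lemma tcop_tw k x : tcop (tw k x) = tmap (tw k) (tw k) (tcop x).
Proof.
move: x; apply: talg_eq => [|||v x IHx]; [by lin | by lin | |].
  by rewrite tw1 tcop1 tmap_pure ?tw1.
rewrite twM tw_tin -scalerAl (linZ tcopl) !tcopM IHx.
move: (tcop x); apply: tens_eq => [||y z]; [by lin | by lin |].
rewrite tmap_pure // !prim_mul_pure scalerDr linD; last by lin.
congr (_ + _).
  by rewrite tmap_pure // twM tw_tin -scalerAl pureZl.
rewrite -(tlift_map (f := tmap _ _)); last by lin.
rewrite sw_tcoact_tw; last by lin.
rewrite -tliftZ; apply: eq_tlift => y0 y1; rewrite tmap_pure // twM tw_tin.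
by rewrite -scalerAl pureZr -!(twistD gT) addnC.
Qed.

(** Left multiplication by v ⊗ 1 ⊗ 1 + 1 ⊗ v ⊗ 1 + 1 ⊗ 1 ⊗ v in the braided triple tensor
    product. *)
Let prim_mul3 (v : V) (t : T ⊗ (T ⊗ T)) : T ⊗ (T ⊗ T) :=
  \sw_(x, s <- t) \sw_(y, z <- s) ((tin v * x) ⊗ (y ⊗ z) +
   (\sw_(x0, x1 <- tcoact x) tw 1 x0 ⊗ ((tin (cmact v x1) * y) ⊗ z) +
    \sw_(x0, x1 <- tcoact x) \sw_(y0, y1 <- tcoact y)
      tw 1 x0 ⊗ (tw 1 y0 ⊗ (tin (cmact v (x1 * y1)) * z)))).

Let prim_mul3_linear v : linear (prim_mul3 v).
Proof. by rewrite /prim_mul3; lin. Qed.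

Let prim_mul3_pure v x y z : prim_mul3 v (x ⊗ (y ⊗ z)) = (tin v * x) ⊗ (y ⊗ z) +
   (\sw_(x0, x1 <- tcoact x) tw 1 x0 ⊗ ((tin (cmact v x1) * y) ⊗ z) +
    \sw_(x0, x1 <- tcoact x) \sw_(y0, y1 <- tcoact y)
      tw 1 x0 ⊗ (tw 1 y0 ⊗ (tin (cmact v (x1 * y1)) * z))).
Proof.
rewrite /prim_mul3 tlift_pure; last by lin.
by rewrite tlift_pure //; lin.
Qed.

(** Both iterated coproducts turn left multiplication by v into [prim_mul3 v]. For (Δ ⊗ id)Δ this
    uses that Δ is colinear and commutes with the signs; for (id ⊗ Δ)Δ it uses that acting by x_1
    and then b is acting by x_1 b. *)
Lemma tcop_coassoc (x : T) :
  \sw_(x1, x2 <- tcop x) (\sw_(x11, x12 <- tcop x1) x11 ⊗ (x12 ⊗ x2)) =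
  \sw_(x1, x2 <- tcop x) x1 ⊗ tcop x2.
Proof.
pose L (t : T ⊗ T) := \sw_(x1, x2 <- t) (\sw_(x11, x12 <- tcop x1) x11 ⊗ (x12 ⊗ x2)).
pose R (t : T ⊗ T) := \sw_(x1, x2 <- t) x1 ⊗ tcop x2.
have lL : linear L by rewrite /L; lin.
have lR : linear R by rewrite /R; lin.
rewrite -/(L _) -/(R _); move: x; apply: talg_eq => [|||v x IHx]; [by lin | by lin | |].
  rewrite tcop1 /L /R !tlift_pure; [|by lin..].
  by rewrite tcop1 tlift_pure //; lin.
have pm3 := @prim_mul3_linear v.
rewrite tcopM; transitivity (prim_mul3 v (L (tcop x))).
  move: (tcop x); apply: tens_eq => [||y z]; [by lin | by lin |].
  rewrite prim_mul_pure linD // -(tlift_map _ _ lL) {1 3}/L !tlift_pure; [|by lin..].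
  rewrite tcopM -(tlift_map _ _ pm3).
  transitivity (\sw_(y1, y2 <- tcop y) (tin v * y1) ⊗ (y2 ⊗ z) +
    (\sw_(y1, y2 <- tcop y) \sw_(x0, x1 <- tcoact y1) (tw 1 x0 ⊗
       ((tin (cmact v x1) * y2) ⊗ z)) +
     \sw_(y1, y2 <- tcop y) \sw_(x0, x1 <- tcoact y1) \sw_(y0, b <- tcoact y2)
      tw 1 x0 ⊗ (tw 1 y0 ⊗ (tin (cmact v (x1 * b)) * z)))); last first.
    by rewrite -!tliftD; apply: eq_tlift => y1 y2; rewrite prim_mul3_pure.
  rewrite addrA; congr (_ + _).
    rewrite -tliftD /prim_mul tlift_tlift; last by lin.
    apply: eq_tlift => y1 y2; rewrite tliftDr; last by lin.
    rewrite tlift_pure; last by lin.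
    congr (_ + _); rewrite tlift_tlift; last by lin.
    by apply: eq_tlift => x0 x1; rewrite tlift_pure //; lin.
  (* The term with v in the last leg: on one side v is acted on by the coaction of y, on the other
     by the coactions of both halves of Δy. Colinearity of Δ identifies them. *)
  transitivity (tlift (fun s a => \sw_(y1, y2 <- s)
     tw 1 y1 ⊗ (tw 1 y2 ⊗ (tin (cmact v a) * z))) (\sw_(x0, a <- tcoact y) tcop x0 ⊗ a)).
    rewrite tlift_tlift; last by lin.
    apply: eq_tlift => y0 y1; rewrite tlift_pure; last by lin.
    rewrite /L tlift_pure; last by lin.
    by rewrite tcop_tw tlift_tmap //; lin.
  rewrite tcop_coact tlift_tlift; last by lin.
  apply: eq_tlift => y1 y2; rewrite tlift_tlift; last by lin.
  apply: eq_tlift => y10 a1; rewrite tlift_tlift; last by lin.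
  apply: eq_tlift => y20 a2; rewrite tlift_pure; last by lin.
  by rewrite tlift_pure //; lin.
rewrite IHx; symmetry; move: (tcop x); apply: tens_eq => [||y z]; [by lin | by lin |].
rewrite prim_mul_pure linD // -(tlift_map _ _ lR) {1}/R tlift_pure; last by lin.
transitivity (\sw_(z1, z2 <- tcop z) (tin v * y) ⊗ (z1 ⊗ z2) +
    (\sw_(z1, z2 <- tcop z) \sw_(x0, x1 <- tcoact y) (tw 1 x0 ⊗
       ((tin (cmact v x1) * z1) ⊗ z2)) +
     \sw_(z1, z2 <- tcop z) \sw_(x0, x1 <- tcoact y) \sw_(y0, b <- tcoact z1)
      tw 1 x0 ⊗ (tw 1 y0 ⊗ (tin (cmact v (x1 * b)) * z2)))).
  rewrite (tlift_map (f := pure (tin v * y))) ?tlift_pureE; last by lin.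
  congr (_ + _); rewrite -tliftD.
  transitivity (\sw_(x0, x1 <- tcoact y) \sw_(z1, z2 <- tcop z)
     ((tw 1 x0 ⊗ ((tin (cmact v x1) * z1) ⊗ z2)) +
      \sw_(y0, b <- tcoact z1) tw 1 x0 ⊗ (tw 1 y0 ⊗ (tin (cmact v (x1 * b)) * z2)))); last first.
    by rewrite -tlift_exch; apply: eq_tlift => z1 z2; rewrite tliftD.
  apply: eq_tlift => x0 x1; rewrite /R tlift_pure; last by lin.
  rewrite tcopM -(tlift_map (f := pure (tw 1 x0))); last by lin.
  apply: eq_tlift => z1 z2; rewrite pureDr; congr (_ + _).
  rewrite -(tlift_map (f := pure (tw 1 x0))); last by lin.
  by apply: eq_tlift => y0 b; rewrite (crossed_actM (crossedP V)).
transitivity (prim_mul3 v (\sw_(z1, z2 <- tcop z) y ⊗ (z1 ⊗ z2))).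
  by rewrite -!tliftD -(tlift_map _ _ pm3); apply: eq_tlift => z1 z2; rewrite prim_mul3_pure.
by rewrite (tlift_map (f := pure y)) ?tlift_pureE /R ?tlift_pure //; lin.
Qed.
End TensorAlgebraBialgebra.

(** * Multiplicativity, counit and antipode of the tensor algebra *)

Section TensorAlgebraHopf.
Variables (K : fieldType) (A : hopfAlg K) (V : crossedMod A).
Local Notation T := (talg V).
Local Notation tact := (@talg_act K A V).
Local Notation tcoact := (@talg_coact K A V).
Local Notation tdeg := (@talg_deg K A V).
Local Notation tcop := (@talg_cop K A V).
Local Notation tcou := (@talg_cou K A V).
Local Notation tw := (twist tdeg).
Local Notation tbr := (super_braiding tdeg tact tcoact).
Let cT := talg_crossed V.
Let gT := talg_grading V.
Let tinl : linear (@tin K V) := @tin_linear K V.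
Let twl k : linear (tw k) := twist_linear gT k.
Let tactb : bilinear tact := @tact_bilinear K A V.
Let tcoactl : linear tcoact := @tcoact_linear K A V.
Let tcopl : linear tcop := @tcop_linear K A V.
Let tbrb : bilinear tbr := super_braiding_bilinear gT tactb tcoactl.
Let vact_bilinear : bilinear (@cmact K A V) := crossed_act_bilinear (crossedP V).
Let vcoact_linear : linear (@cmcoact K A V) := crossed_coact_linear (crossedP V).
Let pmb : bilinear (@prim_mul K A V) := @prim_mul_bilinear K A V.
#[local] Hint Resolve tinl twl tactb tcoactl tcopl tbrb vact_bilinear vcoact_linear pmb
  : linh.

Local Notation bm := (braided_mul *%R tbr).
Let bmb : bilinear bm := braided_mul_bilinear (mul_bilinear T) tbrb.
#[local] Hint Resolve bmb : linh.

Let bmE k s1 s2 t1 t2 : tdeg k s2 -> bm (s1 ⊗ s2) (t1 ⊗ t2) =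
  \sw_(x0, x1 <- tcoact t1) (s1 * tw k x0) ⊗ (tact s2 x1 * t2).
Proof.
move=> ds; rewrite braided_mul_pure; [|by lin..].
rewrite (tbrE _ ds) tlift_tlift; last by lin.
by apply: eq_tlift => x0 x1; rewrite tlift_pure //; lin.
Qed.

(** Associativity of the braided product when the first factor is v ⊗ 1 + 1 ⊗ v, the only case that
    the induction for [tcop_mul] uses. The signs match because v s_2 has degree k + 1 when s_2 has
    degree k. *)
Let bm_prim v s t : bm (prim_mul v s) t = prim_mul v (bm s t).
Proof.
move: s; apply: tens_eq => [||s1 s2]; [by lin | by lin |].
move: s2; apply: (hom_eq gT) => [||k s2 ds]; [by lin | by lin |].
move: t; apply: tens_eq => [||t1 t2]; [by lin | by lin |].
rewrite prim_mul_pure (linD (lin_bil1 _ bmb)) !(bmE _ _ _ ds).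
rewrite -(tlift_map (f := bm^~ _)); last by lin.
rewrite -(tlift_map (f := prim_mul v)); last by lin.
under [RHS]eq_tlift => t10 t11 do rewrite prim_mul_pure.
rewrite tliftD; congr (_ + _).
  by apply: eq_tlift => t10 t11; rewrite mulrA.
transitivity (\sw_(s10, s11 <- tcoact s1) \sw_(t10, t11 <- tcoact t1)
   \sw_(a, b <- hcop t11) (tw 1 s10 * tw k.+1 t10) ⊗
     (tin (cmact v (s11 * a)) * (tact s2 b * t2))).
  apply: eq_tlift => s10 s11.
  have d1 : tdeg k.+1 (tin (cmact v s11) * s2).
    by rewrite -add1n; apply: tdegM => //; apply: tdeg_tin.
  rewrite (bmE _ _ _ d1); apply: eq_tlift => t10 t11.
  rewrite tactM -(tlift_map (f := fun z => _ ⊗ (z * t2))); last by lin.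
  by apply: eq_tlift => a b; rewrite mulrA (crossed_actM (crossedP V)).
rewrite tlift_exch.
transitivity (\sw_(t10, t11 <- tcoact t1) \sw_(s10, s11 <- tcoact s1)
   \sw_(t100, t101 <- tcoact t10) (tw 1 s10 * tw k.+1 t100) ⊗
     (tin (cmact v (s11 * t101)) * (tact s2 t11 * t2))); last first.
  apply: eq_tlift => t10 t11; rewrite sw_tcoact_mul; last by lin.
  apply: eq_tlift => s10 s11; rewrite sw_tcoact_tw; last by lin.
  by apply: eq_tlift => t100 t101; rewrite twM -(add1n k) (twistD gT).
rewrite [LHS]tlift_exch [RHS]tlift_exch; apply: eq_tlift => s10 s11.
by rewrite (sw_coact_assoc cT (F := fun t10 a b => (tw 1 s10 * tw k.+1 t10) ⊗
     (tin (cmact v (s11 * a)) * (tact s2 b * t2)))) //; lin.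
Qed.

Lemma tcop_mul x y : tcop (x * y) = bm (tcop x) (tcop y).
Proof.
move: x; apply: talg_eq => [|||v x IHx]; [by lin | by lin | |].
  rewrite mul1r tcop1; move: (tcop y); apply: tens_eq => [||t1 t2]; [by lin | by lin |].
  rewrite (bmE _ _ _ (@tdeg1 K A V)).
  rewrite -(sw_coact_counit cT (F := fun z => z ⊗ t2)); last by lin.
  apply: eq_tlift => x0 x1; rewrite (twist0 gT) mul1r tact1 -scalerAl mul1r.
  by rewrite pureZr.
by rewrite -mulrA !tcopM bm_prim IHx.
Qed.

Let word_cou (w : seq V) : K^o := (nilp w)%:R.

Let word_cou_multilinear : multilinear word_cou.
Proof.
move=> s t; have h v : word_cou (s ++ v :: t) = 0 by rewrite /word_cou; case: s.
by move=> c x y; rewrite !h scaler0 addr0.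
Qed.

Lemma tcou_scalar : scalar tcou.
Proof. exact: wlift_linear word_cou_multilinear. Qed.
#[local] Hint Resolve tcou_scalar : linh.

Lemma tcou1 : tcou 1 = 1.
Proof. by have := wlift_word word_cou_multilinear [::]; rewrite big_nil. Qed.

Lemma tcouM v x : tcou (tin v * x) = 0.
Proof.
move: x; apply: (word_ind (P := fun x => tcou (tin v * x) = 0)) => [|w].
  apply: (ker_subspace (U := K^o) (f := fun x => tcou (tin v * x))).
  by apply: (lin_comp (g := tcou : T -> K^o)); [apply: tcou_scalar | lin].
by have := wlift_word word_cou_multilinear (v :: w); rewrite big_cons.
Qed.

Let scalar_eq (f g : T -> K) : scalar f -> scalar g -> f 1 = g 1 ->
  (forall v x, f x = g x -> f (tin v * x) = g (tin v * x)) -> forall x, f x = g x.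
Proof. by move=> lf lg; apply: (talg_eq (U := K^o)). Qed.

Lemma tcou_mul x y : tcou (x * y) = tcou x * tcou y.
Proof.
move: x; apply: scalar_eq => [|||v x IHx]; [by lin_scal | by lin_scal | |].
  by rewrite tcou1 !mul1r.
by rewrite -mulrA !tcouM mul0r.
Qed.

Lemma tcou_act x a : tcou (tact x a) = tcou x * hcou a.
Proof.
move: x a; apply: talg_ind => [|a|v x IHx a].
- apply: forall_subspace => a; apply: (eq_linear_subspace (U := K^o)); last first.
    by apply: scalar_linear; lin_scal.
  by apply: scalar_linear; lin_scal.
- by rewrite tact1 (linZ (scalar_linear tcou_scalar)) tcou1 mul1r /= [LHS]mulr1.
rewrite tactM tcouM mul0r -(tlift_map (f := tcou : T -> K^o)); last by apply: tcou_scalar.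
by apply: big1 => p _; rewrite tcouM.
Qed.

Lemma tcou_coact x : \sw_(x0, a <- tcoact x) (tcou x0 *: a) = tcou x *: 1.
Proof.
move: x; apply: talg_eq => [|||v x IHx]; [by lin | by lin | |].
  by rewrite sw_tcoact1 //; lin.
rewrite tcouM scale0r sw_tcoactM; last by lin.
by apply: big1 => p _; apply: big1 => q _; rewrite tcouM scale0r.
Qed.

Lemma tcou_tw k x : tcou (tw k x) = tcou x.
Proof.
move: x; apply: scalar_eq => [|||v x IHx]; [by lin_scal | by lin_scal | |].
  by rewrite tw1.
rewrite twM tw_tin -scalerAl (linZ (scalar_linear tcou_scalar)) !tcouM.
exact: mulr0.
Qed.

Lemma tcounitl (x : T) : \sw_(x1, x2 <- tcop x) (tcou x1 *: x2) = x.
Proof.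
move: x; apply: talg_eq => [|||v x IHx]; [by lin | by lin | |].
  by rewrite tcop1 tlift_pure ?tcou1 ?scale1r //; lin.
rewrite tcopM -[in RHS]IHx; move: (tcop x).
apply: tens_eq => [||y z]; [by lin | by lin |].
rewrite prim_mul_pure tliftDr; last by lin.
rewrite !tlift_pure; [|by lin..]; rewrite tcouM scale0r add0r tlift_tlift; last by lin.
transitivity (\sw_(y0, a <- tcoact y) (tin (cmact v (tcou y0 *: a)) * z)).
  apply: eq_tlift => y0 a; rewrite tlift_pure; last by lin.
  by rewrite tcou_tw (linZ (lin_bil2 _ vact_bilinear)) (linZ tinl) -scalerAl.
rewrite (tlift_map (f := fun a => tin (cmact v a) * z)); last by lin.
rewrite tcou_coact (linZ (lin_bil2 _ vact_bilinear)) (crossed_act1 (crossedP V)).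
by rewrite (linZ tinl) -scalerAl scalerAr.
Qed.

Lemma tcounitr (x : T) : \sw_(x1, x2 <- tcop x) (tcou x2 *: x1) = x.
Proof.
move: x; apply: talg_eq => [|||v x IHx]; [by lin | by lin | |].
  by rewrite tcop1 tlift_pure ?tcou1 ?scale1r //; lin.
rewrite tcopM -[in RHS]IHx; move: (tcop x).
apply: tens_eq => [||y z]; [by lin | by lin |].
rewrite prim_mul_pure tliftDr; last by lin.
rewrite !tlift_pure; [|by lin..]; rewrite tlift_tlift; last by lin.
rewrite [X in _ + X]big1 ?addr0 ?scalerAr // => p _.
by rewrite tlift_pure ?tcouM ?scale0r //; lin.
Qed.

Lemma tcop_deg n (x : T) : tdeg n x ->
  lspan [set t : T ⊗ T | exists i j (y z : T),
      [/\ (i + j)%N = n, tdeg i y, tdeg j z & t = y ⊗ z]] (tcop x).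
Proof.
move: n x; apply: (tdeg_ind (P := fun n => [set x | lspan [set t : T ⊗ T |
   exists i j (y z : T), [/\ (i + j)%N = n, tdeg i y, tdeg j z & t = y ⊗ z]] (tcop x)])).
- by move=> n; apply: preim_subspace; [apply: tcopl | apply: lspan_subspace].
- rewrite /= tcop1; apply: lspan_gen; exists 0%N, 0%N, 1, 1.
  by split=> //; apply: tdeg1.
move=> n v x _ /=; rewrite tcopM; move: (tcop x); apply: lspan_min.
  apply: (preim_subspace (f := prim_mul v)); first by lin.
  exact: lspan_subspace.
move=> _ [i [j [y [z [<- dy dz ->]]]]]; rewrite /= prim_mul_pure.
apply: (subspaceD (lspan_subspace _)).
  apply: lspan_gen; exists i.+1, j, (tin v * y), z; split=> //.
  by rewrite -add1n; apply: tdegM => //; apply: tdeg_tin.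
move: (tcoact y) (tcoact_deg dy); apply: lspan_min.
  apply: (preim_subspace (f := fun t => \sw_(x0, x1 <- t)
    tw 1 x0 ⊗ (tin (cmact v x1) * z))); first by lin.
  exact: lspan_subspace.
move=> _ [y' dy' [a ->]] /=; rewrite tlift_pure; last by lin.
apply: lspan_gen; exists i, j.+1, (tw 1 y'), (tin (cmact v a) * z); split=> //.
- by rewrite addnS.
- exact: (twist_deg gT).
by rewrite -add1n; apply: tdegM => //; apply: tdeg_tin.
Qed.

Lemma tcou_deg n (x : T) : tdeg n.+1 x -> tcou x = 0.
Proof.
move: x; apply: (lspan_min (W := [set x | tcou x = 0])) => [|_ [[|v w] // _ ->]].
  exact: (ker_subspace (U := K^o) (scalar_linear tcou_scalar)).
by rewrite /= big_cons; apply: tcouM.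
Qed.

Lemma btalg_bialgebra : @is_graded_bialgebra K (btalg V) tbr.
Proof.
split.
- exact: gT.
- exact: mul_bilinear.
- exact: mulrA.
- exact: mul1r.
- exact: mulr1.
- exact: (@tdegM K A V).
- exact: (@tdeg1 K A V).
- exact: tcopl.
- exact: tcou_scalar.
- exact: (@tcop_coassoc K A V).
- exact: tcounitl.
- exact: tcounitr.
- exact: tcop_deg.
- exact: tcou_deg.
- exact: tcop_mul.
- exact: (@tcop1 K A V).
- exact: tcou_mul.
- exact: tcou1.
Qed.

(* The antipode is braided antimultiplicative: S (v x) = anti_step v (S x). *)
Let anti_step (v : V) (x : T) : T :=
  - \sw_(x0, x1 <- tcoact x) (tw 1 x0 * tin (cmact v x1)).

Let anti_step_bilinear : bilinear anti_step.
Proof. by rewrite /anti_step; lin. Qed.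
#[local] Hint Resolve anti_step_bilinear : linh.

Definition tanti : T -> T := wfold anti_step 1.

Lemma tanti_linear : linear tanti.
Proof. exact: (wfold_linear _ anti_step_bilinear). Qed.
#[local] Hint Resolve tanti_linear : linh.

Lemma tanti1 : tanti 1 = 1.
Proof. exact: (wfold1 _ anti_step_bilinear). Qed.

Lemma tantiM v x : tanti (tin v * x) =
  - \sw_(x0, x1 <- tcoact (tanti x)) (tw 1 x0 * tin (cmact v x1)).
Proof. exact: (wfoldM _ anti_step_bilinear). Qed.

Lemma tanti_tin v : tanti (tin v) = - tin v.
Proof.
rewrite -[tin v]mulr1 tantiM tanti1 sw_tcoact1; last by lin.
by rewrite tw1 mul1r mulr1 (crossed_act1 (crossedP V)).
Qed.

Lemma tanti_deg n x : tdeg n x -> tdeg n (tanti x).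
Proof.
move: n x; apply: (tdeg_ind (P := fun n => [set x | tdeg n (tanti x)])).
- by move=> n; apply: preim_subspace; [apply: tanti_linear | apply: tdeg_subspace].
- by rewrite /= tanti1; apply: tdeg1.
move=> n v x _ /= IH; rewrite tantiM -scaleN1r.
apply: (subspaceZ (@tdeg_subspace K A V n.+1)).
move: (tcoact (tanti x)) (tcoact_deg IH); apply: lspan_min.
  apply: (preim_subspace (f := fun t => \sw_(x0, x1 <- t) (tw 1 x0 * tin (cmact v x1)))).
    by lin.
  exact: tdeg_subspace.
move=> _ [y dy [a ->]] /=; rewrite tlift_pure; last by lin.
rewrite -addn1; apply: tdegM; last exact: tdeg_tin.
exact: (twist_deg gT).
Qed.

Lemma tanti_tw k x : tanti (tw k x) = tw k (tanti x).
Proof.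
apply: (twist_morph (f := tanti)); [exact: gT | exact: gT | exact: tanti_linear |].
exact: tanti_deg.
Qed.

Lemma tanti_coact x : tcoact (tanti x) = tmap tanti id (tcoact x).
Proof.
move: x; apply: talg_eq => [|||v x IHx]; [by lin | by lin | |].
  by rewrite tanti1 tcoact1 tmap_pure ?tanti1 //; lin.
transitivity (- \sw_(v0, v1 <- cmcoact v) \sw_(y, y1 <- tcoact (tanti x))
   \sw_(y0, y01 <- tcoact y) (tw 1 y0 * tin (cmact v0 y01)) ⊗ (v1 * y1)); last first.
  rewrite /tmap sw_tcoactM; last by lin.
  rewrite -tliftN; apply: eq_tlift => v0 v1; rewrite IHx tlift_tmap; [|by lin..].
  rewrite -tliftN; apply: eq_tlift => x0 x1; rewrite tantiM.
  rewrite (linN (f := fun z => z ⊗ (v1 * x1))); last by lin.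
  by rewrite -(tlift_map (f := fun z => z ⊗ (v1 * x1))) //; lin.
rewrite tantiM (linN tcoactl); congr (- _).
rewrite -(tlift_map _ _ tcoactl).
transitivity (\sw_(y, y1 <- tcoact (tanti x)) \sw_(y0, y01 <- tcoact y)
   \sw_(v0, v1 <- cmcoact (cmact v y1)) (tw 1 y0 * tin v0) ⊗ (y01 * v1)).
  apply: eq_tlift => y y1; rewrite -[LHS]tlift_pureE sw_tcoact_mul; last by lin.
  rewrite sw_tcoact_tw; last by lin.
  by apply: eq_tlift => y0 y01; rewrite sw_tcoact_tin //; lin.
rewrite (sw_coact_assoc cT (F := fun y0 y01 y1 =>
   \sw_(v0, v1 <- cmcoact (cmact v y1)) (tw 1 y0 * tin v0) ⊗ (y01 * v1))); [|by lin..].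
transitivity (\sw_(y, y1 <- tcoact (tanti x)) \sw_(v0, v1 <- cmcoact v)
   \sw_(a, b <- hcop y1) (tw 1 y * tin (cmact v0 a)) ⊗ (v1 * b)).
  apply: eq_tlift => y y1.
  by rewrite (sw_crossed (crossedP V) (F := fun v0 v1 => (tw 1 y * tin v0) ⊗ v1)) //; lin.
rewrite tlift_exch; apply: eq_tlift => v0 v1.
by rewrite -(sw_coact_assoc cT (F := fun y a b => (tw 1 y * tin (cmact v0 a)) ⊗ (v1 * b))) //;
  lin.
Qed.

Lemma tanti_act x a : tanti (tact x a) = tact (tanti x) a.
Proof.
move: x a; apply: talg_ind => [|a|v x IHx a].
- by apply: forall_subspace => a; apply: eq_linear_subspace; lin.
- by rewrite tact1 (linZ tanti_linear) tanti1 tact1.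
rewrite tactM -(tlift_map _ _ tanti_linear) tantiM (linN (f := tact^~ a)); last by lin.
transitivity (- \sw_(a1, a2 <- hcop a) \sw_(y0, y1 <- tcoact (tact (tanti x) a2))
   (tw 1 y0 * tin (cmact v (a1 * y1)))).
  rewrite -tliftN; apply: eq_tlift => a1 a2; rewrite tantiM IHx.
  by congr (- _); apply: eq_tlift => y0 y1; rewrite (crossed_actM (crossedP V)).
congr (- _); rewrite (sw_crossed cT (F := fun y0 c => tw 1 y0 * tin (cmact v c))); last by lin.
rewrite -(tlift_map (f := tact^~ a)); last by lin.
apply: eq_tlift => y0 y1; rewrite tact_mul; apply: eq_tlift => a1 a2.
by rewrite tw_act tact_tin (crossed_actM (crossedP V)).
Qed.

(** On v x the two summands of [prim_mul] cancel by the recursion for S, which is colinear and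
    commutes with the signs, so no induction hypothesis is involved. *)
Lemma tantil x : \sw_(x1, x2 <- tcop x) (tanti x1 * x2) = tcou x *: 1.
Proof.
move: x; apply: talg_eq => [|||v x _]; [by lin | by lin | |].
  by rewrite tcop1 tlift_pure ?tanti1 ?mulr1 ?tcou1 ?scale1r //; lin.
rewrite tcopM tcouM scale0r; move: (tcop x).
apply: tens_eq => [||y z]; [by lin | exact: lin_cst0 |].
rewrite prim_mul_pure tliftDr; last by lin.
rewrite tlift_pure; last by lin.
rewrite tlift_tlift; last by lin.
apply/eqP; rewrite addr_eq0; apply/eqP.
rewrite tantiM mulNr; congr (- _).
rewrite -(tlift_map (f := fun w => w * z)); last by lin.
rewrite tanti_coact tlift_tmap; [|by lin..].
apply: eq_tlift => y0 y1; rewrite tlift_pure; last by lin.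
by rewrite tanti_tw mulrA.
Qed.

(** Here v stays outside, so the induction hypothesis is used: [R] carries [prim_mul v] to r ↦ v r -
    H r, and on the scalar R(Δx) = ε(x) 1 this vanishes since H 1 = v. *)
Lemma tantir x : \sw_(x1, x2 <- tcop x) (x1 * tanti x2) = tcou x *: 1.
Proof.
move: x; apply: talg_eq => [|||v x IHx]; [by lin | by lin | |].
  by rewrite tcop1 tlift_pure ?tanti1 ?mulr1 ?tcou1 ?scale1r //; lin.
pose R t := \sw_(x1, x2 <- t) (x1 * tanti x2).
pose H w := \sw_(w0, w1 <- tcoact w) (tw 1 w0 * tin (cmact v w1)).
have lR : linear R by rewrite /R; lin.
have lH : linear H by rewrite /H; lin.
have RE t : R (prim_mul v t) = tin v * R t - H (R t).
  move: t; apply: tens_eq => [||y z]; [by lin | by lin |].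
  rewrite prim_mul_pure (linD lR) -(tlift_map _ _ lR) {1 3 4}/R !tlift_pure; [|by lin..].
  rewrite mulrA; congr (_ + _).
  rewrite /H sw_tcoact_mul; last by lin.
  rewrite -tliftN; apply: eq_tlift => y0 y1; rewrite /R tlift_pure; last by lin.
  rewrite tantiM mulrN -(tlift_map (f := GRing.mul (tw 1 y0))); last by lin.
  congr (- _); apply: eq_tlift => z0 z1.
  by rewrite twM mulrA (crossed_actM (crossedP V)).
rewrite tcouM scale0r tcopM -/(R _) RE.
have -> : R (tcop x) = tcou x *: 1 by rewrite -IHx.
rewrite (linZ lH) -scalerAr -scalerBr mulr1 /H sw_tcoact1; last by lin.
by rewrite tw1 mul1r (crossed_act1 (crossedP V)) subrr scaler0.
Qed.

Lemma tanti_antipode : @is_antipode K (btalg V) tanti.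
Proof.
split; [exact: tanti_linear | exact: tanti_deg | exact: tantil | exact: tantir].
Qed.

(** The recursion [tantiM] extends from a letter to any homogeneous left factor, whose degree enters
    only through [tw k]. The extension is what shows that S respects the ideal of relations. *)
Lemma tanti_mul k x y : tdeg k x -> tanti (x * y) =
  \sw_(y0, y1 <- tcoact (tanti y)) (tw k y0 * tact (tanti x) y1).
Proof.
move=> dx; move: k x dx y.
apply: (tdeg_ind (P := fun k => [set x | forall y, tanti (x * y) =
  \sw_(y0, y1 <- tcoact (tanti y)) (tw k y0 * tact (tanti x) y1)])).
- by move=> k; apply: forall_subspace => y; apply: eq_linear_subspace; lin.
- move=> y; rewrite mul1r -[LHS](sw_coact_counit cT (F := id)); last by lin.
  by apply: eq_tlift => y0 y1; rewrite (twist0 gT) tanti1 tact1 -scalerAr mulr1.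
move=> k v x _ /= IH y; rewrite -mulrA tantiM IH.
transitivity (- \sw_(z0, z1 <- tcoact (tanti y)) \sw_(w0, w1 <- tcoact (tanti x))
   \sw_(a, b <- hcop z1) (tw k.+1 z0 * (tw 1 (tact w0 a) * tin (cmact v (w1 * b))))).
  congr (- _); rewrite -(tlift_map _ _ tcoactl) tlift_tlift; last by lin.
  transitivity (\sw_(z, z1 <- tcoact (tanti y)) \sw_(z0, z01 <- tcoact z)
     \sw_(w0, w1 <- tcoact (tact (tanti x) z1))
       (tw k.+1 z0 * (tw 1 w0 * tin (cmact v (z01 * w1))))).
    apply: eq_tlift => z z1; rewrite sw_tcoact_mul; last by lin.
    rewrite sw_tcoact_tw; last by lin.
    apply: eq_tlift => z0 z01; apply: eq_tlift => w0 w1.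
    by rewrite twM -(add1n k) (twistD gT) mulrA.
  rewrite (sw_coact_assoc cT (F := fun z0 z01 z1 =>
     \sw_(w0, w1 <- tcoact (tact (tanti x) z1))
       (tw k.+1 z0 * (tw 1 w0 * tin (cmact v (z01 * w1)))))); [|by lin..].
  apply: eq_tlift => z0 z1.
  by rewrite (sw_crossed cT (F := fun w0 c => tw k.+1 z0 * (tw 1 w0 * tin (cmact v c)))) //; lin.
rewrite tantiM -tliftN; apply: eq_tlift => z0 z1.
rewrite (linN (f := fun u => tw k.+1 z0 * tact u z1)); last by lin.
congr (- _); rewrite -(tlift_map (f := fun u => tw k.+1 z0 * tact u z1)); last by lin.
apply: eq_tlift => w0 w1; rewrite tact_mul -(tlift_map (f := GRing.mul _)); last by lin.
by apply: eq_tlift => a b; rewrite tw_act tact_tin (crossed_actM (crossedP V)).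
Qed.

Lemma btalg_braided_hopf : is_braided_hopf (btalg V).
Proof.
split.
- exact: cT.
- exact: (@tact_deg K A V).
- exact: (@tcoact_deg K A V).
- exact: (@tact_mul K A V).
- exact: (@tact1 K A V).
- by move=> x y; rewrite -[LHS]tlift_pureE /= sw_tcoact_mul //; lin.
- exact: (@tcoact1 K A V).
- exact: (@tcop_act K A V).
- exact: tcou_act.
- exact: (@tcop_coact K A V).
- exact: tcou_coact.
- exact: btalg_bialgebra.
- exists tanti; split; [exact: tanti_antipode | exact: tanti_act | exact: tanti_coact].
Qed.

End TensorAlgebraHopf.

(** * Quotients of braided-super Hopf algebras *)

Section BraidedImage.
Variables (K : fieldType) (A : hopfAlg K) (B B' : braidedData A) (p : B -> B').
Hypothesis hB : is_braided_hopf B.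
Local Notation G := (@sdeg K B).
Local Notation G' := (@sdeg K B').
Let cB := bh_crossed hB.
Let bB := bh_bialgebra hB.
Let gG : is_grading G := gb_grading bB.
Let mulb : bilinear (@smul K B) := gb_mul_bilinear bB.
Let actb : bilinear (@bact K A B) := crossed_act_bilinear cB.
Let coactl : linear (@bcoact K A B) := crossed_coact_linear cB.
Let copl : linear (@scop K B) := gb_cop_linear bB.
Let coul : scalar (@scou K B) := gb_cou_linear bB.
#[local] Hint Resolve mulb actb coactl copl coul : linh.
Local Notation br := (super_braiding G (@bact K A B) (@bcoact K A B)).
Local Notation br' := (super_braiding G' (@bact K A B') (@bcoact K A B')).

Hypothesis lp : linear p.
Hypothesis p_surj : forall y, exists x, y = p x.
Hypothesis p_mul : forall x y, p (smul x y) = smul (p x) (p y).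
Hypothesis p_act : forall x a, p (bact x a) = bact (p x) a.
Hypothesis p_coact : forall x, bcoact (p x) = tmap p id (bcoact x).
Hypothesis p_deg : forall n x, G n x -> G' n (p x).
Hypothesis p_deg_surj : forall n y, G' n y -> exists2 x, G n x & y = p x.
Hypothesis gG' : is_grading G'.
#[local] Hint Resolve lp : linh.

(** On a quotient the operations are computed on representatives, so their linearity has to be
    inherited along the surjection p. *)
Let surj_linear (U : lmodType K) (f : B' -> U) : linear (fun x => f (p x)) -> linear f.
Proof.
move=> lf c y z; have [x ->] := p_surj y; have [x' ->] := p_surj z.
by rewrite -lp lf.
Qed.

Lemma image_mul_bilinear : bilinear (@smul K B').
Proof.
split=> [y|y]; have [x ->] := p_surj y; apply: surj_linear.
  by move=> c u v; rewrite -!p_mul (lin_bil2 x mulb) lp.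
by move=> c u v; rewrite -!p_mul (lin_bil1 x mulb) lp.
Qed.
Let mulb' := image_mul_bilinear.

Lemma image_act_bilinear : bilinear (@bact K A B').
Proof.
split=> [y|a]; last by apply: surj_linear => c u v; rewrite -!p_act (lin_bil1 a actb) lp.
by have [x ->] := p_surj y => c a b; rewrite -!p_act (lin_bil2 x actb) lp.
Qed.
Let actb' := image_act_bilinear.

Lemma image_coact_linear : linear (@bcoact K A B').
Proof.
apply: surj_linear => c u v; rewrite !p_coact coactl.
by apply: tmap_linear => //; lin.
Qed.
Let coactl' := image_coact_linear.
#[local] Hint Resolve mulb' actb' coactl' : linh.

Lemma sw_image_coact (U : lmodType K) (F : B' -> A -> U) x : bilinear F ->
  tlift F (bcoact (p x)) = \sw_(x0, x1 <- bcoact x) F (p x0) x1.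
Proof. by move=> bF; rewrite p_coact tlift_tmap //; lin. Qed.

Lemma image_twist k x : p (twist G k x) = twist G' k (p x).
Proof. exact: (twist_morph (f := p)). Qed.

Lemma image_braiding x y : br' (p x) (p y) = tmap p p (br x y).
Proof.
have bb : bilinear br := super_braiding_bilinear gG actb coactl.
have bb' : bilinear br' := super_braiding_bilinear gG' actb' coactl'.
move: x; apply: (hom_eq gG) => [||k x Gx].
- by lin.
- by apply: (lin_comp (tmap_linear lp lp)); lin.
rewrite (super_braidingE gG actb coactl _ Gx).
rewrite (super_braidingE gG' actb' coactl' _ (p_deg Gx)) -image_twist.
rewrite sw_image_coact; last by lin.
rewrite -(tlift_map _ _ (tmap_linear lp lp)); apply: eq_tlift => x0 x1.
by rewrite tmap_pure // p_act.
Qed.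

Lemma image_braided_mul s t :
  tmap p p (braided_mul smul br s t) = braided_mul smul br' (tmap p p s) (tmap p p t).
Proof.
have bb : bilinear br := super_braiding_bilinear gG actb coactl.
have bb' : bilinear br' := super_braiding_bilinear gG' actb' coactl'.
have bm := braided_mul_bilinear mulb bb.
have bm' := braided_mul_bilinear mulb' bb'.
have lpp := tmap_linear lp lp.
move: s; apply: tens_eq => [||x y].
- exact: (lin_comp lpp (lin_bil1 t bm)).
- exact: (lin_comp (lin_bil1 _ bm') lpp).
move: t; apply: tens_eq => [||x' y'].
- exact: (lin_comp lpp (lin_bil2 _ bm)).
- exact: (lin_comp (lin_bil2 _ bm') lpp).
rewrite !tmap_pure // !braided_mul_pure // image_braiding.
rewrite tlift_tmap; [|by lin..].
rewrite -(tlift_map _ _ lpp); apply: eq_tlift => u v.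
by rewrite tmap_pure // !p_mul.
Qed.

Hypothesis p_one : p sone = sone.
Hypothesis p_cop : forall x, scop (p x) = tmap p p (scop x).
Hypothesis p_cou : forall x, scou (p x) = scou x.

Let lpp : linear (tmap p p) := tmap_linear lp lp.

Lemma image_cop_linear : linear (@scop K B').
Proof. by apply: surj_linear => c u v; rewrite !p_cop copl lpp. Qed.
Let copl' := image_cop_linear.

Lemma image_cou_scalar : scalar (@scou K B').
Proof. by apply: (surj_linear (U := K^o)) => c u v; rewrite !p_cou coul. Qed.
Let coul' := image_cou_scalar.
#[local] Hint Resolve copl' coul' lpp : linh.

Lemma sw_image_cop (U : lmodType K) (F : B' -> B' -> U) x : bilinear F ->
  tlift F (scop (p x)) = \sw_(x1, x2 <- scop x) F (p x1) (p x2).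
Proof. by move=> bF; rewrite p_cop tlift_tmap //; lin. Qed.

Lemma image_crossed : is_crossed (@bact K A B') (@bcoact K A B').
Proof.
split=> [|y|y a b||y|y|y a].
- exact: actb'.
- by have [x ->] := p_surj y; rewrite -p_act (crossed_act1 cB).
- by have [x ->] := p_surj y; rewrite -!p_act (crossed_actM cB).
- exact: coactl'.
- have [x ->] := p_surj y; rewrite !sw_image_coact; [|by lin..].
  have lpi : linear (tmap p (@id (A ⊗ A))) by lin.
  have := congr1 (tmap p (@id (A ⊗ A))) (crossed_coassoc cB x).
  rewrite -!(tlift_map _ _ lpi) => h.
  transitivity (\sw_(x0, x1 <- bcoact x) tmap p (@id (A ⊗ A))
    (\sw_(v00, v01 <- bcoact x0) v00 ⊗ (v01 ⊗ x1))).
    apply: eq_tlift => x0 x1; rewrite sw_image_coact; last by lin.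
    by rewrite -(tlift_map _ _ lpi); apply: eq_tlift => u v; rewrite tmap_pure //; lin.
  by rewrite h; apply: eq_tlift => x0 x1; rewrite tmap_pure //; lin.
- have [x ->] := p_surj y; rewrite sw_image_coact; last by lin.
  rewrite -[in RHS](crossed_counit cB x) -tlift_map //.
  by apply: eq_tlift => x0 x1; rewrite (linZ lp).
have [x ->] := p_surj y.
rewrite -p_act p_coact (crossed_compat cB) sw_image_coact; last by lin.
have lpi : linear (tmap p (@id A)) by lin.
rewrite -(tlift_map _ _ lpi); apply: eq_tlift => x0 x1.
rewrite -(tlift_map _ _ lpi); apply: eq_tlift => a1 a'.
rewrite -(tlift_map _ _ lpi); apply: eq_tlift => a2 a3.
by rewrite tmap_pure ?p_act //; lin.
Qed.

Lemma image_bialgebra : is_graded_bialgebra br'.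
Proof.
split=> //.
- by move=> x y z; have [? ->] := p_surj x; have [? ->] := p_surj y;
    have [? ->] := p_surj z; rewrite -!p_mul (gb_mulA bB).
- by move=> x; have [? ->] := p_surj x; rewrite -p_one -p_mul (gb_mul1x bB).
- by move=> x; have [? ->] := p_surj x; rewrite -p_one -p_mul (gb_mulx1 bB).
- move=> i j _ _ /p_deg_surj [x Gx ->] /p_deg_surj [y Gy ->].
  by rewrite -p_mul; apply: p_deg; apply: (gb_mul_deg bB).
- by rewrite -p_one; apply: p_deg; apply: (gb_one_deg bB).
- move=> y; have [x ->] := p_surj y; rewrite !sw_image_cop; [|by lin..].
  have lppp : linear (tmap p (tmap p p)) by apply: tmap_linear.
  have := congr1 (tmap p (tmap p p)) (gb_coassoc bB x).
  rewrite -!(tlift_map _ _ lppp) => h.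
  transitivity (\sw_(x1, x2 <- scop x) tmap p (tmap p p)
     (\sw_(x11, x12 <- scop x1) x11 ⊗ (x12 ⊗ x2))).
    apply: eq_tlift => x1 x2; rewrite sw_image_cop; last by lin.
    by rewrite -(tlift_map _ _ lppp); apply: eq_tlift => u v; rewrite !tmap_pure.
  by rewrite h; apply: eq_tlift => x1 x2; rewrite tmap_pure // p_cop.
- move=> y; have [x ->] := p_surj y; rewrite sw_image_cop; last by lin.
  rewrite -[in RHS](gb_counitl bB x) -tlift_map //.
  by apply: eq_tlift => x1 x2; rewrite (linZ lp) p_cou.
- move=> y; have [x ->] := p_surj y; rewrite sw_image_cop; last by lin.
  rewrite -[in RHS](gb_counitr bB x) -tlift_map //.
  by apply: eq_tlift => x1 x2; rewrite (linZ lp) p_cou.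
- move=> n _ /p_deg_surj [x Gx ->]; rewrite p_cop.
  move: (scop x) (gb_cop_deg bB Gx); apply: lspan_min.
    by apply: (preim_subspace lpp); apply: lspan_subspace.
  move=> _ [i [j [y [z [<- dy dz ->]]]]]; rewrite /= tmap_pure //.
  apply: lspan_gen; exists i, j, (p y), (p z).
  by split=> //; apply: p_deg.
- by move=> n _ /p_deg_surj [x Gx ->]; rewrite p_cou; apply: (gb_cou_deg bB Gx).
- move=> x y; have [x' ->] := p_surj x; have [y' ->] := p_surj y.
  by rewrite -p_mul !p_cop (gb_copM bB) image_braided_mul.
- by rewrite -p_one p_cop (gb_cop1 bB) tmap_pure.
- move=> x y; have [x' ->] := p_surj x; have [y' ->] := p_surj y.
  by rewrite -p_mul !p_cou (gb_couM bB).
- by rewrite -p_one p_cou (gb_cou1 bB).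
Qed.

Variable S : B -> B.
Hypothesis aS : is_antipode S.
Hypothesis S_act : forall x a, S (bact x a) = bact (S x) a.
Hypothesis S_coact : forall x, bcoact (S x) = tmap S id (bcoact x).
Hypothesis S_ker : forall x, p x = 0 -> p (S x) = 0.

(** Each axiom of B' is the image under the surjection p of the axiom of B. Two points require more
    than surjectivity: the grading of B', given by [gG'], and the existence of an antipode, given by
    [S_ker]. *)
Lemma image_braided_hopf : is_braided_hopf B'.
Proof.
have lS : linear S := anti_linear aS.
(* An arbitrary section of p; since S preserves the kernel of p, the composite p S r does not depend
   on its choice. *)
pose r y := xget 0 [set x | y = p x].
have rK y : p (r y) = y.
  by have [x yx] := p_surj y; symmetry; apply: (@xgetPex _ 0 [set x | y = p x]); exists x.
pose S' y := p (S (r y)).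
have S'E x : S' (p x) = p (S x).
  apply/eqP; rewrite -subr_eq0 -(linB lp) -(linB lS); apply/eqP; apply: S_ker.
  by rewrite (linB lp) rK subrr.
have lS' : linear S'.
  by apply: surj_linear => c u v; rewrite !S'E lS lp.
split.
- exact: image_crossed.
- move=> n _ a /p_deg_surj [x Gx ->]; rewrite -p_act; apply: p_deg.
  exact: (bh_act_deg hB).
- move=> n _ /p_deg_surj [x Gx ->]; rewrite p_coact.
  move: (bcoact x) (bh_coact_deg hB Gx); apply: lspan_min.
    by apply: (preim_subspace (f := tmap p id)); [lin | apply: lspan_subspace].
  move=> _ [y Gy [a ->]]; rewrite /= tmap_pure; [|by lin..].
  by apply: lspan_gen; exists (p y); [apply: p_deg | exists a].
- move=> x y a; have [x' ->] := p_surj x; have [y' ->] := p_surj y.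
  rewrite -p_mul -p_act (bh_mul_act hB) -(tlift_map _ _ lp).
  by apply: eq_tlift => a1 a2; rewrite p_mul !p_act.
- by move=> a; rewrite -p_one -p_act (bh_one_act hB) (linZ lp).
- move=> x y; have [x' ->] := p_surj x; have [y' ->] := p_surj y.
  rewrite -p_mul p_coact (bh_mul_coact hB) sw_image_coact; last by lin.
  have lpi : linear (tmap p (@id A)) by lin.
  rewrite -(tlift_map _ _ lpi); apply: eq_tlift => x0 x1.
  rewrite sw_image_coact; last by lin.
  rewrite -(tlift_map _ _ lpi); apply: eq_tlift => y0 y1.
  by rewrite tmap_pure ?p_mul //; lin.
- by rewrite -p_one p_coact (bh_one_coact hB) tmap_pure //; lin.
- move=> y a; have [x ->] := p_surj y.
  rewrite -p_act p_cop (bh_cop_act hB) sw_image_cop; last by lin.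
  rewrite -(tlift_map _ _ lpp); apply: eq_tlift => x1 x2.
  rewrite -(tlift_map _ _ lpp); apply: eq_tlift => a1 a2.
  by rewrite tmap_pure // !p_act.
- by move=> y a; have [x ->] := p_surj y; rewrite -p_act !p_cou (bh_cou_act hB).
- move=> y; have [x ->] := p_surj y.
  rewrite sw_image_coact; last by lin.
  rewrite sw_image_cop; last by lin.
  have lppi : linear (tmap (tmap p p) (@id A)) by lin.
  have := congr1 (tmap (tmap p p) (@id A)) (bh_cop_coact hB x).
  rewrite -!(tlift_map _ _ lppi) => h.
  transitivity (\sw_(x0, a <- bcoact x) tmap (tmap p p) (@id A) (scop x0 ⊗ a)).
    by apply: eq_tlift => x0 a; rewrite tmap_pure ?p_cop //; lin.
  rewrite h; apply: eq_tlift => x1 x2.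
  rewrite sw_image_coact; last by lin.
  rewrite -(tlift_map _ _ lppi); apply: eq_tlift => y1 a1.
  rewrite sw_image_coact; last by lin.
  rewrite -(tlift_map _ _ lppi); apply: eq_tlift => y2 a2.
  by rewrite !tmap_pure //; lin.
- move=> y; have [x ->] := p_surj y.
  rewrite sw_image_coact; last by lin.
  rewrite p_cou -(bh_cou_coact hB x).
  by apply: eq_tlift => x0 x1; rewrite p_cou.
- exact: image_bialgebra.
exists S'; split.
- split=> //.
  + move=> n _ /p_deg_surj [x Gx ->]; rewrite S'E; apply: p_deg.
    exact: (anti_deg aS).
  + move=> y; have [x ->] := p_surj y.
    rewrite sw_image_cop; last by lin.
    rewrite p_cou -p_one -(linZ lp) -(antil aS) -(tlift_map _ _ lp).
    by apply: eq_tlift => x1 x2; rewrite S'E p_mul.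
  + move=> y; have [x ->] := p_surj y.
    rewrite sw_image_cop; last by lin.
    rewrite p_cou -p_one -(linZ lp) -(antir aS) -(tlift_map _ _ lp).
    by apply: eq_tlift => x1 x2; rewrite S'E p_mul.
- by move=> y a; have [x ->] := p_surj y; rewrite -p_act !S'E S_act p_act.
move=> y; have [x ->] := p_surj y; rewrite S'E p_coact S_coact p_coact.
rewrite /tmap !tlift_tlift; [|by lin..].
apply: eq_tlift => x0 x1; rewrite !tlift_pure; [|by lin..].
by rewrite S'E.
Qed.

End BraidedImage.

(** * The ideal of relations and its quotient *)

Section ThetaIdeal.
Variables (K : fieldType) (A : hopfAlg K) (V : crossedMod A) (θ : V).
Hypothesis coact_theta : cmcoact θ = θ ⊗ 1.
Local Notation T := (talg V).
Local Notation tact := (@talg_act K A V).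
Local Notation tcoact := (@talg_coact K A V).
Local Notation tdeg := (@talg_deg K A V).
Local Notation tcop := (@talg_cop K A V).
Local Notation tcou := (@talg_cou K A V).
Local Notation tw := (twist tdeg).
Local Notation tbr := (super_braiding tdeg tact tcoact).
Local Notation I := (theta_ideal θ).
Local Notation L := (Lambda_theta θ).
Local Notation p := (proj I : btalg V -> L).
Local Notation θ2 := (tin θ * tin θ : T).
Let cT := talg_crossed V.
Let hT := btalg_braided_hopf V.
Let gT := talg_grading V.
Let tinl : linear (@tin K V) := @tin_linear K V.
Let twl k : linear (tw k) := twist_linear gT k.
Let tactb : bilinear tact := @tact_bilinear K A V.
Let tcoactl : linear tcoact := @tcoact_linear K A V.
Let tcopl : linear tcop := @tcop_linear K A V.
Let tbrb : bilinear tbr := super_braiding_bilinear gT tactb tcoactl.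
Let vact_bilinear : bilinear (@cmact K A V) := crossed_act_bilinear (crossedP V).
Let vcoact_linear : linear (@cmcoact K A V) := crossed_coact_linear (crossedP V).
Let pmb : bilinear (@prim_mul K A V) := @prim_mul_bilinear K A V.
Let sl : linear (@tanti K A V) := @tanti_linear K A V.
Let lp : linear p := @proj_linear K (btalg V) I.
#[local] Hint Resolve tinl twl tactb tcoactl tcopl tbrb vact_bilinear vcoact_linear pmb
  sl lp : linh.

Lemma theta_ideal_ideal : @is_ideal K (btalg V) I.
Proof.
split; first split.
- by move=> J [iJ _]; apply: subspace0 (ideal_subspace iJ).
- move=> c x y Ix Iy J hJ.
  by apply: (subspaceP (ideal_subspace hJ.1)); [apply: Ix | apply: Iy].
- by move=> x y Iy J hJ; apply: (ideal_mull hJ.1); apply: Iy.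
- by move=> x y Ix J hJ; apply: (ideal_mulr hJ.1); apply: Ix.
Qed.
Let iI := theta_ideal_ideal.
Let sI : is_subspace I := ideal_subspace iI.

Lemma theta_ideal_min (J : set T) : @is_ideal K (btalg V) J ->
  (forall a, hcou a = 0 -> J (tact θ2 a)) ->
  (forall η, J (θ2 * tin η - tin η * θ2)) -> forall x, I x -> J x.
Proof.
move=> iJ Ja Jη x; apply; split=> // y [[a ea <-]|[η _ <-]]; [exact: Ja | exact: Jη].
Qed.

Lemma theta_ideal_act a : hcou a = 0 -> I (tact θ2 a).
Proof. by move=> ea J [_]; apply; left; exists a. Qed.

Lemma theta_ideal_comm η : I (θ2 * tin η - tin η * θ2).
Proof. by move=> J [_]; apply; right; exists η. Qed.

Lemma theta_projP (x y : T) : p x = p y <-> I (x - y).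
Proof.
split=> [/projP|Ixy]; first exact: lspan_id.
by apply/projP; apply: lspan_gen.
Qed.

Lemma theta_proj0 (x : T) : p x = 0 <-> I x.
Proof. by rewrite -(lin0 lp) theta_projP subr0. Qed.

Lemma theta_proj_surj (y : L) : exists x, y = p x.
Proof. by exists (repr y); rewrite /proj reprK. Qed.

Let repr_p (x : T) : I (repr (p x) - x).
Proof. by apply/theta_projP; rewrite /proj reprK. Qed.

Lemma theta_proj_mul (x y : T) : p (x * y) = smul (p x) (p y).
Proof.
apply/esym/theta_projP; set x' := repr _; set y' := repr _.
have -> : x' * y' - x * y = (x' - x) * y' + x * (y' - y).
  by rewrite mulrBl mulrBr addrA subrK.
by apply: (subspaceD sI); [apply: (ideal_mulr iI) | apply: (ideal_mull iI)];
  apply: repr_p.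
Qed.

(** The relation for the element a - ε(a) 1 of A^+: modulo the ideal, A acts on θ² through ε. *)
Let theta_act_mod a : I (tact θ2 a - hcou a *: θ2).
Proof.
have -> : tact θ2 a - hcou a *: θ2 = tact θ2 (a - hcou a *: 1).
  by rewrite (linB (lin_bil2 _ tactb)) (linZ (lin_bil2 _ tactb)) tact_1.
apply: theta_ideal_act.
rewrite (linB (scalar_linear (@hcou_scalar K A))).
by rewrite (linZ (scalar_linear (@hcou_scalar K A))) hcou1 [_ *: _]mulr1 subrr.
Qed.

Lemma proj_theta_act a : p (tact θ2 a) = hcou a *: p θ2.
Proof. by rewrite -(linZ lp); apply/theta_projP. Qed.

Lemma theta_ideal_act_stable (x : T) a : I x -> I (tact x a).
Proof.
move=> Ix; move: x Ix a.
apply: (theta_ideal_min (J := [set x | forall a, I (tact x a)])) => [|a ea b|η a].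
- split; first by apply: forall_subspace => a; apply: (preim_subspace (f := tact^~ a)) => //; lin.
    move=> x y Iy a; rewrite [smul x y]/(x * y) tact_mul; apply: (subspace_tlift _ sI).
    by move=> a1 a2; apply: (ideal_mull iI).
  move=> x y Ix a; rewrite [smul x y]/(x * y) tact_mul; apply: (subspace_tlift _ sI).
  by move=> a1 a2; apply: (ideal_mulr iI).
- by rewrite -tact_comp; apply: theta_ideal_act; rewrite hcouM ea mul0r.
rewrite (linB (lin_bil1 a tactb)) tact_mul (tact_mul (tin η)).
pose ηa := tin (cmact η a).
(* Each θ² ◁ a_i is compared with ε(a_i) θ². The errors lie in the ideal, and what remains is the
   commutator of θ² with η ◁ a. *)
have -> : \sw_(a1, a2 <- hcop a) (tact θ2 a1 * tact (tin η) a2) -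
    \sw_(a1, a2 <- hcop a) (tact (tin η) a1 * tact θ2 a2) =
  \sw_(a1, a2 <- hcop a) ((tact θ2 a1 - hcou a1 *: θ2) * tact (tin η) a2) -
  \sw_(a1, a2 <- hcop a) (tact (tin η) a1 * (tact θ2 a2 - hcou a2 *: θ2)) +
  (θ2 * ηa - ηa * θ2).
  have E1 : \sw_(a1, a2 <- hcop a) ((hcou a1 *: θ2) * tact (tin η) a2) = θ2 * ηa.
    rewrite /ηa -tact_tin -(sw_counitl (F := fun b => θ2 * tact (tin η) b)); last by lin.
    by apply: eq_tlift => a1 a2; rewrite -scalerAl.
  have E2 : \sw_(a1, a2 <- hcop a) (tact (tin η) a1 * (hcou a2 *: θ2)) = ηa * θ2.
    rewrite /ηa -tact_tin -(sw_counitr (F := fun b => tact (tin η) b * θ2)); last by lin.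
    by apply: eq_tlift => a1 a2; rewrite -scalerAr.
  rewrite -[in RHS]E1 -[in RHS]E2 addrACA -tliftD.
  rewrite -opprD -tliftD; congr (_ - _).
    by apply: eq_tlift => a1 a2; rewrite -mulrDl subrK.
  by apply: eq_tlift => a1 a2; rewrite -mulrDr subrK.
apply: (subspaceD sI); last exact: theta_ideal_comm.
apply: (subspaceB sI); apply: (subspace_tlift _ sI) => a1 a2.
  by apply: (ideal_mulr iI); apply: theta_act_mod.
by apply: (ideal_mull iI); apply: theta_act_mod.
Qed.

Lemma theta_proj_act (x : T) a : p (tact x a) = bact (p x) a.
Proof.
apply/esym/theta_projP; rewrite [bact _ _]/(tact _ _) -(linB (lin_bil1 a tactb)).
by apply: theta_ideal_act_stable; apply: repr_p.
Qed.

Let mulb : bilinear (@smul K L).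
Proof. exact: image_mul_bilinear hT lp theta_proj_surj theta_proj_mul. Qed.
#[local] Hint Resolve mulb : linh.

Let lpi : linear (tmap p (@id A)). Proof. by lin. Qed.

Lemma tcoact_theta2 : tcoact θ2 = θ2 ⊗ 1.
Proof.
rewrite tcoactM coact_theta tlift_pure; last by lin.
rewrite sw_tcoact_tin; last by lin.
by rewrite coact_theta tlift_pure ?mulr1 //; lin.
Qed.

(** As θ² is coinvariant, θ² ◁ a coacts as θ² ◁ a_2 ⊗ S(a_1) a_3, which projects to θ² ⊗ S(a_1) a_2
    = ε(a) θ² ⊗ 1 = 0. The commutator coacts as [θ², η_0] ⊗ η_1. *)
Lemma theta_ideal_coact (x : T) : I x -> tmap p id (tcoact x) = 0.
Proof.
move: x; apply: (theta_ideal_min (J := [set x | tmap p id (tcoact x) = 0])).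
- have E (x y : T) : tmap p id (tcoact (x * y)) =
    \sw_(x0, x1 <- tmap p id (tcoact x)) \sw_(y0, y1 <- tmap p id (tcoact y))
      smul x0 y0 ⊗ (x1 * y1).
    rewrite tlift_tmap; [|by lin..].
    rewrite {1}/tmap sw_tcoact_mul; last by lin.
    apply: eq_tlift => x0 x1; rewrite tlift_tmap; [|by lin..].
    by apply: eq_tlift => y0 y1; rewrite theta_proj_mul.
  split; first by apply: (ker_subspace (f := fun x => tmap p id (tcoact x))); lin.
    move=> x y /= y0; rewrite E y0 -[RHS](tlift0 (V := L) (W := A) _ (tmap p id (tcoact x))).
    by apply: eq_tlift => x0 x1; rewrite tlift_0 //; lin.
  by move=> x y /= x0; rewrite E x0 tlift_0 //; lin.
- move=> a ea /=; rewrite (crossed_compat cT) tcoact_theta2 tlift_pure; last by lin.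
  rewrite -(tlift_map _ _ lpi).
  transitivity (\sw_(a1, a' <- hcop a) p θ2 ⊗ (hanti a1 * a')).
    apply: eq_tlift => a1 a'; rewrite -(tlift_map _ _ lpi).
    rewrite -(sw_counitl (F := fun a' => p θ2 ⊗ (hanti a1 * a'))); last by lin.
    apply: eq_tlift => a2 a3; rewrite tmap_pure; [|by lin..].
    by rewrite proj_theta_act pureZl mulr1.
  by rewrite (sw_hantil (F := fun b => p θ2 ⊗ b)) ?ea ?scale0r //; lin.
move=> η /=; rewrite (linB tcoactl) (linB lpi).
have -> : tcoact (θ2 * tin η) = \sw_(y, a <- cmcoact η) (θ2 * tin y) ⊗ a.
  rewrite -[LHS]tlift_pureE sw_tcoact_mul; last by lin.
  rewrite tcoact_theta2 tlift_pure; last by lin.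
  by rewrite sw_tcoact_tin; [apply: eq_tlift => y a; rewrite mul1r | lin].
have -> : tcoact (tin η * θ2) = \sw_(y, a <- cmcoact η) (tin y * θ2) ⊗ a.
  rewrite -[LHS]tlift_pureE sw_tcoactM; last by lin.
  apply: eq_tlift => y a.
  by rewrite tcoact_theta2 tlift_pure ?mulr1 //; lin.
rewrite -(linB lpi) -tliftN -tliftD -(tlift_map _ _ lpi).
apply: big1 => q _; rewrite (linB lpi) !tmap_pure; [|by lin..].
have /theta_projP -> := theta_ideal_comm q.1.
by rewrite subrr.
Qed.

Lemma theta_proj_coact (x : T) : bcoact (p x) = tmap p id (tcoact x).
Proof.
rewrite [bcoact _]/(tmap p id (tcoact _)); apply/eqP.
rewrite -subr_eq0 -(linB lpi) -(linB tcoactl); apply/eqP.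
by apply: theta_ideal_coact; apply: repr_p.
Qed.

(** The relations are homogeneous, of degrees 2 and 3, and the span W of the homogeneous elements of
    the ideal is itself an ideal containing them. *)
Lemma theta_ideal_homogeneous n (x : T) : I x -> I (gcomp tdeg n x).
Proof.
pose W := lspan [set x : T | exists m, tdeg m x /\ I x].
have WI y : W y -> I y by apply: lspan_min => // z [m []].
suff IW y : I y -> W y.
  move=> /IW; move: x; apply: lspan_min.
    by apply: (preim_subspace (f := gcomp tdeg n)) => //; apply: (gcomp_linear gT).
  move=> y [m [dy Iy]] /=; rewrite (gcomp_hom gT _ dy).
  by case: eqP => // _; apply: subspace0.
move: y; apply: theta_ideal_min => [|a ea|η].
- split; first exact: lspan_subspace.
    move=> x' y Wy; move: x'; apply: (hom_ind gT (P := fun x => W (x * y))).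
      by apply: (preim_subspace (f := fun x : T => x * y)); [lin | apply: lspan_subspace].
    move=> m x' dx; move: y Wy; apply: (lspan_min (W := [set y | W (x' * y)])).
      by apply: (preim_subspace (f := fun y : T => x' * y)); [lin | apply: lspan_subspace].
    move=> y [k [dy Iy]]; apply: lspan_gen; exists (m + k)%N.
    by split; [apply: tdegM | apply: (ideal_mull iI)].
  move=> x' y Wx; move: y; apply: (hom_ind gT (P := fun y => W (x' * y))).
    by apply: (preim_subspace (f := fun y : T => x' * y)); [lin | apply: lspan_subspace].
  move=> m y dy; move: x' Wx; apply: (lspan_min (W := [set x | W (x * y)])).
    by apply: (preim_subspace (f := fun x : T => x * y)); [lin | apply: lspan_subspace].
  move=> x' [k [dx Ix]]; apply: lspan_gen; exists (k + m)%N.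
  by split; [apply: tdegM | apply: (ideal_mulr iI)].
- apply: lspan_gen; exists 2%N; split; last exact: theta_ideal_act.
  by apply: tact_deg; apply: (@tdegM _ _ _ 1 1); apply: tdeg_tin.
apply: lspan_gen; exists 3%N; split; last exact: theta_ideal_comm.
have d2 : tdeg 2 θ2 by apply: (@tdegM _ _ _ 1 1); apply: tdeg_tin.
apply: (subspaceB (@tdeg_subspace K A V 3)).
  by apply: (@tdegM _ _ _ 2 1) => //; apply: tdeg_tin.
by apply: (@tdegM _ _ _ 1 2) => //; apply: tdeg_tin.
Qed.

Lemma theta_proj_deg n (x : T) : tdeg n x -> @sdeg K L n (p x).
Proof. by move=> dx; exists x. Qed.

Lemma theta_proj_deg_surj n (y : L) : sdeg n y -> exists2 x : T, tdeg n x & y = p x.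
Proof. by []. Qed.

(** The component maps of the tensor algebra descend because the ideal is homogeneous, and
    [gradingI] applies to them. *)
Lemma Lambda_grading : is_grading (@sdeg K L).
Proof.
have pcE n x : p (gcomp tdeg n (repr (p x))) = p (gcomp tdeg n x).
  apply/theta_projP; rewrite -(linB (gcomp_linear gT n)).
  by apply: theta_ideal_homogeneous; apply: repr_p.
apply: (gradingI (p := fun n (y : L) => p (gcomp tdeg n (repr y)))).
- move=> n; split; first by exists 0; [exact: (subspace0 (@tdeg_subspace K A V n)) | rewrite (lin0 lp)].
  move=> c _ _ [x dx ->] [y dy ->]; exists (c *: x + y); last by rewrite lp.
  exact: (subspaceP (@tdeg_subspace K A V n)).
- move=> n c y z; have [x ->] := theta_proj_surj y; have [x' ->] := theta_proj_surj z.
  by rewrite -(lp c x x') !pcE (gcomp_linear gT n) lp.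
- move=> m n _ [x dx ->]; rewrite pcE (gcomp_hom gT _ dx).
  by rewrite eq_sym; case: eqP => // _; exact: (lin0 lp).
move=> y; have [x ->] := theta_proj_surj y.
move: x; apply: (hom_ind gT (P := fun x => lspan [set y | exists n, @sdeg K L n y] (p x))).
  by apply: (preim_subspace lp); apply: lspan_subspace.
by move=> n x dx; apply: lspan_gen; exists n; apply: theta_proj_deg.
Qed.
Let gL := Lambda_grading.

Let tw_theta2 k : tw k θ2 = θ2.
Proof. by rewrite twM !tw_tin -scalerAl -scalerAr scalerA -expr2 sqrr_sign scale1r. Qed.

Let act_theta1 : cmact θ 1 = θ.
Proof. exact: crossed_act1 (crossedP V) _. Qed.

(** Stated for the operator rather than for the single element Δθ², because it also computes Δ(θ²
    η). *)
Let prim_theta2 t : prim_mul θ (prim_mul θ t) =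
  \sw_(x, y <- t) ((θ2 * x) ⊗ y + \sw_(x0, x1 <- tcoact x) x0 ⊗ (tact θ2 x1 * y)).
Proof.
move: t; apply: tens_eq => [||x y]; [by lin | by lin |].
rewrite tlift_pure; last by lin.
rewrite prim_mul_pure (linD (lin_bil2 _ pmb)) prim_mul_pure mulrA -addrA; congr (_ + _).
rewrite -(tlift_map _ _ (lin_bil2 _ pmb)).
transitivity (\sw_(x0, x1 <- tcoact x) (- ((tin θ * tw 1 x0) ⊗ (tin (cmact θ x1) * y)) +
   ((tin θ * tw 1 x0) ⊗ (tin (cmact θ x1) * y) +
    \sw_(x00, x01 <- tcoact x0) x00 ⊗ (tin (cmact θ x01) * (tin (cmact θ x1) * y))))).
  rewrite sw_tcoactM; last by lin.
  rewrite coact_theta tlift_pure; last by lin.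
  rewrite -tliftD; apply: eq_tlift => x0 x1; rewrite prim_mul_pure twM tw_tin mul1r.
  rewrite expr1 -scalerAl pureZl scaleN1r; congr (_ + (_ + _)).
  rewrite sw_tcoact_tw; last by lin.
  by apply: eq_tlift => x00 x01; rewrite -(twistD gT) (twist_even gT 1).
under eq_tlift => x0 x1 do rewrite addrA addNr add0r.
rewrite (sw_coact_assoc cT (F := fun x00 x01 x1 =>
  x00 ⊗ (tin (cmact θ x01) * (tin (cmact θ x1) * y)))); [|by lin..].
apply: eq_tlift => x0 x1; rewrite tact_mul.
rewrite -(tlift_map (f := fun z => x0 ⊗ (z * y))); last by lin.
by apply: eq_tlift => a b; rewrite !tact_tin mulrA.
Qed.

Lemma tcop_theta2 : tcop θ2 = θ2 ⊗ 1 + 1 ⊗ θ2.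
Proof.
rewrite -[tin θ in X in tin θ * X]mulr1 !tcopM tcop1 prim_theta2 tlift_pure; last by lin.
rewrite sw_tcoact1; last by lin.
by rewrite tact_1 !mulr1.
Qed.

Let lpp : linear (tmap p p) := tmap_linear lp lp.

Let pact_bilinear : bilinear (@bact K A L).
Proof. exact: image_act_bilinear hT lp theta_proj_surj theta_proj_act. Qed.

Let pcoact_linear : linear (@bcoact K A L).
Proof. exact: image_coact_linear hT lp theta_proj_surj theta_proj_coact. Qed.

Local Notation brL := (super_braiding (@sdeg K L) (@bact K A L) (@bcoact K A L)).
Let brLb : bilinear brL := super_braiding_bilinear gL pact_bilinear pcoact_linear.

Lemma theta_ideal_cop (x : T) : I x -> tmap p p (tcop x) = 0.
Proof.
have bmL := braided_mul_bilinear mulb brLb.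
move: x; apply: (theta_ideal_min (J := [set x | tmap p p (tcop x) = 0])).
(* The projected coproduct is multiplicative for the braided product of Λ_θ ⊗ Λ_θ, so its kernel is
   an ideal and only the relations have to be examined. *)
- have E (x y : T) : tmap p p (tcop (x * y)) =
      braided_mul smul brL (tmap p p (tcop x)) (tmap p p (tcop y)).
    rewrite tcop_mul (image_braided_mul hT lp theta_proj_surj theta_proj_mul
      theta_proj_act theta_proj_coact theta_proj_deg gL) //.
  split; first by apply: (ker_subspace (f := fun x => tmap p p (tcop x))); lin.
    by move=> x y /= y0; rewrite E y0 (lin0 (lin_bil2 _ bmL)).
  by move=> x y /= x0; rewrite E x0 (lin0 (lin_bil1 _ bmL)).
- move=> a ea /=.
  have -> : tcop (tact θ2 a) = tact θ2 a ⊗ 1 + 1 ⊗ tact θ2 a.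
    rewrite tcop_act tcop_theta2 tliftDr; last by lin.
    rewrite !tlift_pure; [|by lin..]; congr (_ + _).
      rewrite -(sw_counitr (F := fun a => tact θ2 a ⊗ 1)); last by lin.
      by apply: eq_tlift => a1 a2; rewrite tact1 pureZr.
    rewrite -(sw_counitl (F := fun a => 1 ⊗ tact θ2 a)); last by lin.
    by apply: eq_tlift => a1 a2; rewrite tact1 pureZl.
  rewrite (linD lpp) !tmap_pure //.
  have /theta_proj0 -> := theta_ideal_act ea.
  by rewrite pure0l pure0r addr0.
move=> η /=; rewrite (linB tcopl) (linB lpp).
have E1 : tcop (θ2 * tin η) = (θ2 * tin η) ⊗ 1 +
    \sw_(y, a <- cmcoact η) tin y ⊗ tact θ2 a + (θ2 ⊗ tin η + 1 ⊗ (θ2 * tin η)).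
  rewrite -mulrA !tcopM tcop_tin prim_theta2 tliftDr; last by lin.
  rewrite !tlift_pure; [|by lin..].
  rewrite sw_tcoact_tin; last by lin.
  rewrite sw_tcoact1; last by lin.
  rewrite tact_1 mulr1 !mulrA; congr (_ + _ + _).
  by apply: eq_tlift => y a; rewrite mulr1.
have E2 : tcop (tin η * θ2) = (tin η * θ2) ⊗ 1 + θ2 ⊗ tin η +
    (tin η ⊗ θ2 + 1 ⊗ (tin η * θ2)).
  rewrite tcopM tcop_theta2 (linD (lin_bil2 _ pmb)) !prim_mul_pure.
  rewrite tcoact_theta2 tlift_pure; last by lin.
  rewrite sw_tcoact1; last by lin.
  by rewrite tw_theta2 tw1 !mulr1 (crossed_act1 (crossedP V)).
rewrite E1 E2 !(linD lpp) !tmap_pure // -(tlift_map _ _ lpp).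
(* In the quotient θ² ◁ η_1 = ε(η_1) θ², and the counit of the coaction gives back η. This matches
   the cross term η ⊗ θ² of the other product. *)
have -> : \sw_(y, a <- cmcoact η) tmap p p (tin y ⊗ tact θ2 a) = p (tin η) ⊗ p θ2.
  rewrite -(sw_coact_counit (crossedP V) (F := fun y => p (tin y) ⊗ p θ2)); last by lin.
  by apply: eq_tlift => y a; rewrite tmap_pure // proj_theta_act pureZr.
have /theta_projP -> := theta_ideal_comm η.
by rewrite [X in X - _]addrACA subrr.
Qed.

Lemma theta_proj_cop (x : T) : scop (p x) = tmap p p (tcop x).
Proof.
rewrite [scop _]/(tmap p p (tcop _)); apply/eqP.
rewrite -subr_eq0 -(linB lpp) -(linB tcopl); apply/eqP.
by apply: theta_ideal_cop; apply: repr_p.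
Qed.

Lemma theta_ideal_cou (x : T) : I x -> tcou x = 0.
Proof.
move: x; apply: (theta_ideal_min (J := [set x | tcou x = 0])) => [|a ea|η] /=.
- split=> [|x y y0|x y x0].
  + exact: (ker_subspace (U := K^o) (scalar_linear (@tcou_scalar K A V))).
  + by change (tcou (x * y) = 0); rewrite tcou_mul y0 mulr0.
  + by change (tcou (x * y) = 0); rewrite tcou_mul x0 mul0r.
- by rewrite tcou_act tcouM mul0r.
rewrite (linB (scalar_linear (@tcou_scalar K A V))) -mulrA !tcouM.
exact: subrr.
Qed.

Lemma theta_proj_cou (x : T) : scou (p x) = tcou x.
Proof.
rewrite [scou _]/(tcou _); apply/eqP.
rewrite -subr_eq0 -(linB (scalar_linear (@tcou_scalar K A V))); apply/eqP.
by apply: theta_ideal_cou; apply: repr_p.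
Qed.

Let tanti_braiding (x y : T) :
  tanti (x * y) = \sw_(u, v <- tbr (tanti x) (tanti y)) (u * v).
Proof.
move: x; apply: (hom_eq gT) => [||k x dx]; [by lin | by lin |].
rewrite (tanti_mul _ dx) (tbrE _ (tanti_deg dx)) tlift_tlift; last by lin.
by apply: eq_tlift => y0 y1; rewrite tlift_pure //; lin.
Qed.

Let tanti_theta2 : tanti θ2 = - θ2.
Proof.
rewrite tantiM tanti_tin (linN tcoactl) -[- tcoact _]scaleN1r tliftZr; last by lin.
rewrite sw_tcoact_tin; last by lin.
rewrite coact_theta tlift_pure; last by lin.
by rewrite tw_tin act_theta1 expr1 -scalerAl !scaleN1r opprK.
Qed.

(** S carries θ² ◁ a to its negative and exchanges the two products in [θ², η]. The product θ² η
    goes to η_0 (θ² ◁ η_1), which equals η θ² only modulo the ideal; η θ² goes to θ² η exactly. *)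
Lemma theta_ideal_anti (x : T) : I x -> I (tanti x).
Proof.
move: x; apply: theta_ideal_min => [|a ea|η].
- have E (x y : T) : p (tanti (x * y)) =
      \sw_(u, v <- brL (p (tanti x)) (p (tanti y))) smul u v.
    rewrite tanti_braiding (image_braiding hT lp theta_proj_surj
      theta_proj_act theta_proj_coact theta_proj_deg gL).
    rewrite tlift_tmap // -(tlift_map _ _ lp).
    by apply: eq_tlift => u v; rewrite theta_proj_mul.
  split; first by apply: (preim_subspace sl).
    move=> x y /= /theta_proj0 y0; apply/theta_proj0.
    by rewrite E y0 (lin0 (lin_bil2 _ brLb)) tlift_0.
  move=> x y /= /theta_proj0 x0; apply/theta_proj0.
  by rewrite E x0 (lin0 (lin_bil1 _ brLb)) tlift_0.
- rewrite tanti_act tanti_theta2 (linN (lin_bil1 a tactb)) -scaleN1r.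
  by apply: (subspaceZ sI); apply: theta_ideal_act.
apply/theta_proj0; rewrite (linB sl) (linB lp).
have d2 : tdeg 2 θ2 by apply: (@tdegM _ _ _ 1 1); apply: tdeg_tin.
have -> : p (tanti (θ2 * tin η)) = p (tin η * θ2).
  rewrite (tanti_mul _ d2) tanti_tin (linN tcoactl) -[- tcoact _]scaleN1r tliftZr;
    last by lin.
  rewrite sw_tcoact_tin; last by lin.
  rewrite (linZ lp) -(tlift_map _ _ lp).
  rewrite -(sw_coact_counit (crossedP V) (F := fun y => p (tin y * θ2))); last by lin.
  rewrite -tliftZ; apply: eq_tlift => y a.
  rewrite (twist_even gT 1) tanti_theta2 (linN (lin_bil1 a tactb)) mulrN.
  rewrite (linN lp) scaleN1r opprK (theta_proj_mul _ θ2) (theta_proj_mul _ (tact _ _)) proj_theta_act.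
  by rewrite (linZ (lin_bil2 _ mulb)).
have -> : tanti (tin η * θ2) = θ2 * tin η.
  rewrite (tanti_mul _ (tdeg_tin η)) tanti_theta2 (linN tcoactl).
  rewrite -[- tcoact _]scaleN1r tliftZr; last by lin.
  rewrite tcoact_theta2 tlift_pure; last by lin.
  by rewrite tw_theta2 tact_1 tanti_tin mulrN scaleN1r opprK.
by have /theta_projP <- := theta_ideal_comm η; rewrite subrr.
Qed.

Lemma Lambda_theta_braided_hopf : is_braided_hopf L.
Proof.
apply: (image_braided_hopf hT lp theta_proj_surj theta_proj_mul theta_proj_act
  theta_proj_coact theta_proj_deg theta_proj_deg_surj gL _ theta_proj_cop theta_proj_cou
  (tanti_antipode V) (@tanti_act K A V) (@tanti_coact K A V)) => // x.
by move=> /theta_proj0 Ix; apply/theta_proj0; apply: theta_ideal_anti.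
Qed.

Lemma theta_proj_braided_morph : is_braided_morph p.
Proof.
split; first split.
- exact: lp.
- exact: theta_proj_mul.
- by [].
- exact: theta_proj_cop.
- exact: theta_proj_cou.
- exact: theta_proj_deg.
- exact: theta_proj_act.
- exact: theta_proj_coact.
Qed.

End ThetaIdeal.

(** * Bosonisation *)

Section BosonisationHopf.
Variables (K : fieldType) (A : hopfAlg K) (B : braidedData A).
Hypothesis hB : is_braided_hopf B.
Local Notation G := (@sdeg K B).
Local Notation tw := (twist G).
Local Notation act := (@bact K A B).
Local Notation coact := (@bcoact K A B).
Local Notation cop := (@scop K B).
Local Notation cou := (@scou K B).
Local Notation one := (@sone K B).
Local Notation "x ∙ y" := (@smul K B x y) (at level 39, left associativity).
Local Notation H := (boson B).
Local Notation hmul := (@boson_mul K A B).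
Local Notation Hcop := (@boson_cop K A B).
Local Notation Hdeg := (@boson_deg K A B).
Let cB := bh_crossed hB.
Let bB := bh_bialgebra hB.
Let gG : is_grading G := gb_grading bB.
Let mulb : bilinear (@smul K B) := gb_mul_bilinear bB.
Let actb : bilinear act := crossed_act_bilinear cB.
Let coactl : linear coact := crossed_coact_linear cB.
Let copl : linear cop := gb_cop_linear bB.
Let coul : scalar cou := gb_cou_linear bB.
Let twl k : linear (tw k) := twist_linear gG k.
Local Notation br := (super_braiding G act coact).
Let brb : bilinear br := super_braiding_bilinear gG actb coactl.
#[local] Hint Resolve mulb actb coactl copl coul twl brb : linh.

Lemma sw_bmul_coact (U : lmodType K) (F : B -> A -> U) x y : bilinear F ->
  tlift F (coact (x ∙ y)) =
  \sw_(x0, x1 <- coact x) \sw_(y0, y1 <- coact y) F (x0 ∙ y0) (x1 * y1).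
Proof.
move=> bF; rewrite (bh_mul_coact hB) tlift_tlift //; apply: eq_tlift => x0 x1.
by rewrite tlift_tlift //; apply: eq_tlift => y0 y1; rewrite tlift_pure.
Qed.

Lemma sw_bcoact_tw (U : lmodType K) (F : B -> A -> U) k x : bilinear F ->
  tlift F (coact (tw k x)) = \sw_(x0, x1 <- coact x) F (tw k x0) x1.
Proof. by move=> bF; apply: (sw_coact_twist gG) => //; apply: (bh_coact_deg hB). Qed.

Lemma sw_bcoassoc (U : lmodType K) (F : B -> B -> B -> U) x :
  (forall y z, linear (fun x => F x y z)) ->
  (forall x z, linear (fun y => F x y z)) -> (forall x y, linear (F x y)) ->
  \sw_(x1, z <- cop x) (\sw_(x11, y <- cop x1) F x11 y z) =
  \sw_(x1, y <- cop x) (\sw_(y1, z <- cop y) F x1 y1 z).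
Proof.
move=> F1 F2 F3.
pose R u t := tlift (fun y z => F u y z) t.
have bR : bilinear R by rewrite /R; lin.
have := congr1 (tlift R) (gb_coassoc bB x).
rewrite !tlift_tlift // => h.
transitivity (\sw_(x1, z <- cop x) tlift R (\sw_(x11, y <- cop x1) x11 ⊗ (y ⊗ z))).
  apply: eq_tlift => x1 z; rewrite tlift_tlift //; apply: eq_tlift => x11 y.
  by rewrite tlift_pure // /R tlift_pure //; lin.
by rewrite h; apply: eq_tlift => x1 y; rewrite tlift_pure.
Qed.

Lemma sw_bcounitl (U : lmodType K) (F : B -> U) x : linear F ->
  \sw_(x1, x2 <- cop x) (cou x1 *: F x2) = F x.
Proof.
move=> lF; rewrite -[in RHS](gb_counitl bB x) -tlift_map //.
by apply: eq_tlift => x1 x2; rewrite linZ.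
Qed.

Lemma sw_bcounitr (U : lmodType K) (F : B -> U) x : linear F ->
  \sw_(x1, x2 <- cop x) (cou x2 *: F x1) = F x.
Proof.
move=> lF; rewrite -[in RHS](gb_counitr bB x) -tlift_map //.
by apply: eq_tlift => x1 x2; rewrite linZ.
Qed.

Lemma sw_bcop_coact (U : lmodType K) (F : B -> B -> A -> U) x :
  (forall y a, linear (fun x => F x y a)) ->
  (forall x a, linear (fun y => F x y a)) -> (forall x y, linear (F x y)) ->
  \sw_(x0, a <- coact x) (\sw_(x1, x2 <- cop x0) F x1 x2 a) =
  \sw_(x1, x2 <- cop x) \sw_(y1, a1 <- coact x1) \sw_(y2, a2 <- coact x2)
     F y1 y2 (a1 * a2).
Proof.
move=> F1 F2 F3.
pose R t a := tlift (fun y z => F y z a) t.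
have bR : bilinear R by rewrite /R; lin.
have := congr1 (tlift R) (bh_cop_coact hB x).
rewrite !tlift_tlift // => h.
transitivity (\sw_(x0, a <- coact x) tlift R (cop x0 ⊗ a)).
  by apply: eq_tlift => x0 a; rewrite tlift_pure.
rewrite h; apply: eq_tlift => x1 x2; rewrite tlift_tlift //.
apply: eq_tlift => y1 a1; rewrite tlift_tlift //.
by apply: eq_tlift => y2 a2; rewrite tlift_pure // /R tlift_pure //; lin.
Qed.

Lemma hmul_bilinear : bilinear hmul.
Proof. by rewrite /boson_mul; lin. Qed.
#[local] Hint Resolve hmul_bilinear : linh.

Lemma hmul_pure a x b y :
  hmul (a ⊗ x) (b ⊗ y) = \sw_(b1, b2 <- hcop b) (a * b1) ⊗ (act x b2 ∙ y).
Proof.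
rewrite /boson_mul tlift_pure; last by lin.
by rewrite tlift_pure //; lin.
Qed.

Lemma hmul_pureA a b y : hmul (a ⊗ one) (b ⊗ y) = (a * b) ⊗ y.
Proof.
rewrite hmul_pure -(sw_counitr (F := fun b => (a * b) ⊗ y)); last by lin.
apply: eq_tlift => b1 b2; rewrite (bh_one_act hB) (linZ (lin_bil1 y mulb)).
by rewrite (gb_mul1x bB) pureZr.
Qed.

Lemma hmul_pureB a x y : hmul (a ⊗ x) (1 ⊗ y) = a ⊗ (x ∙ y).
Proof.
rewrite hmul_pure sw_hcop1; last by lin.
by rewrite mulr1 (crossed_act1 cB).
Qed.

Lemma hmulA : associative hmul.
Proof.
move=> s t u; move: s; apply: tens_eq => [||a x]; [by lin | by lin |].
move: t; apply: tens_eq => [||b y]; [by lin | by lin |].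
move: u; apply: tens_eq => [||c z]; [by lin | by lin |].
rewrite !hmul_pure -(tlift_map (f := hmul _)); last by lin.
rewrite -(tlift_map (f := fun v => hmul v _)); last by lin.
transitivity (\sw_(c1, c2 <- hcop c) \sw_(b1, b2 <- hcop b) \sw_(d1, d2 <- hcop c1)
   (a * (b1 * d1)) ⊗ (act x (b2 * d2) ∙ (act y c2 ∙ z))).
  by apply: eq_tlift => c1 c2; rewrite hmul_pure sw_hcopM //; lin.
rewrite tlift_exch; apply: eq_tlift => b1 b2.
rewrite sw_coassoc; [|by lin..]; rewrite hmul_pure.
apply: eq_tlift => c1 c'; rewrite (bh_mul_act hB).
rewrite -(tlift_map (f := fun v => (a * b1 * c1) ⊗ (v ∙ z))); last by lin.
by apply: eq_tlift => d2 c2; rewrite mulrA (crossed_actM cB) (gb_mulA bB).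
Qed.

Lemma Hcop_linear : linear Hcop.
Proof. by rewrite /boson_cop; lin. Qed.
#[local] Hint Resolve Hcop_linear : linh.

(** The coproduct of a ⊗ x as a function of Δx, so that the multiplicativity and equivariance of Δ
    on B can be substituted into it. *)
Let cop_step (a : A) (t : B ⊗ B) : H ⊗ H :=
  \sw_(a1, a2 <- hcop a) \sw_(x1, x2 <- t)
    \sw_(y, b <- coact x1) (a1 ⊗ y) ⊗ ((a2 * b) ⊗ x2).

Let cop_step_bilinear : bilinear cop_step.
Proof. by rewrite /cop_step; lin. Qed.
#[local] Hint Resolve cop_step_bilinear : linh.

Let Hcop_step a x : Hcop (a ⊗ x) = cop_step a (cop x).
Proof. by rewrite /boson_cop tlift_pure //; lin. Qed.

Lemma sw_Hcop (U : lmodType K) (F : H -> H -> U) a x : bilinear F ->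
  tlift F (Hcop (a ⊗ x)) = \sw_(a1, a2 <- hcop a) \sw_(x1, x2 <- cop x)
    \sw_(y, b <- coact x1) F (a1 ⊗ y) ((a2 * b) ⊗ x2).
Proof.
move=> bF; rewrite Hcop_step tlift_tlift //; apply: eq_tlift => a1 a2.
rewrite tlift_tlift //; apply: eq_tlift => x1 x2.
by rewrite tlift_tlift //; apply: eq_tlift => y b; rewrite tlift_pure.
Qed.

(** The coassociativities of A and of B are linked by colinearity of Δ on B, which distributes the
    coaction on a first leg over the two halves of its coproduct. *)
Lemma boson_coassoc (t : H) :
  \sw_(x1, x2 <- Hcop t) (\sw_(x11, x12 <- Hcop x1) x11 ⊗ (x12 ⊗ x2)) =
  \sw_(x1, x2 <- Hcop t) x1 ⊗ Hcop x2.
Proof.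
move: t; apply: tens_eq => [||a x]; [by lin | by lin |].
rewrite !sw_Hcop; [|by lin..].
transitivity (\sw_(a', a3 <- hcop a) \sw_(a1, a2 <- hcop a') \sw_(x1, x3 <- cop x)
   \sw_(y, b <- coact x1) \sw_(y1, y2 <- cop y) \sw_(z, c <- coact y1)
     (a1 ⊗ z) ⊗ (((a2 * c) ⊗ y2) ⊗ ((a3 * b) ⊗ x3))).
  apply: eq_tlift => a' a3; rewrite tlift_exch; apply: eq_tlift => x1 x3.
  rewrite tlift_exch; apply: eq_tlift => y b.
  by rewrite sw_Hcop //; lin.
rewrite sw_coassoc; [|by lin..]; apply: eq_tlift => a1 a'.
transitivity (\sw_(a2, a3 <- hcop a') \sw_(x', x3 <- cop x) \sw_(x1, x2 <- cop x')
   \sw_(z, d <- coact x1) \sw_(c, b <- hcop d) \sw_(y2, e <- coact x2)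
     (a1 ⊗ z) ⊗ (((a2 * c) ⊗ y2) ⊗ ((a3 * (b * e)) ⊗ x3))).
  apply: eq_tlift => a2 a3; apply: eq_tlift => x' x3.
  rewrite (sw_bcop_coact (F := fun y1 y2 b => \sw_(z, c <- coact y1)
     (a1 ⊗ z) ⊗ (((a2 * c) ⊗ y2) ⊗ ((a3 * b) ⊗ x3)))); [|by lin..].
  apply: eq_tlift => x1 x2.
  rewrite -(sw_coact_assoc cB (F := fun z c b => \sw_(y2, e <- coact x2)
     (a1 ⊗ z) ⊗ (((a2 * c) ⊗ y2) ⊗ ((a3 * (b * e)) ⊗ x3)))); [|by lin..].
  by apply: eq_tlift => y1 b; rewrite tlift_exch.
transitivity (\sw_(a2, a3 <- hcop a') \sw_(x1, x'' <- cop x) \sw_(x2, x3 <- cop x'')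
   \sw_(z, d <- coact x1) \sw_(c, b <- hcop d) \sw_(y2, e <- coact x2)
     (a1 ⊗ z) ⊗ (((a2 * c) ⊗ y2) ⊗ ((a3 * (b * e)) ⊗ x3))).
  by apply: eq_tlift => a2 a3; rewrite sw_bcoassoc //; lin.
rewrite tlift_exch; apply: eq_tlift => x1 x''.
transitivity (\sw_(z, d <- coact x1) \sw_(a2, a3 <- hcop a') \sw_(x2, x3 <- cop x'')
   \sw_(c, b <- hcop d) \sw_(y2, e <- coact x2)
     (a1 ⊗ z) ⊗ (((a2 * c) ⊗ y2) ⊗ ((a3 * (b * e)) ⊗ x3))).
  rewrite [RHS]tlift_exch; apply: eq_tlift => a2 a3.
  by rewrite [RHS]tlift_exch.
apply: eq_tlift => z d; rewrite Hcop_step /cop_step sw_hcopM; last by lin.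
rewrite -(tlift_map (f := pure (a1 ⊗ z))); last by lin.
apply: eq_tlift => a2 a3.
rewrite -(tlift_map (f := pure (a1 ⊗ z))); last by lin.
rewrite tlift_exch; apply: eq_tlift => c b.
rewrite -(tlift_map (f := pure (a1 ⊗ z))); last by lin.
apply: eq_tlift => x2 x3.
rewrite -(tlift_map (f := pure (a1 ⊗ z))); last by lin.
by apply: eq_tlift => y2 e; rewrite mulrA.
Qed.

Let cou_bilinear : bilinear (fun (a : A) (x : B) => hcou a * scou x : K^o).
Proof.
split=> [b|y] c u v; first by rewrite coul mulrDr mulrCA.
by rewrite hcou_scalar mulrDl -mulrA.
Qed.

Lemma boson_cou_pure a x : boson_cou ((a ⊗ x) : H) = hcou a * scou x.
Proof. exact: (tlift_pure a x cou_bilinear). Qed.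

Lemma boson_cou_scalar : scalar (@boson_cou K A B).
Proof. exact: (tlift_linear cou_bilinear). Qed.
Let bcl := boson_cou_scalar.
#[local] Hint Resolve bcl : linh.

Lemma boson_counitl (t : H) : \sw_(x1, x2 <- Hcop t) (boson_cou x1 *: x2) = t.
Proof.
move: t; apply: tens_eq => [||a x]; [by lin | by lin |].
rewrite sw_Hcop; last by lin.
rewrite -(sw_counitl (F := fun a => a ⊗ x)); last by lin.
apply: eq_tlift => a1 a2.
rewrite -(sw_bcounitl (F := fun x => a2 ⊗ x)); last by lin.
rewrite -tliftZ; apply: eq_tlift => x1 x2.
transitivity (\sw_(y, b <- coact x1) hcou a1 *: ((a2 * (cou y *: b)) ⊗ x2)).
  apply: eq_tlift => y b; rewrite boson_cou_pure -scalerA; congr (_ *: _).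
  by rewrite -scalerAr pureZl.
rewrite (tlift_map (f := fun b => hcou a1 *: ((a2 * b) ⊗ x2))); last by lin.
by rewrite (bh_cou_coact hB) -scalerAr pureZl mulr1.
Qed.

Lemma boson_counitr (t : H) : \sw_(x1, x2 <- Hcop t) (boson_cou x2 *: x1) = t.
Proof.
move: t; apply: tens_eq => [||a x]; [by lin | by lin |].
rewrite sw_Hcop; last by lin.
rewrite -(sw_counitr (F := fun a => a ⊗ x)); last by lin.
apply: eq_tlift => a1 a2.
rewrite -(sw_bcounitr (F := fun x => a1 ⊗ x)); last by lin.
rewrite -tliftZ; apply: eq_tlift => x1 x2.
rewrite -(sw_coact_counit cB (F := fun x => a1 ⊗ x)); last by lin.
rewrite -!tliftZ; apply: eq_tlift => y b.
by rewrite boson_cou_pure hcouM !scalerA -!mulrA [hcou b * _]mulrC.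
Qed.

Let gid n : linear (gcomp G n) := gcomp_linear gG n.
#[local] Hint Resolve gid : linh.

Lemma boson_deg_pure n a x : G n x -> Hdeg n (a ⊗ x).
Proof. by move=> Gx; apply: lspan_gen; exists a, x. Qed.

Lemma boson_deg_ind n (P : H -> Prop) : is_subspace P ->
  (forall a x, G n x -> P (a ⊗ x)) -> forall t, Hdeg n t -> P t.
Proof. by move=> sP HP; apply: lspan_min => // _ [a [x [Gx ->]]]; apply: HP. Qed.

Lemma boson_deg_subspace n : is_subspace (Hdeg n).
Proof. exact: lspan_subspace. Qed.

Lemma boson_grading : is_grading Hdeg.
Proof.
apply: (gradingI (p := fun n => tmap id (gcomp G n))) => [n|n|m n t dt|t].
- exact: boson_deg_subspace.
- by apply: tmap_linear; lin.
- move: t dt; apply: boson_deg_ind.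
    apply: eq_linear_subspace; first by apply: tmap_linear; lin.
    by case: (m == n); [apply: lin_id | apply: lin_cst0].
  move=> a x Gx; rewrite tmap_pure; [|by lin..].
  rewrite (gcomp_hom gG _ Gx) eq_sym; case: eqP => // _.
  exact: pure0r.
move: t; apply: tens_ind; first exact: lspan_subspace.
move=> a; apply: (hom_ind gG (P := fun x => lspan _ (a ⊗ x))).
  by apply: (preim_subspace (f := pure a)); [lin | apply: lspan_subspace].
by move=> n x Gx; apply: lspan_gen; exists n; apply: boson_deg_pure.
Qed.
Let gH := boson_grading.

Lemma boson_twist k a x : twist Hdeg k (a ⊗ x) = a ⊗ tw k x.
Proof.
by symmetry; apply: (twist_morph (f := pure a) k x gG gH); [lin | move=> *; apply: boson_deg_pure].
Qed.

Lemma boson_mul_deg i j (s t : H) : Hdeg i s -> Hdeg j t -> Hdeg (i + j)%N (hmul s t).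
Proof.
move=> ds dt; move: s ds; apply: boson_deg_ind.
  by apply: (preim_subspace (f := fun s => hmul s t)); [lin | apply: boson_deg_subspace].
move=> a x Gx; move: t dt; apply: boson_deg_ind.
  by apply: (preim_subspace (f := hmul (a ⊗ x))); [lin | apply: boson_deg_subspace].
move=> b y Gy; rewrite hmul_pure; apply: (subspace_tlift _ (boson_deg_subspace _)).
move=> b1 b2; apply: boson_deg_pure; apply: (gb_mul_deg bB) => //.
exact: (bh_act_deg hB).
Qed.

Lemma boson_cop_deg n (t : H) : Hdeg n t ->
  lspan [set s : H ⊗ H | exists i j (y z : H),
      [/\ (i + j)%N = n, Hdeg i y, Hdeg j z & s = y ⊗ z]] (Hcop t).
Proof.
move: t; apply: boson_deg_ind.
  by apply: (preim_subspace Hcop_linear); apply: lspan_subspace.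
move=> a x Gx; rewrite Hcop_step; move: (cop x) (gb_cop_deg bB Gx); apply: lspan_min.
  by apply: (preim_subspace (f := cop_step a)); [lin | apply: lspan_subspace].
move=> _ [i [j [x1 [x2 [<- d1 d2 ->]]]]].
rewrite /= /cop_step; apply: (subspace_tlift _ (lspan_subspace _)) => a1 a2.
rewrite tlift_pure; last by lin.
move: (coact x1) (bh_coact_deg hB d1); apply: lspan_min.
  apply: (preim_subspace (f := fun t => \sw_(y, b <- t) (a1 ⊗ y) ⊗ ((a2 * b) ⊗ x2))).
    by lin.
  exact: lspan_subspace.
move=> _ [y dy [b ->]] /=; rewrite tlift_pure; last by lin.
apply: lspan_gen; exists i, j, (a1 ⊗ y), ((a2 * b) ⊗ x2).
by split=> //; apply: boson_deg_pure.
Qed.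

Local Notation flip := (super_flip Hdeg).
Let flipb : bilinear flip := super_flip_bilinear gH.
#[local] Hint Resolve flipb : linh.
Local Notation BM := (braided_mul hmul flip).
Let BMb : bilinear BM := braided_mul_bilinear hmul_bilinear flipb.
Local Notation bm := (braided_mul (@smul K B) br).
Let bmb : bilinear bm := braided_mul_bilinear mulb brb.
#[local] Hint Resolve BMb bmb : linh.

Let BM_hom k s1 s2 t1 t2 : Hdeg k s2 ->
  BM (s1 ⊗ s2) (t1 ⊗ t2) = hmul s1 (twist Hdeg k t1) ⊗ hmul s2 t2.
Proof.
move=> ds; rewrite braided_mul_pure; [|by lin..].
by rewrite (super_flipE gH _ ds) tlift_pure //; lin.
Qed.

Let bm_hom k s1 s2 t1 t2 : G k s2 -> bm (s1 ⊗ s2) (t1 ⊗ t2) =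
  \sw_(x0, x1 <- coact t1) (s1 ∙ tw k x0) ⊗ (act s2 x1 ∙ t2).
Proof.
move=> ds; rewrite braided_mul_pure; [|by lin..].
rewrite (super_braidingE gG actb coactl _ ds) tlift_tlift; last by lin.
rewrite sw_bcoact_tw; last by lin.
by apply: eq_tlift => x0 x1; rewrite tlift_pure //; lin.
Qed.

Let act2 (t : B ⊗ B) (a : A) : B ⊗ B :=
  \sw_(x1, x2 <- t) \sw_(a1, a2 <- hcop a) act x1 a1 ⊗ act x2 a2.

Let act2_bilinear : bilinear act2.
Proof. by rewrite /act2; lin. Qed.
#[local] Hint Resolve act2_bilinear : linh.

(** The heart of bosonisation. The product on the right uses the plain super flip: the coaction
    inside the coproduct and the action inside the product together supply the braiding of B. The
    crossed module axiom exchanges action and coaction on x_1, and with x_2 homogeneous of degree k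
    both products carry the same sign [tw k]. *)
Let cop_step_mul a b s t :
  \sw_(b1, b2 <- hcop b) cop_step (a * b1) (bm (act2 s b2) t) =
  BM (cop_step a s) (cop_step b t).
Proof.
move: s; apply: tens_eq => [||x1 x2]; [by lin | by lin |].
move: x2; apply: (hom_eq gG) => [||k x2 G2]; [by lin | by lin |].
move: t; apply: tens_eq => [||y1 y2]; [by lin | by lin |].
transitivity (\sw_(a1, a2 <- hcop a) \sw_(b1, b' <- hcop b) \sw_(b2, b3 <- hcop b')
  \sw_(c1, c2 <- hcop b1) \sw_(y10, y11 <- coact y1) \sw_(x10, x11 <- coact (act x1 b2))
   \sw_(y100, y101 <- coact y10)
    ((a1 * c1) ⊗ (x10 ∙ tw k y100)) ⊗
    ((a2 * (c2 * x11) * y101) ⊗ (act x2 (b3 * y11) ∙ y2))).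
  rewrite [RHS]tlift_exch; apply: eq_tlift => b1 b'.
  rewrite /act2 tlift_pure; last by lin.
  rewrite -(tlift_map (f := fun s => cop_step (a * b1) (bm s (y1 ⊗ y2)))); last by lin.
  rewrite [RHS]tlift_exch; apply: eq_tlift => b2 b3.
  have d2 : G k (act x2 b3) by apply: (bh_act_deg hB).
  rewrite (bm_hom _ _ _ d2) -(tlift_map (f := cop_step _)); last by lin.
  under [RHS]eq_tlift => a1 a2 do rewrite tlift_exch.
  rewrite [RHS]tlift_exch; apply: eq_tlift => y10 y11.
  rewrite /cop_step sw_hcopM; last by lin.
  apply: eq_tlift => a1 a2; apply: eq_tlift => c1 c2.
  rewrite tlift_pure; last by lin.
  rewrite sw_bmul_coact; last by lin.
  apply: eq_tlift => x10 x11; rewrite sw_bcoact_tw; last by lin.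
  apply: eq_tlift => y100 y101.
  by rewrite (crossed_actM cB) !mulrA.
transitivity (\sw_(a1, a2 <- hcop a) \sw_(x10, x11 <- coact x1) \sw_(b1, b2 <- hcop b)
  \sw_(y10, y11 <- coact y1) \sw_(c1, c2 <- hcop b1) \sw_(d1, d2 <- hcop b2)
   \sw_(z1, z2 <- hcop y11)
    ((a1 * c1) ⊗ (act x10 c2 ∙ tw k y10)) ⊗
    ((a2 * x11 * d1 * z1) ⊗ (act x2 (d2 * z2) ∙ y2))); last first.
  rewrite /cop_step -(tlift_map (f := BM^~ _)); last by lin.
  apply: eq_tlift => a1 a2; rewrite tlift_pure; last by lin.
  rewrite -(tlift_map (f := BM^~ _)); last by lin.
  apply: eq_tlift => x10 x11; rewrite -(tlift_map (f := BM _)); last by lin.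
  apply: eq_tlift => b1 b2; rewrite tlift_pure; last by lin.
  rewrite -(tlift_map (f := BM _)); last by lin.
  apply: eq_tlift => y10 y11.
  have d2 : Hdeg k ((a2 * x11) ⊗ x2) by apply: boson_deg_pure.
  rewrite (BM_hom _ _ _ d2) boson_twist !hmul_pure sw_hcopM; last by lin.
  rewrite -(tlift_map (f := fun u => u ⊗ _)); last by lin.
  apply: eq_tlift => c1 c2; rewrite -(tlift_map (f := pure _)); last by lin.
  apply: eq_tlift => d1 d2'; rewrite -(tlift_map (f := pure _)); last by lin.
  by apply: eq_tlift => z1 z2; rewrite mulrA.
apply: eq_tlift => a1 a2.
(* Both sides become sums of [F1]; besides one use of the crossed module axiom on x_1, they differ
   only in the numbering of the legs of b and of the coaction of y_1. *)
pose F1 x10 c1 c2 b3 y10 y11 y12 := ((a1 * c1) ⊗ (x10 ∙ tw k y10)) ⊗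
    ((a2 * c2 * y11) ⊗ (act x2 (b3 * y12) ∙ y2)).
transitivity (\sw_(c1, d <- hcop b) \sw_(e, b3 <- hcop d) \sw_(x10, x11 <- coact x1)
  \sw_(e1, e2 <- hcop e) \sw_(y10, z <- coact y1) \sw_(y11, y12 <- hcop z)
  F1 (act x10 e1) c1 (x11 * e2) b3 y10 y11 y12).
  transitivity (\sw_(b1, b' <- hcop b) \sw_(c1, c2 <- hcop b1) \sw_(b2, b3 <- hcop b')
     \sw_(x10, x11 <- coact (act x1 b2)) \sw_(y10, z <- coact y1) \sw_(y11, y12 <- hcop z)
       F1 x10 c1 (c2 * x11) b3 y10 y11 y12).
    apply: eq_tlift => b1 b'; rewrite tlift_exch.
    apply: eq_tlift => c1 c2; apply: eq_tlift => b2 b3.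
    rewrite tlift_exch; apply: eq_tlift => x10 x11.
    by rewrite (sw_coact_assoc cB (F := fun y10 y11 y12 =>
      F1 x10 c1 (c2 * x11) b3 y10 y11 y12)) // /F1; lin.
  rewrite /F1 sw_coassoc; [|by lin..].
  apply: eq_tlift => c1 d; rewrite -sw_coassoc; [|by lin..].
  apply: eq_tlift => e b3.
  by rewrite (sw_crossed cB (F := fun x10 c => \sw_(y10, z <- coact y1)
    \sw_(y11, y12 <- hcop z) F1 x10 c1 c b3 y10 y11 y12)) // /F1; lin.
symmetry.
transitivity (\sw_(x10, x11 <- coact x1) \sw_(c1, d <- hcop b) \sw_(e, b3 <- hcop d)
  \sw_(e1, e2 <- hcop e) \sw_(y10, z <- coact y1) \sw_(y11, y12 <- hcop z)
  F1 (act x10 e1) c1 (x11 * e2) b3 y10 y11 y12); last first.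
  rewrite tlift_exch; apply: eq_tlift => c1 d.
  by rewrite tlift_exch.
apply: eq_tlift => x10 x11.
transitivity (\sw_(b1, b2 <- hcop b) \sw_(c1, c2 <- hcop b1) \sw_(d1, d2 <- hcop b2)
    \sw_(y10, z <- coact y1) \sw_(y11, y12 <- hcop z)
    F1 (act x10 c2) c1 (x11 * d1) d2 y10 y11 y12).
  apply: eq_tlift => b1 b2; rewrite tlift_exch; apply: eq_tlift => c1 c2.
  rewrite tlift_exch; apply: eq_tlift => d1 d2; apply: eq_tlift => y10 z.
  by apply: eq_tlift => y11 y12; rewrite /F1 !mulrA.
rewrite /F1 sw_coassoc; [|by lin..].
apply: eq_tlift => c1 d; rewrite -sw_coassoc //; lin.
Qed.

Lemma boson_copM (s t : H) : Hcop (hmul s t) = BM (Hcop s) (Hcop t).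
Proof.
move: s; apply: tens_eq => [||a x]; [by lin | by lin |].
move: t; apply: tens_eq => [||b y]; [by lin | by lin |].
rewrite !Hcop_step -cop_step_mul hmul_pure -(tlift_map _ _ Hcop_linear).
by apply: eq_tlift => b1 b2; rewrite Hcop_step (gb_copM bB) (bh_cop_act hB).
Qed.

Lemma boson_bialgebra : is_graded_bialgebra (H := boson B) flip.
Proof.
split.
- exact: gH.
- exact: hmul_bilinear.
- exact: hmulA.
- move=> t; move: t; apply: tens_eq => [||a x]; [by apply: lin_bil2; lin | by lin |].
  by rewrite /= hmul_pureA mul1r.
- move=> t; move: t; apply: tens_eq => [||a x].
  + by apply: (lin_bil1 _ hmul_bilinear).
  + by lin.
  by rewrite /= hmul_pureB (gb_mulx1 bB).
- exact: boson_mul_deg.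
- by apply: boson_deg_pure; apply: (gb_one_deg bB).
- exact: Hcop_linear.
- exact: bcl.
- exact: boson_coassoc.
- exact: boson_counitl.
- exact: boson_counitr.
- exact: boson_cop_deg.
- move=> n t; move: t; apply: boson_deg_ind.
    exact: (ker_subspace (U := K^o) (scalar_linear bcl)).
  by move=> a x Gx; rewrite /= boson_cou_pure (gb_cou_deg bB Gx) mulr0.
- exact: boson_copM.
- rewrite /= Hcop_step (gb_cop1 bB) /cop_step sw_hcop1; last by lin.
  rewrite tlift_pure; last by lin.
  by rewrite (bh_one_coact hB) tlift_pure ?mulr1 //; lin.
- move=> s t; move: s; apply: (tens_eq (U := K^o)) => [||a x].
  + by apply: (lin_comp (g := @boson_cou K A B : _ -> K^o)); [exact: bcl | lin].
  + exact: (scalar_mulr _ bcl).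
  move: t; apply: (tens_eq (U := K^o)) => [||b y].
  + by apply: (lin_comp (g := @boson_cou K A B : _ -> K^o)); [exact: bcl | lin].
  + exact: (scalar_mull _ bcl).
  rewrite /= !boson_cou_pure hmul_pure -(tlift_map (f := @boson_cou K A B : _ -> K^o));
    last exact: bcl.
  transitivity (\sw_(b1, b2 <- hcop b)
    (hcou b2 *: (hcou a * hcou b1 * (cou x * cou y) : K^o))).
    apply: eq_tlift => b1 b2; rewrite boson_cou_pure hcouM (gb_couM bB) (bh_cou_act hB).
    by rewrite /GRing.scale /= [cou x * _]mulrC -[hcou b2 * _ * _]mulrA mulrCA.
  rewrite (sw_counitr (F := fun b1 => hcou a * hcou b1 * (cou x * cou y) : K^o)).
    exact: mulrACA.
  by move=> c u v; rewrite hcou_scalar mulrDr mulrDl [hcou a * (c * _)]mulrCA -[c * _ * _]mulrA.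
- by rewrite /= boson_cou_pure hcou1 (gb_cou1 bB) mulr1.
Qed.

Lemma boson_super_hopf : is_super_hopf (boson B).
Proof.
split; first exact: boson_bialgebra.
have [S [aS S_act S_coact]] := bh_antipode hB.
have lS : linear S := anti_linear aS.
(* The usual antipode of a bosonisation, a ⊗ x ↦ (1 ⊗ S x_0)(S(a x_1) ⊗ 1). It needs no sign because
   x_1 lies in A, in degree 0. *)
pose Sh (t : H) : H := \sw_(a, x <- t) \sw_(x0, x1 <- coact x)
  hmul (1 ⊗ S x0) (hanti (a * x1) ⊗ one).
have lSh : linear Sh by rewrite /Sh; lin.
have ShE a x : Sh (a ⊗ x) = \sw_(x0, x1 <- coact x)
    hmul (1 ⊗ S x0) (hanti (a * x1) ⊗ one).
  by rewrite /Sh tlift_pure //; lin.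
exists Sh; split=> //.
- move=> n t; move: t; apply: boson_deg_ind.
    by apply: (preim_subspace lSh); apply: boson_deg_subspace.
  move=> a x Gx; rewrite /= ShE; move: (coact x) (bh_coact_deg hB Gx); apply: lspan_min.
    apply: (preim_subspace (f := fun t => \sw_(x0, x1 <- t)
      hmul (1 ⊗ S x0) (hanti (a * x1) ⊗ one))); first by lin.
    exact: boson_deg_subspace.
  move=> _ [y Gy [b ->]] /=; rewrite tlift_pure; last by lin.
  rewrite -[n]addn0; apply: boson_mul_deg; apply: boson_deg_pure.
    exact: (anti_deg aS).
  exact: (gb_one_deg bB).
- move=> t; move: t; apply: tens_eq => [||a x]; [by lin | |].
    by apply: lin_scalar; exact: bcl.
  rewrite /= sw_Hcop; last by lin.
  rewrite boson_cou_pure -scalerA tlift_exch.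
  transitivity (\sw_(x1, x2 <- cop x) (hcou a *: (1 ⊗ (S x1 ∙ x2) : H))).
    apply: eq_tlift => x1 x2.
    rewrite -(sw_coact_counit cB (F := fun x1 => (hcou a *: (1 ⊗ (S x1 ∙ x2) : H))));
      last by lin.
    transitivity (\sw_(a1, a2 <- hcop a) \sw_(y, c <- coact x1) \sw_(c1, c2 <- hcop c)
      hmul (1 ⊗ S y) ((hanti (a1 * c1) * (a2 * c2)) ⊗ x2)).
      apply: eq_tlift => a1 a2.
      rewrite -(sw_coact_assoc cB (F := fun y c1 c2 =>
        hmul (1 ⊗ S y) ((hanti (a1 * c1) * (a2 * c2)) ⊗ x2))); [|by lin..].
      apply: eq_tlift => y b; rewrite ShE.
      rewrite -(tlift_map (f := hmul^~ _)); last by lin.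
      by apply: eq_tlift => y0 y1; rewrite -hmulA hmul_pureA.
    rewrite tlift_exch; apply: eq_tlift => y c.
    rewrite -(sw_hcopM (F := fun u v => hmul (1 ⊗ S y) ((hanti u * v) ⊗ x2))); last by lin.
    rewrite (sw_hantil (F := fun u => hmul (1 ⊗ S y) (u ⊗ x2))); last by lin.
    by rewrite hmul_pureB hcouM mulrC scalerA.
  rewrite (tlift_map (f := fun u => hcou a *: (1 ⊗ u))); last by lin.
  by rewrite (antil aS) pureZr.
move=> t; move: t; apply: tens_eq => [||a x]; [by lin | |].
  by apply: lin_scalar; exact: bcl.
rewrite /= sw_Hcop; last by lin.
rewrite boson_cou_pure mulrC -scalerA.
transitivity (\sw_(a1, a2 <- hcop a) (cou x *: hmul (a1 ⊗ one) (hanti a2 ⊗ one))).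
  apply: eq_tlift => a1 a2.
  pose F u c := hmul (a1 ⊗ u) (hanti (a2 * c) ⊗ one).
  have bF : bilinear F by rewrite /F; lin.
  transitivity (\sw_(x1, x2 <- cop x) tlift F (coact (x1 ∙ S x2))).
    apply: eq_tlift => x1 x2; rewrite sw_bmul_coact // S_coact.
    apply: eq_tlift => y b; rewrite ShE tlift_tmap; [|by lin..].
    rewrite -(tlift_map (f := hmul _)); last by lin.
    by apply: eq_tlift => x20 x21; rewrite hmulA hmul_pureB /F mulrA.
  rewrite (tlift_map (f := fun u => tlift F (coact u))); last by lin.
  rewrite (antir aS) (linZ coactl) tliftZr // (bh_one_coact hB) tlift_pure //.
  by rewrite /F mulr1.
transitivity (\sw_(a1, a2 <- hcop a) (cou x *: ((a1 * hanti a2) ⊗ one : H))).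
  by apply: eq_tlift => a1 a2; rewrite hmul_pureA.
rewrite (tlift_map (f := fun u => cou x *: (u ⊗ one))); last by lin.
by rewrite (hopf_antir (hopfP A)) pureZl.
Qed.

End BosonisationHopf.

(** * The inner calculus *)

Section InnerDerivation.
Variables (K : fieldType) (H : superData K) (θ : H).
Local Notation G := (@sdeg K H).
Local Notation "x ∙ y" := (@smul K H x y) (at level 39, left associativity).
Local Notation d := (super_bracket θ).
Local Notation P := (twist G 1).
Hypothesis bH : is_graded_bialgebra (super_flip G).
Hypothesis theta_deg : G 1%N θ.
Let gG : is_grading G := gb_grading bH.
Let mulb : bilinear (@smul K H) := gb_mul_bilinear bH.
Let Pl : linear P := twist_linear gG 1.
Let copl : linear (@scop K H) := gb_cop_linear bH.
#[local] Hint Resolve mulb Pl copl : linh.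

Let PM x y : P (x ∙ y) = P x ∙ P y.
Proof. by apply: (twistM gG) => //; apply: (gb_mul_deg bH). Qed.

Let PP x : P (P x) = x.
Proof. by rewrite -(twistD gG) (twist_even gG 1). Qed.

Let P_theta : P θ = - θ.
Proof. by rewrite (twist_hom gG _ theta_deg) expr1 scaleN1r. Qed.

Lemma super_bracketE x : d x = θ ∙ x - P x ∙ θ.
Proof.
have lF n : linear (fun x => θ ∙ x - (-1) ^+ n *: (x ∙ θ)) by lin.
move: x; apply: (hom_eq gG) => [||n x Gx].
- exact: gmap_linear.
- by lin.
rewrite /super_bracket (gmap_hom gG _ Gx) // (twist_hom gG _ Gx) mul1n.
by rewrite (linZ (lin_bil1 θ mulb)).
Qed.

Lemma super_bracket_linear : linear d.
Proof.
have h : linear (fun x => θ ∙ x - P x ∙ θ) by lin.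
by move=> c x y; rewrite !super_bracketE; apply: h.
Qed.

Lemma super_bracket_deg n x : G n x -> G n.+1 (d x).
Proof.
move=> Gx; rewrite super_bracketE; apply: (subspaceB (grading_sub gG _)).
  by rewrite -add1n; apply: (gb_mul_deg bH).
by rewrite -addn1; apply: (gb_mul_deg bH) => //; apply: (twist_deg gG).
Qed.

(** The mixed terms θ P(x) θ cancel because θ is odd. So d² = 0 amounts to centrality of θ², and
    both halves of the theorem use this equivalence. *)
Lemma super_bracket_sq x : d (d x) = θ ∙ θ ∙ x - x ∙ (θ ∙ θ).
Proof.
rewrite !super_bracketE (linB (lin_bil2 _ mulb)) (linB Pl) !PM PP P_theta.
rewrite (linB (lin_bil1 θ mulb)) (linN (lin_bil1 _ mulb)) (linN (lin_bil1 _ mulb)).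
rewrite (linN (lin_bil2 _ mulb)) (linN (lin_bil1 _ mulb)).
by rewrite !(gb_mulA bH) opprB opprK [_ + θ ∙ P x ∙ θ]addrC addrA subrK.
Qed.

Lemma super_bracket_leibniz n x y : G n x ->
  d (x ∙ y) = d x ∙ y + (-1) ^+ n *: (x ∙ d y).
Proof.
move=> Gx; rewrite !super_bracketE PM.
have -> : (-1) ^+ n *: (x ∙ (θ ∙ y - P y ∙ θ)) = P x ∙ (θ ∙ y - P y ∙ θ).
  by rewrite (twist_hom gG 1 Gx) mul1n (linZ (lin_bil1 _ mulb)).
rewrite (linB (lin_bil1 y mulb)) (linB (lin_bil2 _ mulb)) !(gb_mulA bH).
by rewrite addrA subrK.
Qed.

Let flipb : bilinear (super_flip G) := super_flip_bilinear gG.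
Local Notation BM := (braided_mul (@smul K H) (super_flip G)).
Let BMb : bilinear BM := braided_mul_bilinear mulb flipb.
#[local] Hint Resolve flipb BMb : linh.

Lemma flip_mul_hom k s1 s2 t1 t2 : G k s2 ->
  BM (s1 ⊗ s2) (t1 ⊗ t2) = (s1 ∙ twist G k t1) ⊗ (s2 ∙ t2).
Proof.
move=> ds; rewrite braided_mul_pure; [|by lin..].
by rewrite (super_flipE gG _ ds) tlift_pure //; lin.
Qed.

Lemma scop_twist x : scop (P x) = tmap P P (scop x).
Proof.
have lPP : linear (tmap P P) by lin.
move: x; apply: (hom_eq gG) => [||n x Gx].
- by lin.
- exact: (lin_comp lPP copl).
rewrite (twist_hom gG _ Gx) (linZ copl) mul1n.
move: (scop x) (gb_cop_deg bH Gx); apply: lspan_min.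
  by apply: eq_linear_subspace; [apply: lin_scalef; apply: lin_id | exact: lPP].
move=> _ [i [j [y [z [<- dy dz ->]]]]] /=.
rewrite tmap_pure // (twist_hom gG _ dy) (twist_hom gG _ dz) !mul1n.
by rewrite pureZl pureZr scalerA exprD.
Qed.

Hypothesis theta_prim : scop θ = θ ⊗ sone + sone ⊗ θ.

(** Multiplication by θ ⊗ 1 + 1 ⊗ θ touches one leg at a time. From the left, θ crossing the first
    leg y produces the parity of y; from the right, θ crossing the second leg cancels the parity
    already applied to it. *)
Lemma super_bracket_coleibniz x : scop (d x) =
  tmap d id (scop x) + tmap (parity G) d (scop x).
Proof.
have dl := super_bracket_linear.
have lP : linear (parity G).
  by apply: (gmap_linear gG) => i; apply: lin_scalef; apply: lin_id.
have lT1 : linear (tmap d (id : H -> H)) by apply: tmap_linear => //; apply: lin_id.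
have lT2 : linear (tmap (parity G) d) by apply: tmap_linear.
have lPP : linear (tmap P P) by lin.
rewrite super_bracketE (linB copl) !(gb_copM bH) theta_prim scop_twist.
move: (scop x); apply: tens_eq => [||y z].
- apply: lin_addf; first by lin.
  apply: lin_oppf; exact: (lin_comp (lin_bil1 _ BMb) lPP).
- exact: lin_addf.
rewrite !tmap_pure // !super_bracketE (parityE gG).
rewrite (linD (lin_bil1 _ BMb)) (linD (lin_bil2 _ BMb)).
rewrite (flip_mul_hom _ _ _ (gb_one_deg bH)) (flip_mul_hom _ _ _ theta_deg).
rewrite (twist0 gG) !(gb_mul1x bH).
have -> : BM (P y ⊗ P z) (θ ⊗ sone) = (P y ∙ θ) ⊗ z.
  move: z; apply: (hom_eq gG) => [||k z Gz]; [by lin | by lin |].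
  rewrite (flip_mul_hom _ _ _ (twist_deg gG _ Gz)) (gb_mulx1 bH).
  rewrite (twist_hom gG k theta_deg) (twist_hom gG 1 Gz) mul1n muln1.
  by rewrite (linZ (lin_bil2 _ mulb)) pureZl pureZr scalerA -expr2 sqrr_sign scale1r.
have -> : BM (P y ⊗ P z) (sone ⊗ θ) = P y ⊗ (P z ∙ θ).
  move: z; apply: (hom_eq gG) => [||k z Gz]; [by lin | by lin |].
  rewrite (flip_mul_hom _ _ _ (twist_deg gG _ Gz)).
  by rewrite (twist_hom gG k (gb_one_deg bH)) muln0 scale1r (gb_mulx1 bH).
rewrite (linB (f := fun u => u ⊗ z)); last by lin.
rewrite (linB (f := pure (P y))); last by lin.
by rewrite opprD addrACA.
Qed.

End InnerDerivation.

(** * The exterior algebra Ω_θ and its differential *)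

Section OmegaTheta.
Variables (K : fieldType) (A : hopfAlg K) (V : crossedMod A) (θ : V).
Hypothesis coact_theta : cmcoact θ = θ ⊗ 1.
Local Notation T := (talg V).
Local Notation I := (theta_ideal θ).
Local Notation L := (Lambda_theta θ).
Local Notation p := (proj I : btalg V -> L).
Local Notation H := (boson L).
Local Notation Θ := (Omega_theta_elt θ).
Local Notation θ2 := (tin θ * tin θ : T).
Let hL : is_braided_hopf L := Lambda_theta_braided_hopf coact_theta.
Let bL := bh_bialgebra hL.
Let lp : linear p := @proj_linear K (btalg V) I.
Let mulb : bilinear (@smul K L) := gb_mul_bilinear bL.
Let actb : bilinear (@bact K A L) := crossed_act_bilinear (bh_crossed hL).
Let coul : scalar (@scou K L) := gb_cou_linear bL.
Let hmulb : bilinear (@boson_mul K A L) := hmul_bilinear hL.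
#[local] Hint Resolve lp mulb actb coul hmulb : linh.

Lemma theta2_central (y : L) : smul (p θ2) y = smul y (p θ2).
Proof.
have [x ->] := theta_proj_surj y.
rewrite -!theta_proj_mul; apply/theta_projP; move: x; apply: talg_ind => [||v x IHx].
- apply: (preim_subspace (f := fun x : T => θ2 * x - x * θ2)); first by lin.
  exact: ideal_subspace (theta_ideal_ideal θ).
- rewrite mulr1 mul1r subrr.
  exact: subspace0 (ideal_subspace (theta_ideal_ideal θ)).
have -> : θ2 * (tin v * x) - tin v * x * θ2 =
    (θ2 * tin v - tin v * θ2) * x + tin v * (θ2 * x - x * θ2).
  by rewrite mulrBl mulrBr !mulrA addrA subrK.
apply: (subspaceD (ideal_subspace (theta_ideal_ideal θ))).
  by apply: (ideal_mulr (theta_ideal_ideal θ)); apply: theta_ideal_comm.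
exact: (ideal_mull (theta_ideal_ideal θ)).
Qed.

Lemma Omega_theta_sq : smul Θ Θ = (1 : A) ⊗ p θ2 :> H.
Proof. by rewrite [LHS](hmul_pureB hL) theta_proj_mul. Qed.

Lemma Omega_theta_sq_central (t : H) : smul (smul Θ Θ) t = smul t (smul Θ Θ).
Proof.
rewrite Omega_theta_sq; move: t; apply: tens_eq => [||a y].
- exact: (lin_bil2 _ hmulb).
- exact: (lin_bil1 _ hmulb).
rewrite [RHS](hmul_pureB hL) [LHS](hmul_pure hL).
rewrite -theta2_central -(sw_counitr (F := fun a => a ⊗ smul (p θ2) y)); last by lin.
apply: eq_tlift => a1 a2.
rewrite -theta_proj_act proj_theta_act.
by rewrite (linZ (lin_bil1 y mulb)) pureZr mul1r.
Qed.

Lemma Omega_theta_deg : @sdeg K H 1 Θ.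
Proof. by apply: boson_deg_pure; apply: theta_proj_deg; apply: tdeg_tin. Qed.

(** In the bosonisation, 1 ⊗ θ has the coproduct (1 ⊗ θ_0) ⊗ (θ_1 ⊗ 1) plus the term with θ in the
    second leg; coinvariance of θ removes the factor θ_1. *)
Lemma Omega_theta_prim : scop Θ = Θ ⊗ sone + sone ⊗ Θ :> H ⊗ H.
Proof.
have lpp : linear (tmap p p) := tmap_linear lp lp.
rewrite -[LHS]tlift_pureE (sw_Hcop hL); last by lin.
rewrite sw_hcop1; last first.
  by have cl := crossed_coact_linear (bh_crossed hL); lin.
rewrite (theta_proj_cop coact_theta) tcop_tin (linD lpp) !tmap_pure //.
have bF : bilinear (fun x1 x2 : L => \sw_(y, b <- bcoact x1)
    (((1 : A) ⊗ y) ⊗ ((1 * b) ⊗ x2) : H ⊗ H)).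
  by have cl := crossed_coact_linear (bh_crossed hL); lin.
rewrite tliftDr // !tlift_pure // !(theta_proj_coact coact_theta).
rewrite !tlift_tmap; [|by lin..].
rewrite sw_tcoact_tin; last by lin.
rewrite coact_theta tlift_pure; last by lin.
rewrite sw_tcoact1; last by lin.
by rewrite mulr1.
Qed.

Let sH : is_super_hopf H := boson_super_hopf hL.
Let bH := sh_bialgebra sH.

(** The counit of Λ_θ splits the inclusion of A, which gives its injectivity. *)
Let inc_one (a : A) : (\sw_(b, y <- (a ⊗ (sone : L) : H)) (scou y *: b)) = a.
Proof. by rewrite tlift_pure ?(gb_cou1 bL) ?scale1r //; lin. Qed.

Lemma Lambda_deg0 (y : L) : sdeg 0 y -> exists c, y = c *: (sone : L).
Proof.
move=> [x dx ->]; suff [c ->] : exists c, x = c *: 1 by exists c; rewrite (linZ lp).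
move: x dx; apply: lspan_min.
  split; first by exists 0; rewrite scale0r.
  by move=> c _ _ [a ->] [b ->]; exists (c * a + b); rewrite scalerDl scalerA.
by move=> _ [[|//] _ ->]; exists 1; rewrite big_nil scale1r.
Qed.

Lemma Omega_theta_strongly_bicovariant : is_strongly_bicovariant (Omega_theta θ).
Proof.
split.
- exact: sH.
- by rewrite /=; lin.
- by move=> a b /= eab; rewrite -(inc_one a) eab inc_one.
- move=> t; split=> [|[a ->]]; last by apply: boson_deg_pure; apply: (gb_one_deg bL).
  move: t; apply: boson_deg_ind.
    split; first by exists 0; rewrite /= pure0l.
    by move=> c _ _ [a ->] [b ->]; exists (c *: a + b); rewrite /= pureDl pureZl.
  by move=> a x /Lambda_deg0 [c ->]; exists (c *: a); rewrite /= pureZl pureZr.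
- by move=> a b; rewrite [RHS](hmul_pureA hL).
- by [].
- move=> a; rewrite -[LHS]tlift_pureE (sw_Hcop hL); last by lin.
  apply: eq_tlift => a1 a2; rewrite (gb_cop1 bL) tlift_pure; last first.
    by have cl := crossed_coact_linear (bh_crossed hL); lin.
  by rewrite (bh_one_coact hL) tlift_pure ?mulr1 //; lin.
- by move=> a; rewrite [LHS](boson_cou_pure hL) (gb_cou1 bL) mulr1.
- exact: (@super_bracket_linear K H Θ bH).
- move=> n x; exact: (@super_bracket_deg K H Θ bH Omega_theta_deg n x).
- move=> x; rewrite [LHS](super_bracket_sq bH Omega_theta_deg).
  by rewrite Omega_theta_sq_central subrr.
- move=> n x y; exact: (@super_bracket_leibniz K H Θ bH n x y).
- exact: (@super_bracket_coleibniz K H Θ bH Omega_theta_deg Omega_theta_prim).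
Qed.

Lemma Omega_theta_inner : inner_by (Θ : Omega_theta θ).
Proof. by split; first exact: Omega_theta_deg. Qed.

End OmegaTheta.

(** * Left-invariant forms *)

(* As for hantiM, both sides are convolution inverse to the coproduct. *)
Lemma sw_hanti_cop (K : fieldType) (A : hopfAlg K) (U : lmodType K)
    (F : A -> A -> U) a : bilinear F ->
  tlift F (hcop (hanti a)) = \sw_(a1, a2 <- hcop a) F (hanti a2) (hanti a1).
Proof.
move=> bF.
transitivity (\sw_(a1, a' <- hcop a) \sw_(c1, c2 <- hcop (hanti a1))
   \sw_(b, d <- hcop a') \sw_(b1, b2 <- hcop b) \sw_(d1, d2 <- hcop d)
   F (c1 * b1 * hanti d2) (c2 * b2 * hanti d1)).
  rewrite -(sw_counitr (F := fun a => tlift F (hcop (hanti a)))); last by lin.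
  apply: eq_tlift => a1 a'; rewrite -tliftZ; apply: eq_tlift => c1 c2.
  symmetry; rewrite sw_coassoc; [|by lin..].
  transitivity (\sw_(b1, d2 <- hcop a') F (c1 * (b1 * hanti d2)) c2); last first.
    by rewrite (sw_hantir (F := fun t => F (c1 * t) c2)) ?mulr1 //; lin.
  apply: eq_tlift => b1 e; rewrite -sw_coassoc; [|by lin..].
  rewrite -(sw_counitl (F := fun d2 => F (c1 * (b1 * hanti d2)) c2)); last by lin.
  apply: eq_tlift => f d2; rewrite mulrA.
  transitivity (\sw_(b2, d1 <- hcop f) F (c1 * b1 * hanti d2) (c2 * (b2 * hanti d1))).
    by apply: eq_tlift => b2 d1; rewrite mulrA.
  by rewrite (sw_hantir (F := fun t => F (c1 * b1 * hanti d2) (c2 * t))) ?mulr1 //; lin.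
transitivity (\sw_(a1, a' <- hcop a) \sw_(b, d <- hcop a') \sw_(c1, c2 <- hcop (hanti a1))
   \sw_(b1, b2 <- hcop b) \sw_(d1, d2 <- hcop d)
   F (c1 * b1 * hanti d2) (c2 * b2 * hanti d1)).
  by apply: eq_tlift => a1 a'; rewrite tlift_exch.
rewrite -sw_coassoc; [|by lin..].
rewrite -(sw_counitl (F := fun d => \sw_(d1, d2 <- hcop d) F (hanti d2) (hanti d1)));
  last by lin.
apply: eq_tlift => g d.
transitivity (\sw_(a1, b <- hcop g) tlift (fun u v => \sw_(d1, d2 <- hcop d)
   F (u * hanti d2) (v * hanti d1)) (hcop (hanti a1 * b))).
  by apply: eq_tlift => a1 b; rewrite sw_hcopM //; lin.
rewrite (sw_hantil (F := fun t => tlift (fun u v => \sw_(d1, d2 <- hcop d)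
   F (u * hanti d2) (v * hanti d1)) (hcop t))); last by lin.
rewrite sw_hcop1; last by lin.
by congr (_ *: _); apply: eq_tlift => d1 d2; rewrite !mul1r.
Qed.

(** * The projection Π to degree 0 and the projection P to left-invariant elements *)

Section Bicovariant.
Variables (K : fieldType) (A : hopfAlg K) (X : extData A).
Hypothesis hX : is_strongly_bicovariant X.
Local Notation G := (@sdeg K X).
Local Notation "x ∙ y" := (@smul K X x y) (at level 39, left associativity).
Local Notation inc := (@einc K A X).
Local Notation Π := (@deg0_part K A X).
Local Notation Δ := (@scop K X).
Local Notation tw := (twist G).
Let bX : is_graded_bialgebra (super_flip G) := sh_bialgebra (sb_super_hopf hX).
Let gG : is_grading G := gb_grading bX.
Let mulb : bilinear (@smul K X) := gb_mul_bilinear bX.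
Let copl : linear Δ := gb_cop_linear bX.
Let coul : scalar (@scou K X) := gb_cou_linear bX.
Let incl : linear inc := sb_inc_linear hX.
#[local] Hint Resolve mulb copl coul incl : linh.

Lemma deg0_partE x : inc (Π x) = gcomp G 0 x.
Proof.
rewrite -(components0 gG); apply: (@xgetPex _ 0 [set a | inc a = (components G x)`_0]).
have := gcomp_deg gG 0 x; rewrite -(components0 gG).
by move=> /(sb_inc_image hX) [a ->]; exists a.
Qed.

Lemma deg0_part_linear : linear Π.
Proof.
move=> c x y; apply: (sb_inc_inj hX); rewrite incl !deg0_partE.
exact: gcomp_linear.
Qed.
Let Πl := deg0_part_linear.
#[local] Hint Resolve Πl : linh.

Lemma deg0_part_inc a : Π (inc a) = a.
Proof.
apply: (sb_inc_inj hX); rewrite deg0_partE.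
have Ga : G 0%N (inc a) by apply/(sb_inc_image hX); exists a.
by rewrite (gcomp_hom gG _ Ga).
Qed.

Lemma deg0_part_pos n x : G n.+1 x -> Π x = 0.
Proof.
move=> Gx; apply: (sb_inc_inj hX).
by rewrite deg0_partE (gcomp_hom gG _ Gx) (lin0 incl).
Qed.

Lemma deg0_part_mul x y : Π (x ∙ y) = Π x * Π y.
Proof.
move: x; apply: (hom_eq gG) => [||m x Gx]; [by lin | by lin |].
move: y; apply: (hom_eq gG) => [||n y Gy]; [by lin | by lin |].
have Gxy := gb_mul_deg bX Gx Gy.
case: m Gx Gxy => [|m] Gx Gxy; last first.
  by rewrite (deg0_part_pos Gx) (deg0_part_pos Gxy) mul0r.
case: n Gy Gxy => [|n] Gy Gxy; last first.
  by rewrite (deg0_part_pos Gy) (deg0_part_pos Gxy) mulr0.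
move/(sb_inc_image hX): Gx => [a ->]; move/(sb_inc_image hX): Gy => [b ->].
by rewrite -(sb_incM hX) !deg0_part_inc.
Qed.

Lemma deg0_part_tw k x : Π (tw k x) = Π x.
Proof.
have twl : linear (tw k) := twist_linear gG k.
move: x; apply: (hom_eq gG) => [||m x Gx]; [by lin | by lin |].
rewrite (twist_hom gG k Gx) (linZ Πl); case: m Gx => [|m] Gx.
  by rewrite muln0 scale1r.
by rewrite (deg0_part_pos Gx) scaler0.
Qed.

Lemma scop_span n x : G n x -> lspan [set t : X ⊗ X | exists i j (y z : X),
  [/\ (i + j)%N = n, G i y, G j z & t = y ⊗ z]] (Δ x).
Proof. exact: gb_cop_deg bX n x. Qed.

(** In positive degree every term of Δx has a leg of positive degree, which Π kills. So Π is a
    coalgebra map, and with [deg0_part_mul] a bialgebra map onto A. *)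
Lemma sw_deg0_cop (U : lmodType K) (F : A -> A -> U) x : bilinear F ->
  \sw_(x1, x2 <- Δ x) F (Π x1) (Π x2) = tlift F (hcop (Π x)).
Proof.
move=> bF; move: x; apply: (hom_eq gG) => [||n x Gx]; [by lin | by lin |].
case: n Gx => [|n] Gx.
  move/(sb_inc_image hX): Gx => [a ->].
  rewrite (sb_inc_cop hX) tlift_tmap; [|by lin..].
  by rewrite deg0_part_inc; apply: eq_tlift => a1 a2; rewrite !deg0_part_inc.
rewrite (deg0_part_pos Gx) (lin0 (@hcop_linear K A)) tlift_0 //.
have l0 : linear (tlift (fun x1 x2 => F (Π x1) (Π x2))) by lin.
move: (Δ x) (scop_span Gx); apply: (lspan_min (ker_subspace l0)).
move=> _ [[|i] [j [y [z [ij dy dz ->]]]]] /=; rewrite tlift_pure; [|by lin| |by lin].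
  move: dz; rewrite -[j]add0n ij => dz.
  by rewrite (deg0_part_pos dz) (lin0 (lin_bil2 _ bF)).
by rewrite (deg0_part_pos dy) (lin0 (lin_bil1 _ bF)).
Qed.

Lemma scou_deg0 x : scou x = hcou (Π x).
Proof.
have cl : scalar (@hcou K A) := @hcou_scalar K A.
move: x; apply: (hom_eq gG (U := K^o) (g := fun x => hcou (Π x) : K^o)) => [||n x Gx].
- exact: coul.
- exact: (scalar_comp cl Πl).
case: n Gx => [|n] Gx.
  by move/(sb_inc_image hX): Gx => [a ->]; rewrite deg0_part_inc (sb_inc_cou hX).
rewrite (deg0_part_pos Gx) (gb_cou_deg bX Gx).
by rewrite (lin0 (scalar_linear cl)).
Qed.

Lemma sw_scoassoc (U : lmodType K) (F : X -> X -> X -> U) x :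
  (forall y z, linear (fun x => F x y z)) ->
  (forall x z, linear (fun y => F x y z)) -> (forall x y, linear (F x y)) ->
  \sw_(x1, z <- Δ x) (\sw_(x11, y <- Δ x1) F x11 y z) =
  \sw_(x1, y <- Δ x) (\sw_(y1, z <- Δ y) F x1 y1 z).
Proof.
move=> F1 F2 F3.
pose R u t := tlift (fun y z => F u y z) t.
have bR : bilinear R by rewrite /R; lin.
have := congr1 (tlift R) (gb_coassoc bX x).
rewrite !tlift_tlift // => h.
transitivity (\sw_(x1, z <- Δ x) tlift R (\sw_(x11, y <- Δ x1) x11 ⊗ (y ⊗ z))).
  apply: eq_tlift => x1 z; rewrite tlift_tlift //; apply: eq_tlift => x11 y.
  by rewrite tlift_pure // /R tlift_pure //; lin.
by rewrite h; apply: eq_tlift => x1 y; rewrite tlift_pure.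
Qed.

Lemma sw_scounitl (U : lmodType K) (F : X -> U) x : linear F ->
  \sw_(x1, x2 <- Δ x) (hcou (Π x1) *: F x2) = F x.
Proof.
move=> lF; rewrite -[in RHS](gb_counitl bX x) -tlift_map //.
by apply: eq_tlift => x1 x2; rewrite linZ // scou_deg0.
Qed.

Lemma sw_scounitr (U : lmodType K) (F : X -> U) x : linear F ->
  \sw_(x1, x2 <- Δ x) (hcou (Π x2) *: F x1) = F x.
Proof.
move=> lF; rewrite -[in RHS](gb_counitr bX x) -tlift_map //.
by apply: eq_tlift => x1 x2; rewrite linZ // scou_deg0.
Qed.

Let flipb : bilinear (super_flip G) := super_flip_bilinear gG.
#[local] Hint Resolve flipb : linh.
Local Notation BM := (braided_mul (@smul K X) (super_flip G)).
Let BMb : bilinear BM := braided_mul_bilinear mulb flipb.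
#[local] Hint Resolve BMb : linh.

(* Π kills positive degrees, so the signs in the product of X ⊗ X disappear. *)
Lemma sw_left_coactM (U : lmodType K) (F : A -> X -> U) x y : bilinear F ->
  \sw_(z1, z2 <- Δ (x ∙ y)) F (Π z1) z2 =
  \sw_(x1, x2 <- Δ x) \sw_(y1, y2 <- Δ y) F (Π x1 * Π y1) (x2 ∙ y2).
Proof.
move=> bF; rewrite (gb_copM bX).
move: (Δ x); apply: tens_eq => [||x1 x2]; [by lin | by lin |].
move: x2; apply: (hom_eq gG) => [||k x2 Gx2]; [by lin | by lin |].
move: (Δ y); apply: tens_eq => [||y1 y2]; [by lin | by lin |].
rewrite (flip_mul_hom bX _ _ _ Gx2) !tlift_pure; [|by lin..].
by rewrite deg0_part_mul deg0_part_tw.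
Qed.

Lemma sw_right_coactM (U : lmodType K) (F : X -> A -> U) x y : bilinear F ->
  \sw_(z1, z2 <- Δ (x ∙ y)) F z1 (Π z2) =
  \sw_(x1, x2 <- Δ x) \sw_(y1, y2 <- Δ y) F (x1 ∙ y1) (Π x2 * Π y2).
Proof.
move=> bF; rewrite (gb_copM bX).
move: (Δ x); apply: tens_eq => [||x1 x2]; [by lin | by lin |].
move: x2; apply: (hom_eq gG) => [||k x2 Gx2]; [by lin | by lin |].
move: (Δ y); apply: tens_eq => [||y1 y2]; [by lin | by lin |].
rewrite (flip_mul_hom bX _ _ _ Gx2) !tlift_pure; [|by lin..].
rewrite deg0_part_mul; case: k Gx2 => [|k] Gx2; first by rewrite (twist0 gG).
by rewrite (deg0_part_pos Gx2) mul0r !(lin0 (lin_bil2 _ bF)).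
Qed.

Lemma sw_scop_inc (U : lmodType K) (F : X -> X -> U) a : bilinear F ->
  tlift F (Δ (inc a)) = \sw_(a1, a2 <- hcop a) F (inc a1) (inc a2).
Proof. by move=> bF; rewrite (sb_inc_cop hX) tlift_tmap //; lin. Qed.

Definition left_inv_proj (x : X) : X := \sw_(x1, x2 <- Δ x) (inc (hanti (Π x1)) ∙ x2).
Local Notation P := left_inv_proj.

Lemma left_inv_proj_linear : linear P.
Proof. by rewrite /P; lin. Qed.
Let Pl := left_inv_proj_linear.
#[local] Hint Resolve Pl : linh.

Lemma left_inv_proj_incM a x : P (inc a ∙ x) = hcou a *: P x.
Proof.
rewrite /P (sw_left_coactM (F := fun b y => inc (hanti b) ∙ y)); last by lin.
rewrite sw_scop_inc; last by lin.
transitivity (\sw_(x1, x2 <- Δ x) \sw_(a1, a2 <- hcop a)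
   (inc (hanti (Π x1) * (hanti a1 * a2)) ∙ x2)).
  rewrite tlift_exch; apply: eq_tlift => x1 x2; apply: eq_tlift => a1 a2.
  by rewrite deg0_part_inc hantiM !(sb_incM hX) !(gb_mulA bX).
rewrite -tliftZ; apply: eq_tlift => x1 x2.
by rewrite (sw_hantil (F := fun t => inc (hanti (Π x1) * t) ∙ x2)) ?mulr1 //; lin.
Qed.

(** One half of the fundamental theorem of Hopf modules: the leg in front cancels the antipode
    inside P. Thus X is spanned by the products of A with the image of P. *)
Lemma left_inv_proj_sum x : \sw_(x1, x2 <- Δ x) (inc (Π x1) ∙ P x2) = x.
Proof.
transitivity (\sw_(x1, y <- Δ x) \sw_(y1, z <- Δ y)
   (inc (Π x1 * hanti (Π y1)) ∙ z)).
  apply: eq_tlift => x1 y; rewrite -(tlift_map (f := smul _)); last by lin.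
  by apply: eq_tlift => y1 z; rewrite (sb_incM hX) (gb_mulA bX).
rewrite -sw_scoassoc; [|by lin..].
rewrite -[RHS](sw_scounitl (F := id)); last by lin.
apply: eq_tlift => x1 z.
rewrite (sw_deg0_cop (F := fun a b => inc (a * hanti b) ∙ z)); last by lin.
rewrite (sw_hantir (F := fun t => inc t ∙ z)); last by lin.
by rewrite (sb_inc1 hX) (gb_mul1x bX).
Qed.

(** Write x by [left_inv_proj_sum]: P replaces the leading factor from A by its counit. This makes v
    ◁ a = P(v a) an action. *)
Lemma left_inv_proj_mul x a : P (x ∙ inc a) = P (P x ∙ inc a).
Proof.
rewrite -{1}(left_inv_proj_sum x) -(tlift_map (f := fun z => z ∙ inc a)); last by lin.
rewrite -(tlift_map _ _ Pl).
rewrite -(sw_scounitl (F := fun x => P (P x ∙ inc a))); last by lin.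
by apply: eq_tlift => x1 x2; rewrite -(gb_mulA bX) left_inv_proj_incM.
Qed.

(** Since S reverses coproducts, the left leg of P(x) is S of the second half of x_{-1} times the
    next left leg of x; the two are adjacent and cancel. *)
Lemma left_inv_projP (U : lmodType K) (F : A -> X -> U) x : bilinear F ->
  \sw_(z1, z2 <- Δ (P x)) F (Π z1) z2 = F 1 (P x).
Proof.
move=> bF; rewrite {1}/P -(tlift_map _ _ copl) tlift_tlift; last by lin.
transitivity (\sw_(x1, y <- Δ x) \sw_(u, z <- Δ y) \sw_(a1, a2 <- hcop (Π x1))
    F (hanti a2 * Π u) (inc (hanti a1) ∙ z)).
  apply: eq_tlift => x1 y; rewrite sw_left_coactM //.
  rewrite sw_scop_inc; last by lin.
  rewrite (sw_hanti_cop (F := fun c1 c2 => \sw_(y1, y2 <- Δ y)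
    F (Π (inc c1) * Π y1) (inc c2 ∙ y2))); last by lin.
  rewrite tlift_exch; apply: eq_tlift => u z; apply: eq_tlift => a1 a2.
  by rewrite deg0_part_inc.
transitivity (\sw_(x1, y <- Δ x) \sw_(u, z <- Δ y) \sw_(w1, w2 <- Δ x1)
    F (hanti (Π w2) * Π u) (inc (hanti (Π w1)) ∙ z)).
  apply: eq_tlift => x1 y; apply: eq_tlift => u z.
  by rewrite (sw_deg0_cop (F := fun a1 a2 => F (hanti a2 * Π u) (inc (hanti a1) ∙ z))) //; lin.
transitivity (\sw_(x1, y <- Δ x) \sw_(w1, w2 <- Δ x1) \sw_(u, z <- Δ y)
    F (hanti (Π w2) * Π u) (inc (hanti (Π w1)) ∙ z)).
  by apply: eq_tlift => x1 y; rewrite tlift_exch.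
rewrite sw_scoassoc; [|by lin..].
rewrite -[P x in RHS]/(\sw_(x1, x2 <- Δ x) (inc (hanti (Π x1)) ∙ x2)).
rewrite -(tlift_map (f := F 1)); last by lin.
apply: eq_tlift => w1 y; rewrite -sw_scoassoc; [|by lin..].
rewrite -(sw_scounitl (F := fun z => F 1 (inc (hanti (Π w1)) ∙ z))); last by lin.
apply: eq_tlift => t z.
rewrite (sw_deg0_cop (F := fun a b => F (hanti a * b) (inc (hanti (Π w1)) ∙ z))); last by lin.
by rewrite (sw_hantil (F := fun t => F t (inc (hanti (Π w1)) ∙ z))) //; lin.
Qed.

Lemma left_inv_proj_deg n x : G n x -> G n (P x).
Proof.
move=> Gx; rewrite /P; move: (Δ x) (scop_span Gx); apply: lspan_min.
  by apply: preim_subspace (grading_sub gG n); lin.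
move=> _ [[|i] [j [y [z [<- dy dz ->]]]]] /=; rewrite tlift_pure; [|by lin| |by lin].
  by apply: (gb_mul_deg bX) => //; apply/(sb_inc_image hX); exists (hanti (Π y)).
rewrite (deg0_part_pos dy) (lin0 (@hanti_linear K A)) (lin0 incl).
rewrite (lin0 (lin_bil1 z mulb)).
exact: subspace0 (grading_sub gG _).
Qed.

End Bicovariant.

(** * The crossed module of left-invariant 1-forms *)

Section LeftInvariants.
Variables (K : fieldType) (A : hopfAlg K) (X : extData A).
Hypothesis hX : is_strongly_bicovariant X.
Local Notation G := (@sdeg K X).
Local Notation "x ∙ y" := (@smul K X x y) (at level 39, left associativity).
Local Notation inc := (@einc K A X).
Local Notation Π := (@deg0_part K A X).
Local Notation Δ := (@scop K X).
Local Notation P := (@left_inv_proj K A X).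
Let bX : is_graded_bialgebra (super_flip G) := sh_bialgebra (sb_super_hopf hX).
Let gG : is_grading G := gb_grading bX.
Let mulb : bilinear (@smul K X) := gb_mul_bilinear bX.
Let copl : linear Δ := gb_cop_linear bX.
Let incl : linear inc := sb_inc_linear hX.
Let Πl : linear Π := deg0_part_linear hX.
Let Pl : linear P := left_inv_proj_linear hX.
Let g1l : linear (gcomp G 1) := gcomp_linear gG 1.
#[local] Hint Resolve mulb copl incl Πl Pl g1l : linh.

Definition linv1 : set X := [set v | G 1%N v /\ left_invariant v].

Lemma linv1_subspace : is_subspace linv1.
Proof.
have s1 := grading_sub gG 1.
have sL : is_subspace [set v : X | tmap Π id (Δ v) = 1 ⊗ v].
  by apply: eq_linear_subspace; lin.
split; first by split; [apply: subspace0 s1 | apply: subspace0 sL].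
by move=> c x y [dx ix] [dy iy]; split; [apply: (subspaceP s1) | apply: (subspaceP sL)].
Qed.

Lemma sw_linv1 (U : lmodType K) (F : A -> X -> U) v : linv1 v -> bilinear F ->
  \sw_(z1, z2 <- Δ v) F (Π z1) z2 = F 1 v.
Proof.
move=> [_ iv] bF; have := congr1 (tlift F) iv.
by rewrite tlift_tmap ?tlift_pure //; lin.
Qed.

Lemma left_inv_proj_id v : linv1 v -> P v = v.
Proof.
move=> iv; rewrite /left_inv_proj (sw_linv1 (F := fun a x => inc (hanti a) ∙ x)) //.
  by rewrite hanti1 (sb_inc1 hX) (gb_mul1x bX).
by lin.
Qed.

(** Passing to the degree 1 component first gives a map defined on all of X with values in
    [linv1]. *)
Let proj1 x := P (gcomp G 1 x).

Let proj1_linv x : linv1 (proj1 x).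
Proof.
split; first by apply: left_inv_proj_deg => //; apply: gcomp_deg.
by rewrite /left_invariant /tmap (left_inv_projP hX (F := @pure K A X)) //; lin.
Qed.

(** The right coaction preserves left-invariant 1-forms. Where the second leg has degree 0 the first
    has degree 1, so [gcomp] changes nothing; coassociativity then lets P see the left coaction of v
    itself, which is trivial. *)
Lemma sw_linv1_right (U : lmodType K) (F : X -> A -> U) v : linv1 v -> bilinear F ->
  \sw_(x1, x2 <- Δ v) F (P (gcomp G 1 x1)) (Π x2) = \sw_(x1, x2 <- Δ v) F x1 (Π x2).
Proof.
move=> iv bF; transitivity (\sw_(x1, x2 <- Δ v) F (P x1) (Π x2)).
  have l1 : linear (tlift (fun x1 x2 => F (P (gcomp G 1 x1)) (Π x2))) by lin.
  have l2 : linear (tlift (fun x1 x2 => F (P x1) (Π x2))) by lin.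
  move: (Δ v) (scop_span hX iv.1); apply: (lspan_min (eq_linear_subspace l1 l2)).
  move=> _ [i [[|j] [y [z [ij dy dz ->]]]]] /=; rewrite !tlift_pure; [|by lin|by lin| |by lin|by lin].
    by move: dy ij; rewrite addn0 => dy i1; rewrite (gcomp_hom gG _ dy) i1.
  by rewrite (deg0_part_pos hX dz) !(lin0 (lin_bil2 _ bF)).
transitivity (\sw_(x1, x2 <- Δ v) \sw_(w1, w2 <- Δ x1)
   F (inc (hanti (Π w1)) ∙ w2) (Π x2)).
  apply: eq_tlift => x1 x2.
  by rewrite (tlift_map (f := F^~ (Π x2))) //; lin.
rewrite (sw_scoassoc hX (F := fun w1 w2 x2 => F (inc (hanti (Π w1)) ∙ w2) (Π x2)));
  [|by lin..].
rewrite (sw_linv1 (F := fun a y => \sw_(y1, y2 <- Δ y) F (inc (hanti a) ∙ y1) (Π y2))) //;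
  last by lin.
by rewrite hanti1 (sb_inc1 hX); apply: eq_tlift => y1 y2; rewrite (gb_mul1x bX).
Qed.

Definition linv_mod : lmodType K := subsp linv1_subspace.
Local Notation Vm := linv_mod.
Definition linv_val (v : Vm) : X := sval_subsp (v : subsp linv1_subspace).
Local Notation val := linv_val.
Definition linv_proj (x : X) : Vm := Subsp linv1_subspace (proj1_linv x).
Local Notation PV := linv_proj.

Lemma linv_valP v : linv1 (val v).
Proof. exact: (subsp_mem (v : subsp linv1_subspace)). Qed.

Lemma linv_val_inj : injective val.
Proof. exact: subsp_inj. Qed.

Lemma linv_val_linear : linear val.
Proof. by []. Qed.

Lemma linv_proj_val x : val (PV x) = P (gcomp G 1 x).
Proof. by []. Qed.

Lemma linv_valK v : PV (val v) = v.
Proof.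
apply: linv_val_inj; rewrite linv_proj_val (gcomp_hom gG _ (linv_valP v).1).
by rewrite left_inv_proj_id //; apply: linv_valP.
Qed.

Lemma linv_proj_linear : linear PV.
Proof. by move=> c x y; apply: linv_val_inj; rewrite linv_val_linear !linv_proj_val g1l Pl. Qed.
Let vall : linear val := linv_val_linear.
Let PVl : linear PV := linv_proj_linear.
#[local] Hint Resolve vall PVl : linh.

(** The inclusion of V is split by [linv_proj], and so is its tensor product with U; identities in V
    ⊗ U can therefore be checked in X ⊗ U. *)
Lemma linv_tens_inj (U : lmodType K) : injective (tmap val (id : U -> U)).
Proof.
apply: (can_inj (g := tmap PV (id : U -> U))); apply: tens_eq => [||v u].
- by apply: (lin_comp (g := tmap PV id)); lin.
- exact: lin_id.
by rewrite !tmap_pure ?linv_valK //; lin.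
Qed.

(** The right adjoint action: the left coaction of v a is a_1 ⊗ v a_2 for left-invariant v, so P(v
    a) = S(a_1) v a_2. *)
Definition linv_act (v : Vm) (a : A) : Vm := PV (val v ∙ inc a).
Definition linv_coact (v : Vm) : Vm ⊗ A := tmap PV Π (Δ (val v)).

Lemma linv_act_val v a : val (linv_act v a) = P (val v ∙ inc a).
Proof.
have d1 : G 1%N (val v ∙ inc a).
  apply: (gb_mul_deg bX (i := 1) (j := 0)); first exact: (linv_valP v).1.
  by apply/(sb_inc_image hX); exists a.
by rewrite linv_proj_val (gcomp_hom gG _ d1).
Qed.

Lemma linv_act_bilinear : bilinear linv_act.
Proof. by rewrite /linv_act; lin. Qed.

Lemma linv_coact_linear : linear linv_coact.
Proof. by rewrite /linv_coact; lin. Qed.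
Let vactb := linv_act_bilinear.
Let vcoactl := linv_coact_linear.
#[local] Hint Resolve vactb vcoactl : linh.

Lemma sw_linv_coact (U : lmodType K) (F : X -> A -> U) v : bilinear F ->
  \sw_(w, a <- linv_coact v) F (val w) a = \sw_(x1, x2 <- Δ (val v)) F x1 (Π x2).
Proof.
move=> bF; rewrite tlift_tmap; [|by lin..].
exact: sw_linv1_right (linv_valP v) bF.
Qed.

(** [left_inv_proj_sum] applied to v a. It is the commutation rule of A # Λ, now holding inside
    X. *)
Lemma linv_mul_inc (v : Vm) a :
  val v ∙ inc a = \sw_(a1, a2 <- hcop a) (inc a1 ∙ val (linv_act v a2)).
Proof.
rewrite -[LHS](left_inv_proj_sum hX).
rewrite (sw_left_coactM hX (F := fun b x => inc b ∙ P x)); last by lin.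
rewrite (sw_linv1 (F := fun b x => \sw_(y1, y2 <- Δ (inc a))
   (inc (b * Π y1) ∙ P (x ∙ y2))) (linv_valP v)); last by lin.
rewrite sw_scop_inc //; last by lin.
by apply: eq_tlift => a1 a2; rewrite mul1r deg0_part_inc // linv_act_val.
Qed.

(* Both sides are P ⊗ id of the right coaction of v a = a_1 (v ◁ a_2). *)
Lemma linv_crossed (v : Vm) a :
  \sw_(a1, a2 <- hcop a) (\sw_(w, b <- linv_coact (linv_act v a2)) w ⊗ (a1 * b)) =
  \sw_(w, b <- linv_coact v) \sw_(a1, a2 <- hcop a) linv_act w a1 ⊗ (b * a2).
Proof.
apply: (@linv_tens_inj A).
have lvi : linear (tmap val (id : A -> A)) by lin.
rewrite -!(tlift_map _ _ lvi).
transitivity (\sw_(x1, x2 <- Δ (val v ∙ inc a)) P x1 ⊗ Π x2); last first.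
  rewrite (sw_right_coactM hX (F := fun x b => P x ⊗ b)); last by lin.
  rewrite -(sw_linv_coact (F := fun y1 y2 => \sw_(a1, a2 <- Δ (inc a))
     P (y1 ∙ a1) ⊗ (y2 * Π a2))); last by lin.
  apply: eq_tlift => w b; rewrite sw_scop_inc //; last by lin.
  rewrite -(tlift_map _ _ lvi); apply: eq_tlift => a1 a2.
  by rewrite tmap_pure ?linv_act_val ?deg0_part_inc //; lin.
rewrite linv_mul_inc.
rewrite -(tlift_map _ _ copl) tlift_tlift; last by lin.
apply: eq_tlift => a1 a2; rewrite -(tlift_map _ _ lvi).
rewrite (sw_right_coactM hX (F := fun x b => P x ⊗ b)); last by lin.
rewrite sw_scop_inc //; last by lin.
transitivity (\sw_(y1, y2 <- Δ (val (linv_act v a2))) (P y1 ⊗ (a1 * Π y2))).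
  rewrite -(sw_linv_coact (F := fun x b => P x ⊗ (a1 * b))); last by lin.
  apply: eq_tlift => w b; rewrite tmap_pure; [|by lin..].
  by rewrite left_inv_proj_id //; apply: linv_valP.
rewrite tlift_exch; apply: eq_tlift => y1 y2.
rewrite -(sw_counitl (F := fun b => P y1 ⊗ (b * Π y2))); last by lin.
apply: eq_tlift => b1 b2; rewrite deg0_part_inc // left_inv_proj_incM //.
by rewrite pureZl.
Qed.

Lemma linv_module_crossed : is_crossed linv_act linv_coact.
Proof.
split.
- exact: vactb.
- move=> v; apply: linv_val_inj; rewrite linv_act_val (sb_inc1 hX) (gb_mulx1 bX).
  by apply: left_inv_proj_id; apply: linv_valP.
- move=> v a b; apply: linv_val_inj; rewrite !linv_act_val (sb_incM hX) (gb_mulA bX).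
  exact: left_inv_proj_mul.
- exact: vcoactl.
- move=> v; apply: linv_tens_inj.
  have lvi : linear (tmap val (id : A ⊗ A -> A ⊗ A)) by lin.
  rewrite -!(tlift_map _ _ lvi).
  transitivity (\sw_(w, a <- linv_coact v) \sw_(x1, x2 <- Δ (val w))
      x1 ⊗ (Π x2 ⊗ a)).
    apply: eq_tlift => w a; rewrite -(tlift_map _ _ lvi).
    rewrite -(sw_linv_coact (F := fun x b => x ⊗ (b ⊗ a))); last by lin.
    by apply: eq_tlift => u b; rewrite tmap_pure //; lin.
  rewrite (sw_linv_coact (F := fun y a => \sw_(x1, x2 <- Δ y) x1 ⊗ (Π x2 ⊗ a)));
    last by lin.
  rewrite (sw_scoassoc hX (F := fun x1 x2 y => x1 ⊗ (Π x2 ⊗ Π y))); [|by lin..].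
  transitivity (\sw_(w, a <- linv_coact v) val w ⊗ hcop a); last first.
    by apply: eq_tlift => w a; rewrite tmap_pure //; lin.
  rewrite (sw_linv_coact (F := fun x a => x ⊗ hcop a)); last by lin.
  apply: eq_tlift => x1 y; rewrite -[hcop _]tlift_pureE.
  rewrite -(sw_deg0_cop hX (F := @pure K A A)); last by lin.
  by rewrite -(tlift_map (f := pure x1)) //; lin.
- move=> v; apply: linv_val_inj; rewrite -(tlift_map _ _ vall).
  transitivity (\sw_(w, a <- linv_coact v) (hcou a *: val w)).
    by apply: eq_tlift => w a; rewrite (linZ vall).
  rewrite (sw_linv_coact (F := fun x a => hcou a *: x)); last by lin.
  by rewrite (sw_scounitr hX (F := id)) //; lin.
move=> v a; apply: crossed_compat_of => //; exact: linv_crossed.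
Qed.

Definition linv_crossedMod : crossedMod A := CrossedMod linv_module_crossed.

End LeftInvariants.

(** * The universal property of the inner calculus *)

Section QuotientByKernel.
Variables (K : fieldType) (A : hopfAlg K) (X Y : extData A) (f : X -> Y).
Hypotheses (gX : is_grading (@sdeg K X)) (gY : is_grading (@sdeg K Y)).
Hypotheses (hf : is_ext_morph f) (f_surj : forall y, exists x, y = f x).

(** With I the kernel of f, classes are separated by f ([pE]). This shows both that the operations
    on representatives make [p] a morphism and that an arbitrary section of f induces the
    isomorphism. *)
Lemma iso_to_quotient_by_kernel : is_iso_to_quotient_of Y X.
Proof.
have [fl fM f1 fcop fcou fdeg] := em_super hf.
pose I := [set x : X | f x = 0]; exists I.
pose p : X -> ext_quot I := proj I.
have pl : linear p := @proj_linear K X I.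
have sI : is_subspace I := ker_subspace fl.
have pE x x' : p x = p x' <-> f x = f x'.
  rewrite [p x = p x']projP; split=> [/(lspan_id sI)|fx].
    by rewrite /I /= (linB fl) => /eqP; rewrite subr_eq0 => /eqP.
  by apply: lspan_gen; rewrite /I /= (linB fl) fx subrr.
have pr x : p (repr x) = x by rewrite /p /proj reprK.
have fr x : f (repr (p x)) = f x by apply/pE; rewrite pr.
pose s y := xget 0 [set x | y = f x].
have sK y : f (s y) = y.
  have [x yx] := f_surj y; symmetry.
  by apply: (@xgetPex _ 0 [set x | y = f x]); exists x.
pose g y : ext_quot I := p (s y).
have gf x : g (f x) = p x by apply/pE; rewrite sK.
have gl : linear g.
  by move=> c y y'; rewrite -(sK y) -(sK y') -fl !gf pl.
have gff t : tmap g g (tmap f f t) = tmap p p t.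
  rewrite {1}/tmap tlift_tmap; [|by lin..].
  by apply: eq_tlift => x x'; rewrite !gf.
have pM x x' : p (smul x x') = smul (p x) (p x').
  by apply/esym/pE; rewrite !fM !fr.
have pcop x : scop (p x) = tmap p p (scop x).
  transitivity (tmap p p (scop (repr (p x)))); first by [].
  by rewrite -!gff -!fcop fr.
have pcou x : scou (p x) = scou x.
  transitivity (scou (repr (p x))); first by [].
  by rewrite -!fcou fr.
have pd x : p (ed x) = ed (p x).
  by apply/esym/pE; rewrite !(em_d hf) fr.
have hp : is_ext_morph p.
  split=> //; split=> //; by move=> n x dx; exists x.
split=> //; exists g; last first.
  exists (fun q => f (repr q)) => [y|q]; first by rewrite /g fr sK.
  by rewrite gf pr.
split; first split.
- exact: gl.
- by move=> y y'; rewrite -(sK y) -(sK y') -fM !gf pM.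
- by rewrite -f1 gf.
- by move=> y; rewrite -(sK y) fcop gff gf pcop.
- by move=> y; rewrite -(sK y) fcou gf pcou.
(* The chosen preimage of y need not be homogeneous, but its component of degree n has the same
   image, since f preserves degrees. *)
- move=> n y dy; exists (gcomp (@sdeg K X) n (s y)); first exact: gcomp_deg.
  apply/pE; have -> : f (gcomp (@sdeg K X) n (s y)) = gcomp (@sdeg K Y) n (f (s y)).
    move: (s y); apply: (hom_eq gX).
    + by apply: lin_comp => //; apply: gcomp_linear.
    + by apply: lin_comp => //; apply: gcomp_linear.
    move=> m x dx; rewrite (gcomp_hom gX _ dx) (gcomp_hom gY _ (fdeg _ _ dx)).
    by case: eqP => // _; apply: (lin0 fl).
  by rewrite sK (gcomp_hom gY _ dy) eqxx.
- by move=> a; rewrite -(em_inc hf) gf.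
by move=> y; rewrite -(sK y) -(em_d hf) !gf pd.
Qed.

End QuotientByKernel.

(** * The surjection from Ω_θ onto a given inner exterior algebra *)

Section InnerUniversal.
Variables (K : fieldType) (A : hopfAlg K) (X : extData A) (θ : X).
Hypothesis hX : is_strongly_bicovariant X.
Hypothesis iθ : inner_by θ.
Hypotheses (lθ : left_invariant θ) (rθ : right_invariant θ).
Hypothesis genX : generated_in_deg01 X.
Local Notation G := (@sdeg K X).
Local Notation "x ∙ y" := (@smul K X x y) (at level 39, left associativity).
Local Notation inc := (@einc K A X).
Local Notation Π := (@deg0_part K A X).
Local Notation Δ := (@scop K X).
Local Notation P := (@left_inv_proj K A X).
Local Notation V := (linv_crossedMod hX).
Local Notation val := (@linv_val K A X hX).
Local Notation T := (talg V).
Local Notation tact := (@talg_act K A V).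
Let bX : is_graded_bialgebra (super_flip G) := sh_bialgebra (sb_super_hopf hX).
Let gG : is_grading G := gb_grading bX.
Let mulb : bilinear (@smul K X) := gb_mul_bilinear bX.
Let copl : linear Δ := gb_cop_linear bX.
Let coul : scalar (@scou K X) := gb_cou_linear bX.
Let incl : linear inc := sb_inc_linear hX.
Let Πl : linear Π := deg0_part_linear hX.
Let Pl : linear P := left_inv_proj_linear hX.
Let vall : linear (val : V -> X) := @linv_val_linear K A X hX.
Let tactb : bilinear tact := @tact_bilinear K A V.
#[local] Hint Resolve mulb copl coul incl Πl Pl vall tactb : linh.

Definition linv_theta : V := Subsp (linv1_subspace hX) (conj iθ.1 lθ).
Local Notation θV := linv_theta.

Lemma linv_theta_coact : cmcoact θV = θV ⊗ 1.
Proof.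
apply: linv_tens_inj; rewrite tmap_pure; [|by lin..].
transitivity (\sw_(x1, x2 <- Δ (val θV)) x1 ⊗ Π x2); last exact: rθ.
exact: (sw_linv_coact (F := @pure K X A) θV (@pure_bilinear _ _ _)).
Qed.

Let step (v : V) (x : X) : X := val v ∙ x.
Let step_bilinear : bilinear step.
Proof. by rewrite /step; lin. Qed.

Definition word_map : T -> X := wfold step sone.
Local Notation φ := word_map.

Lemma word_map_linear : linear φ.
Proof. exact: (wfold_linear _ step_bilinear). Qed.
Let φl := word_map_linear.
#[local] Hint Resolve φl : linh.

Lemma word_map1 : φ 1 = sone.
Proof. exact: (wfold1 _ step_bilinear). Qed.

Lemma word_map_step v x : φ (tin v * x) = val v ∙ φ x.
Proof. exact: (wfoldM _ step_bilinear). Qed.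

Lemma word_map_tin v : φ (tin v) = val v.
Proof. by rewrite -[tin v]mulr1 word_map_step word_map1 (gb_mulx1 bX). Qed.

Lemma word_mapM x y : φ (x * y) = φ x ∙ φ y.
Proof.
move: x; apply: talg_eq => [|||v x IHx]; [by lin | by lin | |].
  by rewrite mul1r word_map1 (gb_mul1x bX).
by rewrite -mulrA !word_map_step IHx (gb_mulA bX).
Qed.

Lemma word_map_deg n x : talg_deg n x -> G n (φ x).
Proof.
move: n x; apply: (tdeg_ind (P := fun n => [set x | G n (φ x)])).
- by move=> n; apply: (preim_subspace φl); apply: grading_sub.
- by rewrite /= word_map1; apply: (gb_one_deg bX).
move=> n v x _ /= IH; rewrite word_map_step -add1n; apply: (gb_mul_deg bX) => //.
exact: (linv_valP v).1.
Qed.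

Lemma linv_actE (v : V) a :
  val v ∙ inc a = \sw_(a1, a2 <- hcop a) (inc a1 ∙ val (cmact v a2)).
Proof. exact: linv_mul_inc. Qed.

(** The commutation rule [linv_mul_inc] carried along a word letter by letter. It gives the
    relations for θ² ◁ a, and it is exactly what multiplicativity of a ⊗ y ↦ a φ(y) requires. *)
Lemma word_map_act x a : φ x ∙ inc a = \sw_(a1, a2 <- hcop a) (inc a1 ∙ φ (tact x a2)).
Proof.
move: x a; apply: talg_ind => [|a|v x IHx a].
- by apply: forall_subspace => a; apply: eq_linear_subspace; lin.
- rewrite word_map1 (gb_mul1x bX) -(sw_counitr (F := inc)); last by lin.
  apply: eq_tlift => a1 a2; rewrite tact1 (linZ φl) word_map1.
  by rewrite (linZ (lin_bil2 _ mulb)) (gb_mulx1 bX).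
have vactb : bilinear (@cmact K A V) := crossed_act_bilinear (crossedP V).
rewrite word_map_step -(gb_mulA bX) IHx -(tlift_map (f := smul _)); last by lin.
transitivity (\sw_(a1, a3 <- hcop a) \sw_(b1, b2 <- hcop a1)
   (inc b1 ∙ (val (cmact v b2) ∙ φ (tact x a3)))).
  apply: eq_tlift => a1 a3; rewrite (gb_mulA bX) linv_actE.
  rewrite -(tlift_map (f := fun z => z ∙ _)); last by lin.
  by apply: eq_tlift => b1 b2; rewrite (gb_mulA bX).
rewrite sw_coassoc; [|by lin..].
apply: eq_tlift => b1 a'; rewrite tactM -(tlift_map _ _ φl).
rewrite -(tlift_map (f := smul _)); last by lin.
by apply: eq_tlift => b2 a3; rewrite word_map_step.
Qed.

Local Notation θ2 := (tin θV * tin θV : T).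

Let word_map_theta2 : φ θ2 = θ ∙ θ.
Proof. by rewrite word_mapM word_map_tin. Qed.

Lemma theta_sq_central x : θ ∙ θ ∙ x = x ∙ (θ ∙ θ).
Proof.
have := sb_dd hX x; rewrite !iθ.2 (super_bracket_sq bX iθ.1).
by move=> /eqP; rewrite subr_eq0 => /eqP.
Qed.

Lemma word_map_theta_ideal x : theta_ideal θV x -> φ x = 0.
Proof.
move: x; apply: (theta_ideal_min (J := [set x | φ x = 0])) => [|a ea|η] /=.
- split; first exact: (ker_subspace φl).
    by move=> x y y0; change (φ (x * y) = 0); rewrite word_mapM y0 (lin0 (lin_bil2 _ mulb)).
  by move=> x y x0; change (φ (x * y) = 0); rewrite word_mapM x0 (lin0 (lin_bil1 _ mulb)).
- transitivity (\sw_(a1, a' <- hcop a) (inc (hanti a1) ∙ (φ θ2 ∙ inc a'))).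
    transitivity (\sw_(a1, a' <- hcop a) \sw_(a2, a3 <- hcop a')
       (inc (hanti a1 * a2) ∙ φ (tact θ2 a3))).
      rewrite -sw_coassoc; [|by lin..].
      rewrite -(sw_counitl (F := fun a => φ (tact θ2 a))); last by lin.
      apply: eq_tlift => b a3.
      rewrite (sw_hantil (F := fun t => inc t ∙ φ (tact θ2 a3))); last by lin.
      by rewrite (sb_inc1 hX) (gb_mul1x bX).
    apply: eq_tlift => a1 a'; rewrite word_map_act -(tlift_map (f := smul _)); last by lin.
    by apply: eq_tlift => a2 a3; rewrite (sb_incM hX) (gb_mulA bX).
  transitivity (\sw_(a1, a' <- hcop a) (inc (hanti a1 * a') ∙ (θ ∙ θ))).
    apply: eq_tlift => a1 a'.
    by rewrite word_map_theta2 theta_sq_central (sb_incM hX) (gb_mulA bX).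
  by rewrite (sw_hantil (F := fun t => inc t ∙ (θ ∙ θ))) ?ea ?scale0r //; lin.
rewrite (linB φl) !word_mapM word_map_tin theta_sq_central.
exact: subrr.
Qed.

Local Notation I := (theta_ideal θV).
Local Notation L := (Lambda_theta θV).
Local Notation p := (proj I : btalg V -> L).
Local Notation H := (boson L).
Local Notation Ω := (Omega_theta θV).
Let hΩ : is_strongly_bicovariant Ω := Omega_theta_strongly_bicovariant linv_theta_coact.
Let hL : is_braided_hopf L := Lambda_theta_braided_hopf linv_theta_coact.
Let bL := bh_bialgebra hL.
Let bH : is_graded_bialgebra (super_flip (@sdeg K H)) := sh_bialgebra (sb_super_hopf hΩ).
Let gH : is_grading (@sdeg K H) := gb_grading bH.
Let hmulb : bilinear (@boson_mul K A L) := hmul_bilinear hL.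
Let hcopl : linear (@boson_cop K A L) := Hcop_linear hL.
Let lp : linear p := @proj_linear K (btalg V) I.

Let ψ (y : L) : X := φ (repr y).

Let ψp x : ψ (p x) = φ x.
Proof.
apply/eqP; rewrite -subr_eq0 -(linB φl); apply/eqP; apply: word_map_theta_ideal.
by apply/theta_projP; rewrite /proj reprK.
Qed.

Let ψl : linear ψ.
Proof.
move=> c y z; have [x ->] := theta_proj_surj y; have [x' ->] := theta_proj_surj z.
by rewrite -(lp c x x') !ψp φl.
Qed.
#[local] Hint Resolve lp ψl hmulb hcopl : linh.

Definition Omega_map (t : Ω) : X := \sw_(a, y <- (t : A ⊗ L)) (inc a ∙ ψ y).
Local Notation Φ := Omega_map.

Lemma Omega_map_linear : linear Φ.
Proof. by rewrite /Φ; apply: tlift_linear; lin. Qed.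
Let Φl : linear (Φ : H -> X) := Omega_map_linear.
#[local] Hint Resolve Φl : linh.

Lemma Omega_map_pure a x : Φ ((a ⊗ p x) : H) = inc a ∙ φ x.
Proof. by rewrite /Φ tlift_pure ?ψp //; lin. Qed.

Let H_eq (U : lmodType K) (f g : H -> U) : linear f -> linear g ->
  (forall a x, f (a ⊗ p x) = g (a ⊗ p x)) -> forall t, f t = g t.
Proof.
move=> lf lg fg; apply: tens_eq => // a y.
by have [x ->] := theta_proj_surj y.
Qed.

Lemma Omega_mapM (s t : H) : Φ (smul s t) = Φ s ∙ Φ t.
Proof.
have lr : forall t, linear (fun s : H => Φ (@smul K H s t)).
  by move=> t'; apply: (lin_comp (g := Φ : H -> X)) => //; apply: (lin_bil1 _ hmulb).
have ll : forall s, linear (fun t : H => Φ (@smul K H s t)).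
  by move=> s'; apply: (lin_comp (g := Φ : H -> X)) => //; apply: (lin_bil2 _ hmulb).
move: s; apply: H_eq => [||a x]; [exact: lr | by lin |].
move: t; apply: H_eq => [||b y]; [exact: ll | by lin |].
rewrite !Omega_map_pure [smul _ _](hmul_pure hL) -(tlift_map (f := Φ : H -> X)); last by lin.
transitivity (\sw_(b1, b2 <- hcop b) (inc a ∙ ((inc b1 ∙ φ (tact x b2)) ∙ φ y))).
  apply: eq_tlift => b1 b2; rewrite -theta_proj_act -theta_proj_mul Omega_map_pure.
  by rewrite (sb_incM hX) word_mapM !(gb_mulA bX).
rewrite (tlift_map (f := fun z => inc a ∙ (z ∙ φ y))); last by lin.
by rewrite -word_map_act !(gb_mulA bX).
Qed.

Lemma Omega_map_inc a : Φ (einc a) = inc a.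
Proof. by rewrite (Omega_map_pure a 1) word_map1 (gb_mulx1 bX). Qed.

Lemma Omega_map_one : Φ sone = sone.
Proof. by rewrite -(sb_inc1 hΩ) Omega_map_inc (sb_inc1 hX). Qed.

Lemma Omega_map_deg n (t : H) : sdeg n t -> G n (Φ t).
Proof.
move: t; apply: boson_deg_ind; first by apply: (preim_subspace Φl); apply: grading_sub.
move=> a _ [x dx ->]; rewrite Omega_map_pure -[n]add0n; apply: (gb_mul_deg bX).
  by apply/(sb_inc_image hX); exists a.
exact: word_map_deg.
Qed.

Let word_map_cou x : scou (φ x) = talg_cou x.
Proof.
move: x; apply: (talg_eq (U := K^o)) => [|||v x _].
- by apply: (lin_comp (g := @scou K X : X -> K^o)); [exact: coul | exact: φl].
- exact: (@tcou_scalar K A V).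
- by rewrite word_map1 (gb_cou1 bX) tcou1.
rewrite word_map_step (gb_couM bX) (gb_cou_deg bX (linv_valP v).1) tcouM.
exact: mul0r.
Qed.

Lemma Omega_map_cou (t : H) : scou (Φ t) = scou t.
Proof.
move: t; apply: (H_eq (U := K^o)) => [||a x].
- by apply: (lin_comp (g := @scou K X : X -> K^o)); [exact: coul | exact: Φl].
- exact: (gb_cou_linear bH).
rewrite Omega_map_pure (gb_couM bX) (sb_inc_cou hX) word_map_cou.
by rewrite [RHS](boson_cou_pure hL) theta_proj_cou.
Qed.

Let ΦΦl : linear (tmap (Φ : H -> X) (Φ : H -> X)) := tmap_linear Φl Φl.

Local Notation BM := (braided_mul (@smul K X) (super_flip G)).
Local Notation BMH := (braided_mul (@smul K H) (super_flip (@sdeg K H))).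

Let BM_image (s t : H ⊗ H) : tmap (Φ : H -> X) (Φ : H -> X) (BMH s t) =
  BM (tmap (Φ : H -> X) (Φ : H -> X) s) (tmap (Φ : H -> X) (Φ : H -> X) t).
Proof.
have b1 := braided_mul_bilinear mulb (super_flip_bilinear gG).
have b2 := braided_mul_bilinear (gb_mul_bilinear bH) (super_flip_bilinear gH).
move: s; apply: tens_eq => [||s1 s2].
- exact: (lin_comp ΦΦl (lin_bil1 t b2)).
- exact: (lin_comp (lin_bil1 _ b1) ΦΦl).
move: s2; apply: (hom_eq gH) => [||k s2 d2].
- by apply: (lin_comp ΦΦl); apply: (lin_comp (lin_bil1 t b2)); lin.
- by apply: (lin_comp (lin_bil1 _ b1)); apply: (lin_comp ΦΦl); lin.
move: t; apply: tens_eq => [||t1 t2].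
- exact: (lin_comp ΦΦl (lin_bil2 _ b2)).
- exact: (lin_comp (lin_bil2 _ b1) ΦΦl).
rewrite (flip_mul_hom bH _ _ _ d2) !tmap_pure //.
rewrite (flip_mul_hom bX _ _ _ (Omega_map_deg d2)) !Omega_mapM.
by rewrite (twist_morph (f := Φ : H -> X) k t1 gH gG Φl Omega_map_deg).
Qed.

(** In degree 1 only the bidegrees (1, 0) and (0, 1) occur. The first part is the right coaction,
    and left invariance reduces the second to 1 ⊗ v. *)
Let val_cop (v : V) : Δ (val v) =
  \sw_(w, a <- cmcoact v) val w ⊗ inc a + sone ⊗ val v.
Proof.
have iv := linv_valP v; have incΠ x : G 0%N x -> inc (Π x) = x.
  by move=> Gx; rewrite deg0_partE // (gcomp_hom gG _ Gx).
rewrite (sw_linv_coact (F := fun x a => x ⊗ inc a)); last by lin.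
have <- : \sw_(x1, x2 <- Δ (val v)) inc (Π x1) ⊗ x2 = sone ⊗ val v.
  by rewrite (sw_linv1 hX (F := fun a x => inc a ⊗ x) iv) ?(sb_inc1 hX) //; lin.
rewrite -tliftD -[LHS]tlift_pureE.
have l1 : linear (tlift (fun x1 x2 : X => x1 ⊗ x2)) by lin.
have l2 : linear (tlift (fun x1 x2 : X => x1 ⊗ inc (Π x2) + inc (Π x1) ⊗ x2)) by lin.
move: (Δ (val v)) (scop_span hX iv.1); apply: (lspan_min (eq_linear_subspace l1 l2)).
move=> _ [i [j [y [z [ij dy dz ->]]]]] /=; rewrite !tlift_pure; [|by lin..].
case: i dy ij => [|i] dy.
  rewrite add0n => j1; move: dz; rewrite j1 => dz.
  by rewrite (deg0_part_pos hX dz) (lin0 incl) pure0r add0r incΠ.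
rewrite addSn => -[] /eqP; rewrite addn_eq0 => /andP [_ /eqP j0].
move: dz; rewrite j0 => dz.
by rewrite (deg0_part_pos hX dy) (lin0 incl) pure0l addr0 incΠ.
Qed.

(** Both sides are multiplicative, so they need only be compared on the generators, the elements of
    A and of V; for the latter [val_cop] has the shape of the bosonised coproduct of a primitive
    element. *)
Lemma Omega_map_cop (t : H) : Δ (Φ t) = tmap (Φ : H -> X) (Φ : H -> X) (scop t).
Proof.
have l1 : linear (fun t : H => Δ (Φ t)) by lin.
have l2 : linear (fun t : H => tmap (Φ : H -> X) (Φ : H -> X) (@scop K H t)).
  exact: (lin_comp ΦΦl hcopl).
have copM (s u : H) : Δ (Φ s) = tmap (Φ : H -> X) (Φ : H -> X) (scop s) ->
    Δ (Φ u) = tmap (Φ : H -> X) (Φ : H -> X) (scop u) ->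
    Δ (Φ (smul s u)) = tmap (Φ : H -> X) (Φ : H -> X) (scop (smul s u)).
  by move=> hs hu; rewrite Omega_mapM (gb_copM bX) hs hu -BM_image (gb_copM bH).
have cop_inc a : Δ (Φ (@einc K A Ω a)) = tmap (Φ : H -> X) (Φ : H -> X) (scop (@einc K A Ω a)).
  rewrite Omega_map_inc (sb_inc_cop hX) [X in _ = tmap _ _ X](sb_inc_cop hΩ).
  transitivity (\sw_(a1, a2 <- hcop a) tmap (Φ : H -> X) (Φ : H -> X)
    ((@einc K A Ω a1 : H) ⊗ (@einc K A Ω a2 : H))); last by rewrite (tlift_map _ _ ΦΦl).
  by apply: eq_tlift => a1 a2; rewrite tmap_pure // !Omega_map_inc.
have cop_tin v : Δ (Φ ((1 : A) ⊗ p (tin v) : H)) =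
    tmap (Φ : H -> X) (Φ : H -> X) (scop ((1 : A) ⊗ p (tin v) : H)).
  have Φv (w : V) : Φ ((1 : A) ⊗ p (tin w) : H) = val w.
    by rewrite Omega_map_pure word_map_tin (sb_inc1 hX) (gb_mul1x bX).
  rewrite Φv val_cop; set lhs := LHS.
  have cl : linear (@bcoact K A L) := crossed_coact_linear (bh_crossed hL).
  have lpp : linear (tmap p p) := tmap_linear lp lp.
  have tinl : linear (@tin K V) := @tin_linear K V.
  have tcl := @tcoact_linear K A V.
  rewrite -[X in _ = tmap _ _ X]tlift_pureE [X in _ = tmap _ _ X](sw_Hcop hL); last by lin.
  rewrite sw_hcop1; last by lin.
  rewrite (theta_proj_cop linv_theta_coact) tcop_tin (linD lpp) !tmap_pure //.
  have bF : bilinear (fun x1 x2 : L => \sw_(y, b <- bcoact x1)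
      (((1 : A) ⊗ y) ⊗ ((1 * b) ⊗ x2) : H ⊗ H)) by lin.
  rewrite tliftDr // !tlift_pure // (linD ΦΦl) !(theta_proj_coact linv_theta_coact).
  rewrite !tlift_tmap; [|by lin..].
  rewrite sw_tcoact_tin; last by lin.
  rewrite sw_tcoact1; last by lin.
  rewrite /lhs; congr (_ + _).
    rewrite -(tlift_map _ _ ΦΦl); apply: eq_tlift => w b.
    by rewrite tmap_pure // Φv mul1r Omega_map_pure word_map1 (gb_mulx1 bX).
  by rewrite mulr1 tmap_pure // Φv Omega_map_pure word_map1 (gb_mulx1 bX) (sb_inc1 hX).
move: t; apply: (H_eq l1 l2) => a x.
have -> : (a ⊗ p x : H) = smul (@einc K A Ω a) ((1 : A) ⊗ p x).
  by rewrite [RHS](hmul_pureA hL) mulr1.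
apply: (copM); first exact: cop_inc.
move: x; apply: talg_ind => [||v x IHx].
- apply: (eq_linear_subspace (f := fun x : T => Δ (Φ ((1 : A) ⊗ p x : H)))).
    by apply: (lin_comp l1); lin.
  by apply: (lin_comp l2); lin.
- exact: cop_inc.
have -> : ((1 : A) ⊗ p (tin v * x) : H) = smul ((1 : A) ⊗ p (tin v) : H) ((1 : A) ⊗ p x).
  by rewrite [RHS](hmul_pureB hL) -theta_proj_mul.
exact: copM.
Qed.

Lemma Omega_map_theta : Φ (Omega_theta_elt θV) = θ.
Proof. by rewrite Omega_map_pure word_map_tin (sb_inc1 hX) (gb_mul1x bX). Qed.

(** Both differentials are brackets, and Φ is a graded algebra map carrying one inner element to the
    other. *)
Lemma Omega_map_d (t : Ω) : Φ (ed t) = ed (Φ t).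
Proof.
rewrite iθ.2 (super_bracketE _ bX) [ed t](super_bracketE _ bH) (linB Φl) !Omega_mapM.
rewrite (twist_morph (f := Φ : H -> X) 1 t gH gG Φl Omega_map_deg).
by rewrite Omega_map_theta.
Qed.

Lemma Omega_map_surj (x : X) : exists t, x = Φ t.
Proof.
have sC : is_subspace [set x | exists t, x = Φ t].
  split; first by exists 0; rewrite (lin0 Φl).
  by move=> c _ _ [s ->] [t ->]; exists (c *: (s : H) + (t : H)); rewrite Φl.
have hx : smallest (@is_subalgebra K X) (G 0%N `|` G 1%N) x by rewrite genX.
apply: (hx [set x | exists t, x = Φ t]); split=> [|y [/(sb_inc_image hX) [a ->]|Gy]].
- split=> //; first by exists sone; rewrite Omega_map_one.
  by move=> _ _ [s ->] [t ->]; exists (smul (s : H) t); rewrite Omega_mapM.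
- by exists (einc a); rewrite Omega_map_inc.
(* A 1-form is a sum of products of elements of A with left-invariant 1-forms: terms whose first leg
   has positive degree vanish under Π, and in the others the second leg already has degree 1, so
   inserting [gcomp] is harmless. *)
have -> : y = \sw_(y1, y2 <- Δ y) (inc (Π y1) ∙ P (gcomp G 1 y2)).
  rewrite -[LHS](left_inv_proj_sum hX).
  have gl := gcomp_linear gG 1.
  have l1 : linear (tlift (fun y1 y2 => inc (Π y1) ∙ P y2)) by lin.
  have l2 : linear (tlift (fun y1 y2 => inc (Π y1) ∙ P (gcomp G 1 y2))) by lin.
  move: (Δ y) (scop_span hX Gy); apply: (lspan_min (eq_linear_subspace l1 l2)).
  move=> _ [i [j [u [w [ij du dw ->]]]]] /=; rewrite !tlift_pure; [|by lin..].
  rewrite (gcomp_hom gG _ dw); case: i du ij => [|i] du.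
    by rewrite add0n => ->.
  by rewrite (deg0_part_pos hX du) (lin0 incl) !(lin0 (lin_bil1 _ mulb)).
apply: (subspace_tlift _ sC) => y1 y2.
exists ((Π y1 : A) ⊗ p (tin (linv_proj hX y2 : V)) : H).
by rewrite Omega_map_pure word_map_tin.
Qed.

Lemma Omega_map_ext_morph : is_ext_morph Φ.
Proof.
split; last exact: Omega_map_d.
  split.
  - exact: Φl.
  - exact: Omega_mapM.
  - exact: Omega_map_one.
  - exact: Omega_map_cop.
  - exact: Omega_map_cou.
  - exact: Omega_map_deg.
exact: Omega_map_inc.
Qed.

Lemma inner_iso_to_quotient_of_Omega : is_iso_to_quotient_of X Ω.
Proof. exact: (@iso_to_quotient_by_kernel K A Ω X Φ gH gG Omega_map_ext_morph Omega_map_surj). Qed.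

End InnerUniversal.

Theorem proposition3p10 (K : fieldType) (hK : 2%N \notin [pchar K])
    (A : hopfAlg K) (hS : bijective (@hanti K A)) :
  (forall (V : crossedMod A) (θ : V), cmcoact θ = θ ⊗ 1 ->
     [/\ is_braided_hopf (Lambda_theta θ),
         is_braided_morph (proj (theta_ideal θ) : btalg V -> Lambda_theta θ),
         is_strongly_bicovariant (Omega_theta θ) &
         inner_by (Omega_theta_elt θ : Omega_theta θ)]) /\
  (forall (X : extData A) (θ : X),
     is_strongly_bicovariant X -> inner_by θ ->
     left_invariant θ -> right_invariant θ -> generated_in_deg01 X ->
     exists (V : crossedMod A) (θV : V),
       cmcoact θV = θV ⊗ 1 /\ is_iso_to_quotient_of X (Omega_theta θV)).
Proof.
split=> [V θ coact_theta|X θ hX iθ lθ rθ genX].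
  split.
  - exact: Lambda_theta_braided_hopf.
  - exact: theta_proj_braided_morph.
  - exact: Omega_theta_strongly_bicovariant.
  - exact: Omega_theta_inner.
exists (linv_crossedMod hX), (linv_theta hX iθ lθ).
split; first exact: linv_theta_coact.
exact: inner_iso_to_quotient_of_Omega.
Qed.
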